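(* Let $A\subset B$ be an extension of commutative rings with unity and let ${}^{+}\!A$ denote the subintegral closure of $A$ in $B$. Let $M$ be a positive (commutative, cancellative, torsion-free) monoid. Then: (i) The diagram $$\begin{array}{ccccccccc} 1&\to&\mathcal I(A,{}^{+}\!A)&\to&\mathcal I(A,B)&\xrightarrow{\ \phi(A,{}^{+}\!A,B)\ }&\mathcal I({}^{+}\!A,B)&\to&1\\ &&\downarrow{\scriptstyle\theta(A,{}^{+}\!A)}&&\downarrow{\scriptstyle\theta(A,B)}&&\downarrow{\scriptstyle\theta({}^{+}\!A,B)}&&\\ 1&\to&\mathcal I(A[M],{}^{+}\!A[M])&\to&\mathcal I(A[M],B[M])&\xrightarrow{\ \phi(A[M],{}^{+}\!A[M],B[M])\ }&\mathcal I({}^{+}\!A[M],B[M])&\to&1 \end{array}$$ is commutative with exact rows, and the right vertical map $\theta({}^{+}\!A,B)$ is an isomorphism. (ii) If $\mathbb Q\subset A$, then $\mathcal I(A[M],{}^{+}\!A[M])\cong\mathbb Z[M]\otimes_{\mathbb Z}\mathcal I(A,{}^{+}\!A)$ as abelian groups.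
   Context: All rings are commutative with unity. All monoids are commutative, cancellative and torsion-free (if $x^n=y^n$ for some $n\ge 1$ then $x=y$). A monoid is positive if its group of units is trivial. $A[M]$ denotes the monoid algebra, and ${}^{+}\!A[M]$ means $({}^{+}\!A)[M]$. For a ring extension $A\subset B$, $\mathcal I(A,B)$ is the multiplicative group of invertible $A$-submodules of $B$, i.e. $A$-submodules $I\subset B$ such that $IJ=A$ for some $A$-submodule $J\subset B$. A ring homomorphism $\phi:B\to B'$ with $\phi(A)\subset A'$ induces a group homomorphism $\mathcal I(A,B)\to\mathcal I(A',B')$, sending $I$ to the $A'$-submodule of $B'$ generated by $\phi(I)$. For $R\subset S$, the map $\theta(R,S):\mathcal I(R,S)\to\mathcal I(R[M],S[M])$ is the one induced by the inclusion $S\to S[M]$. For rings $R\subset C\subset S$, the map $\mathcal I(R,C)\to\mathcal I(R,S)$ is the one induced by the inclusion $C\to S$, and $\phi(R,C,S):\mathcal I(R,S)\to\mathcal I(C,S)$ is the one induced by the identity of $S$, i.e. $I\mapsto IC$. An extension $A\subset B$ is elementary subintegral if $B=A[b]$ for some $b$ with $b^2,b^3\in A$; it is subintegral if $B$ is a union of subrings obtained from $A$ by finite successions of elementary subintegral extensions. The subintegral closure of $A$ in $B$ is the largest subintegral extension of $A$ in $B$. *)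

(* Defs.v *)
From HB Require Import structures.
From mathcomp Require Import all_boot all_order all_algebra.
From mathcomp Require Import boolp classical_sets.
From mathcomp Require Import finmap monalg.

Set Implicit Arguments.
Unset Strict Implicit.
Unset Printing Implicit Defensive.

Import GRing.Theory.

Local Open Scope classical_set_scope.
Local Open Scope ring_scope.

(* Ring extensions A ⊂ B are represented as subrings A, B : subringClosed T
   of an ambient commutative ring T with {subset A <= B}. *)

Section Submodules.
Variable T : comNzRingType.
Implicit Types (A B : subringClosed T) (I J K : set T).

Definition is_submod A I : Prop :=
  [/\ I 0, forall x y, I x -> I y -> I (x + y)
    & forall a x, a \in A -> I x -> I (a * x)].

Definition submod_span A (X : set T) : set T := smallest (is_submod A) X.

Definition submod_mul A I J : set T :=
  submod_span A [set z | exists x y, [/\ I x, J y & z = x * y]].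

Definition is_invertible A B I : Prop :=
  [/\ is_submod A I, I `<=` [set` B]
    & exists J, [/\ is_submod A J, J `<=` [set` B]
                  & submod_mul A I J = [set` A]]].

Lemma submod_spanP A X : is_submod A (submod_span A X).
Proof.
split=> [S [[]] //|x y Xx Xy S [SS XS]|a x Aa Xx S [SS XS]].
  by case: (SS) => _ SD _; apply: SD; [apply: Xx|apply: Xy].
by case: (SS) => _ _ SM; apply: SM => //; apply: Xx.
Qed.

Lemma sub_submod_span A X : X `<=` submod_span A X.
Proof. exact: sub_gen_smallest. Qed.

Lemma submod_span_min A X I :
  is_submod A I -> X `<=` I -> submod_span A X `<=` I.
Proof. exact: smallest_sub. Qed.

Lemma submod_mulP A I J : is_submod A (submod_mul A I J).
Proof. exact: submod_spanP. Qed.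

Lemma mem_submod_mul A I J x y : I x -> J y -> submod_mul A I J (x * y).
Proof. by move=> Ix Jy; apply: sub_submod_span; exists x, y. Qed.

Lemma submod_mul_min A I J K : is_submod A K ->
  (forall x y, I x -> J y -> K (x * y)) -> submod_mul A I J `<=` K.
Proof.
by move=> sK IJK; apply: submod_span_min => // _ [x [y [Ix Jy ->]]]; apply: IJK.
Qed.

Lemma is_submod_preim A K y : is_submod A K -> is_submod A [set x | K (x * y)].
Proof.
case=> K0 KD KM; split=> /= [|u v Ku Kv|a u Aa Ku]; first by rewrite mul0r.
- by rewrite mulrDl; apply: KD.
- by rewrite -mulrA; apply: KM.
Qed.

Lemma submod_mulC A I J : submod_mul A I J = submod_mul A J I.
Proof.
by apply/seteqP; split; apply: submod_mul_min; try exact: submod_mulP;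
  move=> x y Ix Jy; rewrite mulrC; apply: mem_submod_mul.
Qed.

Lemma submod_mulA_sub A I J K :
  submod_mul A (submod_mul A I J) K `<=` submod_mul A I (submod_mul A J K).
Proof.
apply: submod_mul_min => [|x y IJx Ky]; first exact: submod_mulP.
apply: (submod_mul_min (is_submod_preim y (@submod_mulP A I _))) IJx.
by move=> u v Iu Jv; rewrite /= -mulrA; do 2!apply: mem_submod_mul => //.
Qed.

Lemma submod_mulA A I J K :
  submod_mul A I (submod_mul A J K) = submod_mul A (submod_mul A I J) K.
Proof.
apply/seteqP; split; last exact: submod_mulA_sub.
rewrite (submod_mulC A I J) submod_mulC (submod_mulC A J K).
by rewrite [X in _ `<=` X]submod_mulC; exact: submod_mulA_sub.
Qed.

Lemma is_submod_ring A B : {subset A <= B} -> is_submod A [set` B].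
Proof.
move=> sAB; split=> /= [|x y|a x Aa]; [exact: rpred0|exact: rpredD|].
by apply: rpredM; apply: sAB.
Qed.

Lemma submod_mul1 A I : is_submod A I -> submod_mul A [set` A] I = I.
Proof.
move=> sI; apply/seteqP; split=> [|x Ix].
  by case: (sI) => _ _ IM; apply: submod_mul_min.
by rewrite -[x]mul1r; apply: mem_submod_mul => //=; apply: rpred1.
Qed.

Lemma sub_submod_mul A B I J : {subset A <= B} ->
  I `<=` [set` B] -> J `<=` [set` B] -> submod_mul A I J `<=` [set` B].
Proof.
move=> sAB sIB sJB; apply: submod_mul_min (is_submod_ring sAB) _ => x y Ix Jy.
by apply: rpredM; [apply: sIB|apply: sJB].
Qed.

Lemma is_invertible_ring A B : {subset A <= B} -> is_invertible A B [set` A].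
Proof.
have sA : is_submod A [set` A] by exact: is_submod_ring.
by move=> sAB; split=> //; exists [set` A]; split=> //; apply: submod_mul1.
Qed.

Lemma is_invertible_mul A B I J : {subset A <= B} ->
  is_invertible A B I -> is_invertible A B J ->
  is_invertible A B (submod_mul A I J).
Proof.
move=> sAB [sI IB [I' [sI' I'B II']]] [sJ JB [J' [sJ' J'B JJ']]].
split; [exact: submod_mulP|exact: sub_submod_mul|].
exists (submod_mul A I' J'); split; [exact: submod_mulP|exact: sub_submod_mul|].
rewrite submod_mulA (submod_mulC A I J) -(submod_mulA A J) II'.
by rewrite -submod_mulA submod_mul1 // JJ'.
Qed.

End Submodules.

(* The group 𝓘(A, B) for A ⊂ B.  It is written additively, abelian groups being
   zmodType's in the library: 0 is A, I + J is the product IJ and - I is the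
   inverse of I. *)
Record invmod (T : comNzRingType) (A B : subringClosed T)
    (sAB : {subset A <= B}) := InvMod {
  invmod_set :> set T;
  invmodP : is_invertible A B invmod_set
}.

Section InvModGroup.
Variables (T : comNzRingType) (A B : subringClosed T).
Variable sAB : {subset A <= B}.
Local Notation invmod := (invmod sAB).
Implicit Types I J K : invmod.

Lemma invmod_inj I J : I = J :> set T -> I = J.
Proof.
by case: I J => [I pI] [J pJ] /= eIJ; subst J; rewrite (Prop_irrelevance pI pJ).
Qed.

HB.instance Definition _ := gen_eqMixin invmod.
HB.instance Definition _ := gen_choiceMixin invmod.

Definition invmod_one : invmod := InvMod sAB (is_invertible_ring sAB).

Definition invmod_mul I J : invmod :=
  InvMod sAB (is_invertible_mul sAB (invmodP I) (invmodP J)).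

Lemma invmod_inv_subproof I :
  exists J : invmod, submod_mul A J I = [set` A].
Proof.
case: (invmodP I) => sI IB [J [sJ JB IJ]].
have invJ : is_invertible A B J.
  by split=> //; exists I; split=> //; rewrite submod_mulC.
by exists (InvMod sAB invJ); rewrite /= submod_mulC.
Qed.

Definition invmod_inv I : invmod := sval (cid (invmod_inv_subproof I)).

Lemma invmod_mulA : associative invmod_mul.
Proof. by move=> I J K; apply: invmod_inj; apply: submod_mulA. Qed.

Lemma invmod_mulC : commutative invmod_mul.
Proof. by move=> I J; apply: invmod_inj; apply: submod_mulC. Qed.

Lemma invmod_mul1 : left_id invmod_one invmod_mul.
Proof.
by move=> I; apply: invmod_inj; apply: submod_mul1; case: (invmodP I).
Qed.

Lemma invmod_mulV : left_inverse invmod_one invmod_inv invmod_mul.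
Proof.
by move=> I; apply: invmod_inj; rewrite /invmod_inv /=; case: cid.
Qed.

HB.instance Definition _ := GRing.isZmodule.Build invmod
  invmod_mulA invmod_mulC invmod_mul1 invmod_mulV.

Lemma invmod0E : (0 : invmod) = [set` A] :> set T. Proof. by []. Qed.

Lemma invmodDE I J : (I + J : invmod) = submod_mul A I J :> set T.
Proof. by []. Qed.

End InvModGroup.

(* The homomorphism 𝓘(A, B) -> 𝓘(A', B') induced by a ring homomorphism phi. *)
Section InvModMap.
Variables (T T' : comNzRingType) (phi : {rmorphism T -> T'}).
Variables (A B : subringClosed T) (A' B' : subringClosed T').
Variables (sAB : {subset A <= B}) (sAB' : {subset A' <= B'}).
Hypothesis phiA : {homo phi : x / x \in A >-> x \in A'}.
Hypothesis phiB : {homo phi : x / x \in B >-> x \in B'}.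

Let span_phi (I : set T) : set T' := submod_span A' (phi @` I).

Lemma is_submod_preim_phi (K : set T') :
  is_submod A' K -> is_submod A (phi @^-1` K).
Proof.
case=> K0 KD KM; split=> /= [|x y|a x Aa Kx]; first by rewrite rmorph0.
- by rewrite rmorphD; apply: KD.
- by rewrite rmorphM; apply: KM => //; apply: phiA.
Qed.

Lemma span_phi_mul (I J : set T) :
  span_phi (submod_mul A I J) = submod_mul A' (span_phi I) (span_phi J).
Proof.
have img K x : K x -> span_phi K (phi x) by move=> Kx; apply: sub_submod_span; exists x.
apply/seteqP; split.
  apply: submod_span_min => [|_ [x IJx <-]]; first exact: submod_mulP.
  move: x IJx; apply: submod_mul_min => [|x y Ix Jy].
    by apply: (is_submod_preim_phi (submod_mulP _ _ _)).
  by rewrite /= rmorphM; apply: mem_submod_mul; apply: img.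
apply: submod_mul_min => [|x y Ix Jy]; first exact: submod_spanP.
have sK : is_submod A' (span_phi (submod_mul A I J)) by exact: submod_spanP.
move: x Ix; apply: (submod_span_min (is_submod_preim y sK)) => _ [x Ix <-] /=.
rewrite mulrC; move: y Jy.
apply: (submod_span_min (is_submod_preim (phi x) sK)) => _ [y Jy <-] /=.
by rewrite mulrC -rmorphM; apply: img; apply: mem_submod_mul.
Qed.

Lemma span_phi_ring : span_phi [set` A] = [set` A'].
Proof.
apply/seteqP; split=> [|x A'x].
  apply: submod_span_min => [|_ [x Ax <-]]; last exact: phiA.
  exact: is_submod_ring.
rewrite -[x]mulr1; case: (submod_spanP A' (phi @` [set` A])) => _ _; apply=> //.
by apply: sub_submod_span; exists 1; rewrite ?rmorph1 //=; apply: rpred1.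
Qed.

Lemma span_phi_sub (I : set T) : I `<=` [set` B] -> span_phi I `<=` [set` B'].
Proof.
move=> IB; apply: submod_span_min => [|_ [x Ix <-]]; first exact: is_submod_ring.
by apply: phiB; apply: IB.
Qed.

Lemma is_invertible_span_phi (I : invmod sAB) : is_invertible A' B' (span_phi I).
Proof.
case: (invmodP I) => sI IB [J [sJ JB IJ]].
split; [exact: submod_spanP|exact: span_phi_sub|].
exists (span_phi J); split; [exact: submod_spanP|exact: span_phi_sub|].
by rewrite -span_phi_mul IJ span_phi_ring.
Qed.

Definition invmod_map (I : invmod sAB) : invmod sAB' :=
  InvMod sAB' (is_invertible_span_phi I).

Lemma invmod_map_morphism : nmod_morphism invmod_map.
Proof.
split=> [|I J]; apply: invmod_inj; first exact: span_phi_ring.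
exact: span_phi_mul.
Qed.

HB.instance Definition _ :=
  GRing.isNmodMorphism.Build (invmod sAB) (invmod sAB') invmod_map
    invmod_map_morphism.

End InvModMap.

Arguments invmod_map {T T'} phi {A B A' B'} sAB sAB' phiA phiB I.

Section Tower.
Variables (T : comNzRingType) (R C S : subringClosed T).
Variables (sRC : {subset R <= C}) (sCS : {subset C <= S}).
Variable sRS : {subset R <= S}.

Lemma homo_idfun (D E : subringClosed T) : {subset D <= E} ->
  {homo (idfun : T -> T) : x / x \in D >-> x \in E}.
Proof. by []. Qed.

Lemma subring_subxx (D : subringClosed T) : {subset D <= D}. Proof. by []. Qed.

(* 𝓘(R, C) -> 𝓘(R, S), induced by the inclusion of C in S *)
Definition invmod_incl : {additive invmod sRC -> invmod sRS} :=
  invmod_map idfun sRC sRS (homo_idfun (@subring_subxx R)) (homo_idfun sCS).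

(* ϕ(R, C, S) : 𝓘(R, S) -> 𝓘(C, S), I |-> IC *)
Definition invmod_phi : {additive invmod sRS -> invmod sCS} :=
  invmod_map idfun sRS sCS (homo_idfun sRC) (homo_idfun (@subring_subxx S)).

Lemma invmod_inclE (I : invmod sRC) : invmod_incl I = I :> set T.
Proof.
apply/seteqP; split=> [|x Ix]; last by apply: sub_submod_span; exists x.
by apply: submod_span_min => [|_ [x Ix <-] //]; case: (invmodP I).
Qed.

Lemma invmod_phiE (I : invmod sRS) :
  invmod_phi I = submod_mul C I [set` C] :> set T.
Proof.
apply/seteqP; split.
  apply: submod_span_min => [|_ [x Ix <-]]; first exact: submod_mulP.
  by rewrite /= -[x in submod_mul _ _ _ x]mulr1; apply: mem_submod_mul => //=; apply: rpred1.
apply: submod_mul_min => [|x c Ix Cc]; first exact: submod_spanP.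
rewrite mulrC; case: (submod_spanP C (idfun @` I)) => _ _; apply=> //.
by apply: sub_submod_span; exists x.
Qed.

End Tower.

(* A[M], as the subring of T[M] of the elements with coefficients in A.
   The units of a monomType are trivial (axiom unitm), so that a conomType is a
   positive commutative monoid. *)
Section MonoidAlgebra.
Variables (T : comNzRingType) (M : conomType).

Definition monalg_sub (A : subringClosed T) : {pred {malg T[M]}} :=
  [pred f | f \is a monalgOver A].

Lemma monalg_subP (A : subringClosed T) (f : {malg T[M]}) :
  reflect (forall m, f@_m \in A) (f \in monalg_sub A).
Proof. exact: monalgOverP. Qed.

Lemma monalg_sub_closed (A : subringClosed T) : subring_closed (monalg_sub A).
Proof.
split=> [|f g /monalg_subP Af /monalg_subP Ag|f g Af Ag].
- exact: monalgOver1.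
- by apply/monalg_subP=> m; rewrite mcoeffB; apply: rpredB.
- exact: (monalgOver_mulr_closed M A).2.
Qed.

HB.instance Definition _ (A : subringClosed T) :=
  GRing.isSubringClosed.Build {malg T[M]} (monalg_sub A) (monalg_sub_closed A).

Lemma sub_monalg (A B : subringClosed T) : {subset A <= B} ->
  {subset (monalg_sub A : subringClosed {malg T[M]}) <=
          (monalg_sub B : subringClosed {malg T[M]})}.
Proof. by move=> sAB; apply: monalgOverS. Qed.

Lemma homo_malgC (A : subringClosed T) :
  {homo @malgC M T : x / x \in A >->
      x \in (monalg_sub A : subringClosed {malg T[M]})}.
Proof. by move=> x Ax; rewrite inE monalgOverC. Qed.

(* θ(R, S) : 𝓘(R, S) -> 𝓘(R[M], S[M]) *)
Definition invmod_theta (R S : subringClosed T) (sRS : {subset R <= S}) :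
    {additive invmod sRS -> invmod (sub_monalg sRS)} :=
  invmod_map (@malgC M T) sRS (sub_monalg sRS) (@homo_malgC R) (@homo_malgC S).

Definition cancellative_monoid : Prop :=
  forall x y z : M, mmul x y = mmul x z -> y = z.

Definition torsion_free_monoid : Prop :=
  forall (x y : M) (n : nat), (0 < n)%N ->
    iter n (mmul x) (mone : M) = iter n (mmul y) (mone : M) -> x = y.

End MonoidAlgebra.

Section Subintegral.
Variable T : comNzRingType.
Implicit Types A B C D E : subringClosed T.

(* D = C[b] with b^2, b^3 in C *)
Definition elementary_subintegral C D : Prop :=
  exists b, [/\ b ^+ 2 \in C, b ^+ 3 \in C
    & forall x, x \in D <-> exists2 p : {poly T}, p \is a polyOver C & x = p.[b]].

Inductive finitely_subintegral A : subringClosed T -> Prop :=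
| finitely_subintegral_refl : finitely_subintegral A A
| finitely_subintegral_step C D :
    finitely_subintegral A C -> elementary_subintegral C D ->
    finitely_subintegral A D.

Definition subintegral A D : Prop :=
  forall x, x \in D <->
    exists C, [/\ finitely_subintegral A C, {subset C <= D} & x \in C].

Definition is_subintegral_closure A B C : Prop :=
  [/\ {subset C <= B}, subintegral A C
    & forall D, {subset D <= B} -> subintegral A D -> {subset D <= C}].

Section Adjoin.
Variables (C : subringClosed T) (b : T).

Definition adjoin : {pred T} :=
  [pred x | `[< exists2 p : {poly T}, p \is a polyOver C & x = p.[b] >]].

Lemma adjoin_closed : subring_closed adjoin.
Proof.
split=> [|x y|x y].
- by apply/asboolP; exists 1; rewrite ?hornerE ?rpred1.
- move=> /asboolP[p Cp ->] /asboolP[q Cq ->]; apply/asboolP.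
  by exists (p - q); rewrite ?hornerE ?rpredB.
- move=> /asboolP[p Cp ->] /asboolP[q Cq ->]; apply/asboolP.
  by exists (p * q); rewrite ?hornerM ?rpredM.
Qed.

HB.instance Definition _ := GRing.isSubringClosed.Build T adjoin adjoin_closed.

End Adjoin.

Lemma finitely_subintegral_sub A D :
  finitely_subintegral A D -> {subset A <= D}.
Proof.
elim=> // C E _ sAC [b [_ _ EP]] x Ax; apply/EP.
by exists x%:P; rewrite ?hornerC // polyOverC sAC.
Qed.

Lemma finitely_subintegral_join A B D E :
  finitely_subintegral A D -> {subset D <= B} ->
  finitely_subintegral A E -> {subset E <= B} ->
  exists F, [/\ finitely_subintegral A F, {subset F <= B},
                {subset D <= F} & {subset E <= F}].
Proof.
move=> fD sDB; elim=> [_|C E' _ IH [b [b2 b3 EP]] sEB].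
  by exists D; split=> //; apply: finitely_subintegral_sub.
have sCE : {subset C <= E'}.
  by move=> x Cx; apply/EP; exists x%:P; rewrite ?hornerC // polyOverC.
have [x /sCE/sEB//|F [fF sFB sDF sCF]] := IH.
have Bb : b \in B by apply/sEB/EP; exists 'X; rewrite ?hornerX // polyOverX.
have sFb : {subset F <= adjoin F b}.
  by move=> x Fx; apply/asboolP; exists x%:P; rewrite ?hornerC // polyOverC.
exists (adjoin F b : subringClosed T); split.
- apply: (finitely_subintegral_step fF); exists b.
  split; [exact: sCF|exact: sCF|].
  by move=> x; split=> [/asboolP|?]; last apply/asboolP.
- move=> _ /asboolP[p /polyOverP Fp ->].
  by rewrite horner_coef rpred_sum // => i _; rewrite rpredM ?rpredX // sFB.
- by move=> x /sDF/sFb.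
- move=> x /EP[p Cp ->]; apply/asboolP; exists p => //.
  by apply: polyOverS Cp.
Qed.

Section Existence.
Variables (A B : subringClosed T) (sAB : {subset A <= B}).

Let closure : {pred T} :=
  [pred x | `[< exists C, [/\ finitely_subintegral A C, {subset C <= B}
                            & x \in C] >]].

Let closure_closed : subring_closed closure.
Proof.
split=> [|x y|x y].
- by apply/asboolP; exists A; split=> //; [left|exact: rpred1].
- move=> /asboolP[D [fD sDB Dx]] /asboolP[E [fE sEB Ey]]; apply/asboolP.
  have [F [fF sFB sDF sEF]] := finitely_subintegral_join fD sDB fE sEB.
  by exists F; split=> //; apply: rpredB; [apply: sDF|apply: sEF].
- move=> /asboolP[D [fD sDB Dx]] /asboolP[E [fE sEB Ey]]; apply/asboolP.
  have [F [fF sFB sDF sEF]] := finitely_subintegral_join fD sDB fE sEB.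
  by exists F; split=> //; apply: rpredM; [apply: sDF|apply: sEF].
Qed.

HB.instance Definition _ := GRing.isSubringClosed.Build T closure closure_closed.

Lemma subintegral_closure_exists :
  exists C, {subset A <= C} /\ is_subintegral_closure A B C.
Proof.
exists (closure : subringClosed T); split.
  by move=> x Ax; apply/asboolP; exists A; split=> //; left.
split.
- by move=> x /asboolP[C [_ sCB /sCB]].
- move=> x; split=> [/asboolP[C [fC sCB Cx]]|[C [_ sC /sC]] //].
  by exists C; split=> // y Cy; apply/asboolP; exists C.
- move=> D sDB DP x /DP[C [fC sCD Cx]]; apply/asboolP; exists C; split=> //.
  by move=> y /sCD/sDB.
Qed.

End Existence.
End Subintegral.

(* U ⊗ V over the integers: the quotient of the free abelian group on U × V by
   the subgroup generated by the biadditivity relations. *)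
Section Tensor.
Variables U V : zmodType.
Local Notation free := {malg int[(U * V)%type]}.

Definition tensor_relation : set free :=
  [set r | (exists u u' v, r = << (u + u', v) >> - << (u, v) >> - << (u', v) >>)
        \/ (exists u v v', r = << (u, v + v') >> - << (u, v) >> - << (u, v') >>)].

Definition is_subgroup (S : set free) : Prop :=
  S 0 /\ forall x y, S x -> S y -> S (x - y).

Definition tensor_kernel : {pred free} :=
  [pred x | `[< smallest is_subgroup tensor_relation x >]].

Lemma tensor_kernel_closed : zmod_closed tensor_kernel.
Proof.
split=> [|x y /asboolP kx /asboolP ky]; apply/asboolP=> S.
  by case=> -[].
by move=> gS; case: (gS) => -[_ SB] _; apply: SB; [exact: kx|exact: ky].
Qed.

HB.instance Definition _ :=
  GRing.isZmodClosed.Build free tensor_kernel tensor_kernel_closed.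

Definition tensor : zmodType := Quotient.quot (tensor_kernel : zmodClosed free).

End Tensor.

Definition short_exact (U V W : zmodType)
    (f : {additive U -> V}) (g : {additive V -> W}) : Prop :=
  [/\ injective f, range f = g @^-1` [set 0] & range g = setT].

(* Main.v *)
Require Import Defs.
From HB Require Import structures.
From mathcomp Require Import all_boot all_order all_algebra.
From mathcomp Require Import boolp classical_sets.
From mathcomp Require Import finmap monalg.
From mathcomp Require Import ring lra zify.

Set Implicit Arguments.
Unset Strict Implicit.
Unset Printing Implicit Defensive.

Import GRing.Theory.
Local Open Scope ring_scope.

(* Rows.  An elementary subintegral extension is C = A + bA with b^2 C contained in
   A, so modulo b^2 C the element b is nilpotent and an invertible C-submodule of B
   can be lifted to A by an explicit change of generators; a finite tower is handled
   step by step, and a subintegral extension is a union of finite towers.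

   Right vertical map.  Let A be subintegrally closed in B and let I in I(A[M], B[M])
   be trivial at the augmentation.  A weight function, injective and additive on the
   finitely many monomials involved (Gordan's theorem, using that M is positive,
   cancellative and torsion-free), reduces to M = N.  By Dedekind-Mertens the
   coefficients of I generate a finite A-algebra C.  Its conductor c is a radical ideal
   of C; if c is proper, localise at a minimal prime of c.  Then A/c becomes a field
   K and C/c a reduced ring L, the rank one projective K[t]-module I is free, its
   generator is a unit of L[t], hence constant, so the coefficients of I lie in K and
   c meets the complement of the prime, a contradiction.

   Part (ii).  When Q is contained in A, each I in I(A[t], C[t]) is stable under
   d/dt - p for a p in C[t] which is unique modulo A[t], and p determines I up to
   I(0).  For subintegral C every p occurs (for C = A + bA take the model
   (1 + b Q) A[t] + b^2 C[t] of exp(b Q)); the path with p = c constant is exp(ct),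
   and its value at t = 1 gives an isomorphism from C / A onto I(A, C).  Applied to
   A[M] and C[M] as well, this turns the claim into the coefficientwise decomposition
   of C[M] / A[M]. *)

(** * Invertible submodules *)

Section SubmoduleTheory.
Local Open Scope classical_set_scope.
Local Open Scope ring_scope.
Variable T : comNzRingType.
Implicit Types (A B : subringClosed T).

(** Invertible submodules are handled through dual families: x_i, y_i with all x_i y_j in A and sum
    x_i y_i = 1 determine the module over every subring that contains the products. This allows
    descent to a finite stage of a subintegral extension, and it makes weights usable: a weight is
    additive only on finitely many monomials, so it gives no ring map on T[M], but it respects the
    few products that occur in a dual pair. No quotient or localisation is formed either: K and L
    become congruences modulo an ideal N of C, at the price of denominators d in A outside N.
    Subintegral closedness enters through the radicality of the conductor: if z^2 lies in it, then
    (zd)^2 and (zd)^3 lie in A for every d in C. In part (ii) the obstacle is that exp c has no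
    meaning as an element, since c need not be nilpotent; only the submodule it would generate
    exists. A differential equation replaces the series because it is compatible with products,
    inverses and change of the base ring. *)

Lemma submod0 A (I : set T) : is_submod A I -> I 0. Proof. by case. Qed.

Lemma submodD A (I : set T) x y : is_submod A I -> I x -> I y -> I (x + y).
Proof. by case=> _ ID _; apply: ID. Qed.

Lemma submodZ A (I : set T) a x : is_submod A I -> a \in A -> I x -> I (a * x).
Proof. by case=> _ _; apply. Qed.

Lemma submodN A (I : set T) x : is_submod A I -> I x -> I (- x).
Proof. by move=> sI Ix; rewrite -mulN1r; apply: (submodZ sI); rewrite ?rpredN1. Qed.

Lemma submodB A (I : set T) x y : is_submod A I -> I x -> I y -> I (x - y).
Proof. by move=> sI Ix Iy; apply: (submodD sI) => //; apply: submodN sI _. Qed.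

Lemma submod_sum A (I : set T) (L : Type) (r : seq L) (P : pred L) (F : L -> T) :
  is_submod A I -> (forall i, P i -> I (F i)) -> I (\sum_(i <- r | P i) F i).
Proof.
by move=> sI IF; elim/big_ind: _ => //; [exact: submod0 sI|move=> *; exact: (submodD sI)].
Qed.

Lemma submod_mul_seq A (I J : set T) z : is_submod A I -> submod_mul A I J z ->
  exists2 s : seq (T * T), (forall p, p \in s -> I p.1 /\ J p.2) &
    z = \sum_(p <- s) p.1 * p.2.
Proof.
move=> sI; move: z.
apply: (@submod_mul_min _ A I J [set z | exists2 s : seq (T * T),
  (forall p, p \in s -> I p.1 /\ J p.2) & z = \sum_(p <- s) p.1 * p.2]) => [|x y Ix Jy];
  last first.
  by exists [:: (x, y)]; [move=> p; rewrite inE => /eqP->|rewrite big_seq1].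
split=> [|x y [s sP ->] [s' sP' ->]|a x Aa [s sP ->]].
- by exists [::]; rewrite ?big_nil.
- exists (s ++ s'); last by rewrite big_cat.
  by move=> p; rewrite mem_cat => /orP[/sP|/sP'].
- exists [seq (a * p.1, p.2) | p <- s].
    by move=> _ /mapP[p /sP[Ip Jp] ->]; split=> //; apply: submodZ sI _ _.
  by rewrite big_map mulr_sumr; apply: eq_bigr => p _; rewrite mulrA.
Qed.

Lemma submod_mul_sum A (I J : set T) z : is_submod A I -> submod_mul A I J z ->
  exists n (x y : 'I_n -> T),
    [/\ forall i, I (x i), forall i, J (y i) & z = \sum_i x i * y i].
Proof.
move=> sI /(submod_mul_seq sI)[s sP ->].
exists (size s), (fun i => (tnth (in_tuple s) i).1), (fun i => (tnth (in_tuple s) i).2).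
by split=> [i|i|]; [case: (sP _ (mem_tnth i (in_tuple s)))..|rewrite big_tnth].
Qed.

Lemma is_invertible_crit A B (I J : set T) : {subset A <= B} ->
    is_submod A I -> (I `<=` [set` B])%classic ->
    is_submod A J -> (J `<=` [set` B])%classic ->
    (forall x y, I x -> J y -> x * y \in A) -> submod_mul A I J 1 ->
  is_invertible A B I.
Proof.
move=> sAB sI IB sJ JB IJA IJ1; split=> //; exists J; split=> //.
apply/seteqP; split=> [|x Ax]; first exact: submod_mul_min (is_submod_ring _) _.
by rewrite -[x]mulr1; apply: (submodZ (submod_mulP _ _ _)).
Qed.

Section Invmod.
Variables (A B : subringClosed T) (sAB : {subset A <= B}).
Implicit Types I J K : invmod sAB.

Lemma invmod_submod I : is_submod A I. Proof. by case: (invmodP I). Qed.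

Lemma invmod_subB I x : invmod_set I x -> x \in B.
Proof. by case: (invmodP I) => _ IB _ /IB. Qed.

Lemma invmod_mulVE I : submod_mul A I (- I) = [set` A].
Proof. by rewrite -[RHS](invmod0E sAB) -(addrN I). Qed.

Lemma invmod_mul_mem I x y : invmod_set I x -> invmod_set (- I) y -> x * y \in A.
Proof.
move=> Ix Iy; have: submod_mul A I (- I) (x * y) by apply: mem_submod_mul.
by rewrite invmod_mulVE.
Qed.

Lemma invmod_dual_basis I : exists n (x y : 'I_n -> T),
  [/\ forall i, invmod_set I (x i), forall i, invmod_set (- I) (y i)
    & \sum_i x i * y i = 1].
Proof.
have: submod_mul A I (- I) 1 by rewrite invmod_mulVE /=; apply: rpred1.
case/(submod_mul_sum (invmod_submod I))=> n [x [y [Ix Iy ->]]].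
by exists n, x, y.
Qed.

(** An invertible module is the colon of its inverse: expand [z] along a dual basis. *)
Lemma mem_invmod I z :
  (forall y, invmod_set (- I) y -> z * y \in A) -> invmod_set I z.
Proof.
move=> zA; have [n [x [y [Ix Iy xy1]]]] := invmod_dual_basis I.
rewrite -[z]mulr1 -xy1 mulr_sumr; apply: (submod_sum _ (invmod_submod I)) => i _.
by rewrite mulrCA mulrC; apply: (submodZ (invmod_submod I)) => //; apply: zA.
Qed.

Lemma invmod_eq I J : (forall x, invmod_set I x -> invmod_set J x) ->
  (forall x, invmod_set (- I) x -> invmod_set (- J) x) -> I = J.
Proof.
move=> IJ IJ'; apply: invmod_inj; apply/seteqP; split=> // x Jx.
apply: mem_invmod => y /IJ'; exact: invmod_mul_mem.
Qed.

Lemma invmod_inv_uniq I (J : set T) : is_submod A J ->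
  (forall x y, invmod_set I x -> J y -> x * y \in A) -> submod_mul A I J 1 ->
  invmod_set (- I) = J.
Proof.
move=> sJ IJA IJ1; have [n [x [y [Ix Jy e1]]]] := submod_mul_sum (invmod_submod I) IJ1.
apply/seteqP; split=> z zP; last first.
  by apply: mem_invmod => w; rewrite opprK mulrC => Iw; apply: IJA.
rewrite -[z]mulr1 e1 mulr_sumr; apply: (submod_sum _ sJ) => i _.
by rewrite mulrA; apply: (submodZ sJ) => //; rewrite mulrC; apply: invmod_mul_mem zP.
Qed.

Lemma invmod_eq0 I : (forall x, invmod_set I x -> x \in A) ->
  (forall x, invmod_set (- I) x -> x \in A) -> I = 0.
Proof. by move=> IA IA'; apply: invmod_eq => x; [exact: IA|rewrite oppr0; exact: IA']. Qed.

(** A dual pair pins down the module: each of its elements expands along [x] with coefficients in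
    [A]. *)
Lemma invmod_eq_dual n (x y : 'I_n -> T) I J : \sum_i x i * y i = 1 ->
  (forall i, invmod_set I (x i) /\ invmod_set (- I) (y i)) ->
  (forall i, invmod_set J (x i) /\ invmod_set (- J) (y i)) -> I = J.
Proof.
move=> xy1 xyI xyJ; apply: invmod_eq => z Iz; rewrite -[z]mulr1 -xy1 mulr_sumr.
  apply: (submod_sum _ (invmod_submod J)) => i _; rewrite mulrCA mulrC.
  case: (xyI i) (xyJ i) => _ Iy [Jx _].
  by apply: (submodZ (invmod_submod J)) => //; apply: invmod_mul_mem Iz Iy.
apply: (submod_sum _ (invmod_submod (- J))) => i _; rewrite mulrA [z * _]mulrC.
case: (xyI i) (xyJ i) => Ix _ [_ Jy].
by apply: (submodZ (invmod_submod (- J))) => //; apply: invmod_mul_mem Ix Iz.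
Qed.

(** The spans of [x] and [y] are inverse to each other. Applied to a smaller ring that still
    contains the products [x i * y j], this descends an invertible module. *)
Lemma invmod_of_dual n (x y : 'I_n -> T) :
  (forall i, x i \in B) -> (forall i, y i \in B) ->
  (forall i j, x i * y j \in A) -> \sum_i x i * y i = 1 ->
  exists I, forall i, invmod_set I (x i) /\ invmod_set (- I) (y i).
Proof.
move=> Bx By xyA xy1.
pose X := submod_span A (range x); pose Y := submod_span A (range y).
have sX : is_submod A X := submod_spanP A _.
have sY : is_submod A Y := submod_spanP A _.
have Xx i : X (x i) by apply: sub_submod_span; exists i.
have Yy i : Y (y i) by apply: sub_submod_span; exists i.
have XB : X `<=` [set` B].
  by apply: submod_span_min => [|_ [i _ <-] //=]; apply: is_submod_ring.
have YB : Y `<=` [set` B].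
  by apply: submod_span_min => [|_ [i _ <-] //=]; apply: is_submod_ring.
have sA := is_submod_ring (fun x Ax => Ax : x \in A).
have XYA u v : X u -> Y v -> u * v \in A.
  move=> Xu Yv; move: u Xu.
  apply: (submod_span_min (is_submod_preim v sA)) => _ [i _ <-] /=.
  rewrite mulrC; move: v Yv.
  apply: (submod_span_min (is_submod_preim (x i) sA)) => _ [j _ <-] /=.
  by rewrite mulrC.
have XY1 : submod_mul A X Y 1.
  rewrite -xy1; apply: (submod_sum _ (submod_mulP A X Y)) => i _.
  by apply: mem_submod_mul.
pose I : invmod sAB := InvMod sAB (is_invertible_crit sAB sX XB sY YB XYA XY1).
have eY : invmod_set (- I) = Y by apply: invmod_inv_uniq.
by exists I => i; rewrite eY; split; [exact: Xx|exact: Yy].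
Qed.

End Invmod.

(** The commuting squares used later reduce to this: composites induced by the same ring map
    agree. *)
Lemma invmod_map_comp (T1 T2 T3 : comNzRingType)
    (f : {rmorphism T1 -> T2}) (g : {rmorphism T2 -> T3}) (h : {rmorphism T1 -> T3})
    (A1 B1 : subringClosed T1) (A2 B2 : subringClosed T2) (A3 B3 : subringClosed T3)
    (s1 : {subset A1 <= B1}) (s2 : {subset A2 <= B2}) (s3 : {subset A3 <= B3})
    fA fB gA gB hA hB : (forall x, g (f x) = h x) ->
  forall I, invmod_map g s2 s3 gA gB (invmod_map f s1 s2 fA fB I) =
            invmod_map h s1 s3 hA hB I.
Proof.
move=> gfh I; apply: invmod_inj; rewrite /=.
apply/seteqP; split; apply: submod_span_min; try exact: submod_spanP.
  move=> _ [x Ix <-]; move: x Ix.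
  suff: submod_span A2 (f @` I) `<=` g @^-1` submod_span A3 (h @` I) by apply.
  apply: submod_span_min; first exact: (is_submod_preim_phi gA (submod_spanP _ _)).
  by move=> _ [x Ix <-]; apply: sub_submod_span; exists x; rewrite ?gfh.
by move=> _ [x Ix <-]; rewrite -gfh; apply: sub_submod_span; exists (f x) => //;
  apply: sub_submod_span; exists x.
Qed.

Section MapTheory.
Variables (T' : comNzRingType) (phi : {rmorphism T -> T'}).
Variables (A B : subringClosed T) (A' B' : subringClosed T').
Variables (sAB : {subset A <= B}) (sAB' : {subset A' <= B'}).
Variables (phiA : {homo phi : x / x \in A >-> x \in A'}).
Variables (phiB : {homo phi : x / x \in B >-> x \in B'}).
Implicit Types I : invmod sAB.

Lemma mem_invmod_map I x : invmod_set I x ->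
  invmod_set (invmod_map phi sAB sAB' phiA phiB I) (phi x).
Proof. by move=> Ix; apply: sub_submod_span; exists x. Qed.

Lemma invmod_map_min I (K : set T') : is_submod A' K ->
  (forall x, invmod_set I x -> K (phi x)) ->
  forall z, invmod_set (invmod_map phi sAB sAB' phiA phiB I) z -> K z.
Proof. by move=> sK IK; apply: submod_span_min => // _ [x /IK Kx <-]. Qed.

End MapTheory.

End SubmoduleTheory.

(** * Lifting invertible modules along subintegral extensions *)

Section Subintegrality.
Variable T : comNzRingType.
Local Open Scope classical_set_scope.
Local Open Scope ring_scope.
Implicit Types (A B C D : subringClosed T) (b : T).

(** All powers of [b] from the second on lie in [A], so that [A[b]] is just [A + A b]; this linear
    form replaces polynomials in [b]. *)
Definition quad_ext A C b : Prop := [/\ b ^+ 2 \in A, b ^+ 3 \in A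
  & forall x, x \in C <-> exists c0 c1, [/\ c0 \in A, c1 \in A & x = c0 + c1 * b]].

Lemma expr_ge2_mem A b k : b ^+ 2 \in A -> b ^+ 3 \in A -> (1 < k)%N -> b ^+ k \in A.
Proof.
move=> b2 b3; elim/ltn_ind: k => -[|[|[|[|k]]]] // IH _.
by rewrite -[k.+4]/(2 + k.+2)%N exprD rpredM // IH.
Qed.

Lemma horner_quad A b (p : {poly T}) : b ^+ 2 \in A -> b ^+ 3 \in A ->
  p \is a polyOver A ->
  exists c0 c1, [/\ c0 \in A, c1 \in A & p.[b] = c0 + c1 * b].
Proof.
move=> b2 b3 /polyOverP Ap.
exists (p`_0 + \sum_(2 <= i < (size p).+2) p`_i * b ^+ i), p`_1; split=> //.
  rewrite rpredD // big_seq rpred_sum // => i; rewrite mem_index_iota => /andP[i2 _].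
  by rewrite rpredM // expr_ge2_mem.
rewrite (@horner_coef_wide _ (size p).+2); last by rewrite -addn2 leq_addr.
rewrite -(big_mkord xpredT (fun i => p`_i * b ^+ i)) big_ltn // big_ltn //.
by rewrite expr0 expr1 mulr1; ring.
Qed.

Lemma elementary_quad A C :
  elementary_subintegral A C <-> exists b, quad_ext A C b.
Proof.
have lin b c0 c1 : c0 \in A -> c1 \in A ->
    exists2 p : {poly T}, p \is a polyOver A & c0 + c1 * b = p.[b].
  move=> Ac0 Ac1; exists (c0%:P + c1 *: 'X); last by rewrite !hornerE.
  by rewrite rpredD ?polyOverC // polyOverZ // polyOverX.
split=> -[b [b2 b3 CP]]; exists b; split=> // x.
  split=> [/CP[p Ap ->]|[c0 [c1 [Ac0 Ac1 ->]]]]; first exact: horner_quad.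
  by apply/CP; apply: lin.
split=> [/CP[c0 [c1 [Ac0 Ac1 ->]]]|[p Ap ->]]; first exact: lin.
by apply/CP; apply: horner_quad.
Qed.

Section QuadExt.
Variables (A C : subringClosed T) (b : T).
Hypothesis ACb : quad_ext A C b.

Lemma quad_ext_sub : {subset A <= C}.
Proof.
case: ACb => _ _ CP x Ax; apply/CP; exists x, 0.
by rewrite rpred0 mul0r addr0; split.
Qed.

Lemma quad_ext_gen : b \in C.
Proof.
by case: ACb => _ _ CP; apply/CP; exists 0, 1; rewrite rpred0 rpred1 mul1r add0r; split.
Qed.

(** This makes errors of second order in [b] harmless: they lie in [A] whatever their cofactor in
    [C]. *)
Lemma quad_ext_cond c : c \in C -> b ^+ 2 * c \in A.
Proof.
case: ACb => b2 b3 CP /CP[c0 [c1 [Ac0 Ac1 ->]]].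
have ->: b ^+ 2 * (c0 + c1 * b) = b ^+ 2 * c0 + b ^+ 3 * c1 by ring.
by rewrite rpredD // rpredM.
Qed.

(* With x, y dual bases of J, write the idempotent (x_i y_j) as a + b a' over A.
   The vectors a x and y a then generate, together with b^2 J and b^2 J^-1, an
   inverse pair over A: mod b^2 C one has (a x)(y a) = a^2. *)
Lemma quad_ext_phi_surj (B : subringClosed T)
    (sAC : {subset A <= C}) (sCB : {subset C <= B}) (sAB : {subset A <= B})
    (J : invmod sCB) :
  exists I : invmod sAB, invmod_phi sAC sCB sAB I = J.
Proof.
have Cb := quad_ext_gen; have condA := quad_ext_cond.
case: ACb => b2 b3 CP.
have Bb : b \in B by apply: (sCB).
have [n [x [y [Jx Jy xy1]]]] := invmod_dual_basis J.
have sJ := invmod_submod J; have sJ' := invmod_submod (- J).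
have JJ u v : invmod_set J u -> invmod_set (- J) v -> u * v \in C by apply: invmod_mul_mem.
have /choice[a aP] : forall p : 'I_n * 'I_n, exists q : T * T,
    [/\ q.1 \in A, q.2 \in A & x p.1 * y p.2 = q.1 + q.2 * b].
  move=> [i j] /=; have /CP[c0 [c1 ?]] := JJ _ _ (Jx i) (Jy j).
  by exists (c0, c1).
pose z i := \sum_j (a (i, j)).2 * x j; pose w j := \sum_i (a (i, j)).2 * y i.
have Jz i : invmod_set J (z i).
  by apply: (submod_sum _ sJ) => j _; apply: (submodZ sJ) => //; apply: sAC; case: (aP (i, j)).
have Jw j : invmod_set (- J) (w j).
  by apply: (submod_sum _ sJ') => i _; apply: (submodZ sJ') => //; apply: sAC; case: (aP (i, j)).
pose xt i := x i - b * z i; pose yt j := y j - b * w j.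
have Jxt i : invmod_set J (xt i) by apply: (submodB sJ) => //; apply: (submodZ sJ).
have Jyt j : invmod_set (- J) (yt j) by apply: (submodB sJ') => //; apply: (submodZ sJ').
have xytA i j : xt i * yt j \in A.
  have e1 : \sum_k (x i * y k) * (x k * y j) = x i * y j.
    rewrite -[RHS]mul1r -xy1 mulr_suml; apply: eq_bigr => k _; ring.
  have e2 : \sum_k ((a (i, k)).2 * x k) * y j = z i * y j by rewrite -mulr_suml.
  have e3 : \sum_k x i * ((a (k, j)).2 * y k) = x i * w j by rewrite -mulr_sumr.
  have e4 : \sum_k (a (i, k)).1 * (a (k, j)).1 = x i * y j - b * (z i * y j)
      - b * (x i * w j) + \sum_k b ^+ 2 * ((a (i, k)).2 * (a (k, j)).2).
    rewrite -e1 -e2 -e3 !mulr_sumr -!sumrB -big_split; apply: eq_bigr => k _ /=.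
    case: (aP (i, k)) => _ _ /=; case: (aP (k, j)) => _ _ /= E1 E2.
    have -> : (a (i, k)).1 = x i * y k - (a (i, k)).2 * b by rewrite E2; ring.
    have -> : (a (k, j)).1 = x k * y j - (a (k, j)).2 * b by rewrite E1; ring.
    ring.
  have -> : xt i * yt j = \sum_k (a (i, k)).1 * (a (k, j)).1
      - \sum_k b ^+ 2 * ((a (i, k)).2 * (a (k, j)).2) + b ^+ 2 * (z i * w j).
    by rewrite e4 /xt /yt; ring.
  apply: rpredD; last by apply: condA; apply: JJ.
  apply: rpredB; apply: rpred_sum => k _;
    case: (aP (i, k)) => A1 A2 _; case: (aP (k, j)) => A3 A4 _; first exact: rpredM.
  by apply: rpredM => //; apply: rpredM.
pose I := [set u | exists c v, [/\ forall i : 'I_n, c i \in A, invmod_set J v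
  & u = \sum_i c i * xt i + b ^+ 2 * v]].
pose I' := [set u | exists c v, [/\ forall i : 'I_n, c i \in A, invmod_set (- J) v
  & u = \sum_i c i * yt i + b ^+ 2 * v]].
have sI : is_submod A I.
  split=> [|_ _ [c [v [Ac Jv ->]]] [d [v' [Ad Jv' ->]]]|e _ Ae [c [v [Ac Jv ->]]]].
  - exists (fun=> 0), 0; split=> [i||]; rewrite ?rpred0 //; first exact: submod0 sJ.
    by rewrite big1 ?mulr0 ?addr0 // => i; rewrite mul0r.
  - exists (fun i => c i + d i), (v + v'); split=> [i||]; first by rewrite rpredD.
      exact: (submodD sJ).
    under [in RHS]eq_bigr do rewrite mulrDl.
    by rewrite big_split /=; ring.
  - exists (fun i => e * c i), (e * v); split=> [i||]; first by rewrite rpredM.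
      by apply: (submodZ sJ) => //; apply: sAC.
    by under [in RHS]eq_bigr do rewrite -mulrA; rewrite -mulr_sumr; ring.
have sI' : is_submod A I'.
  split=> [|_ _ [c [v [Ac Jv ->]]] [d [v' [Ad Jv' ->]]]|e _ Ae [c [v [Ac Jv ->]]]].
  - exists (fun=> 0), 0; split=> [i||]; rewrite ?rpred0 //; first exact: submod0 sJ'.
    by rewrite big1 ?mulr0 ?addr0 // => i; rewrite mul0r.
  - exists (fun i => c i + d i), (v + v'); split=> [i||]; first by rewrite rpredD.
      exact: (submodD sJ').
    under [in RHS]eq_bigr do rewrite mulrDl.
    by rewrite big_split /=; ring.
  - exists (fun i => e * c i), (e * v); split=> [i||]; first by rewrite rpredM.
      by apply: (submodZ sJ') => //; apply: sAC.
    by under [in RHS]eq_bigr do rewrite -mulrA; rewrite -mulr_sumr; ring.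
have IJ u : I u -> invmod_set J u.
  move=> [c [v [Ac Jv ->]]]; apply: (submodD sJ); last by apply: (submodZ sJ) => //; apply: sAC.
  by apply: (submod_sum _ sJ) => i _; apply: (submodZ sJ) => //; apply: sAC.
have IJ' u : I' u -> invmod_set (- J) u.
  move=> [c [v [Ac Jv ->]]]; apply: (submodD sJ'); last by apply: (submodZ sJ') => //; apply: sAC.
  by apply: (submod_sum _ sJ') => i _; apply: (submodZ sJ') => //; apply: sAC.
have Ixt i : I (xt i).
  exists (fun k => (k == i)%:R), 0; split=> [k||]; first by rewrite rpred_nat.
    exact: submod0 sJ.
  rewrite mulr0 addr0 (bigD1 i) //= eqxx mul1r big1 ?addr0 // => k /negPf->.
  by rewrite mul0r.
have Iyt i : I' (yt i).
  exists (fun k => (k == i)%:R), 0; split=> [k||]; first by rewrite rpred_nat.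
    exact: submod0 sJ'.
  rewrite mulr0 addr0 (bigD1 i) //= eqxx mul1r big1 ?addr0 // => k /negPf->.
  by rewrite mul0r.
have Ib2 v : invmod_set J v -> I (b ^+ 2 * v).
  exists (fun=> 0), v; split=> [i||] //; first by rewrite rpred0.
  by rewrite big1 ?add0r // => i; rewrite mul0r.
have Ib2' v : invmod_set (- J) v -> I' (b ^+ 2 * v).
  exists (fun=> 0), v; split=> [i||] //; first by rewrite rpred0.
  by rewrite big1 ?add0r // => i; rewrite mul0r.
have II'A u v : I u -> I' v -> u * v \in A.
  move=> [c [t [Ac Jt ->]]] I'v; rewrite mulrDl -[X in _ + X]mulrA; apply: rpredD; last first.
    by apply: condA; apply: JJ => //; apply: IJ'.
  rewrite mulr_suml; apply: rpred_sum => i _; rewrite -mulrA; apply: rpredM => //.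
  case: I'v => [d [t' [Ad Jt' ->]]]; rewrite mulrDr; apply: rpredD; last first.
    by rewrite mulrCA; apply: condA; apply: JJ.
  by rewrite mulr_sumr; apply: rpred_sum => j _; rewrite mulrCA rpredM.
pose K := submod_mul A I I'; have sK : is_submod A K := submod_mulP A I I'.
have KII' u v : I u -> I' v -> K (u * v) by apply: mem_submod_mul.
have Kb2 c : c \in C -> K (b ^+ 2 * c).
  move=> Cc; pose rho := \sum_i x i * w i.
  have Crho : rho \in C by apply: rpred_sum => i _; apply: JJ.
  (* Substituting [y i = yt i + b * w i] trades [b ^+ 2 * d] for an element of [K] plus a term with
     one more factor [b]. After two rounds, [b ^+ 4] splits as [b ^+ 2] times [b ^+ 2] between the
     two modules. *)
  have step d : b ^+ 2 * d = \sum_i (b ^+ 2 * (d * x i)) * yt i + b ^+ 2 * (b * d * rho).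
    have -> : b ^+ 2 * d = \sum_i b ^+ 2 * d * (x i * y i) by rewrite -mulr_sumr xy1 mulr1.
    rewrite /rho !mulr_sumr -big_split; apply: eq_bigr => i _ /=; rewrite /yt; ring.
  have KC d : d \in C -> K (\sum_i (b ^+ 2 * (d * x i)) * yt i).
    move=> Cd; apply: (submod_sum _ sK) => i _; apply: KII' => //.
    by apply: Ib2; apply: (submodZ sJ).
  rewrite step step; apply: (submodD sK); [exact: KC|apply: (submodD sK)].
    by apply: KC; apply: rpredM => //; apply: rpredM.
  have -> : b ^+ 2 * (b * (b * c * rho) * rho) =
      \sum_i (b ^+ 2 * (c * rho ^+ 2 * x i)) * (b ^+ 2 * y i).
    transitivity (\sum_i (b ^+ 4 * c * rho ^+ 2) * (x i * y i)).
      by rewrite -mulr_sumr xy1; ring.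
    by apply: eq_bigr => i _; ring.
  apply: (submod_sum _ sK) => i _; apply: KII'; [apply: Ib2|exact: Ib2'].
  by apply: (submodZ sJ); [apply: rpredM => //; apply: rpredX|exact: Jx].
have K1 : K 1.
  pose s := \sum_i xt i * yt i.
  pose kap := \sum_i (z i * y i + x i * w i - b * (z i * w i)).
  have Ck : kap \in C.
    by apply: rpred_sum => i _; apply: rpredB; [apply: rpredD|apply: rpredM => //]; apply: JJ.
  have es : s = 1 - b * kap.
    by rewrite -xy1 /kap mulr_sumr -sumrB; apply: eq_bigr => i _; rewrite /xt /yt; ring.
  (* Used below: [(2 - s) * s] is 1 minus the square of [1 - s], and [1 - s = b * kap]. *)
  have Ks : K s by apply: (submod_sum _ sK) => i _; apply: KII'.
  have As : s \in A by apply: rpred_sum => i _.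
  have -> : 1 = (2 - s) * s + b ^+ 2 * kap ^+ 2 by rewrite es; ring.
  apply: (submodD sK); last by apply: Kb2; apply: rpredX.
  by apply: (submodZ sK) => //; apply: rpredB => //; apply: rpred_nat.
have invI : is_invertible A B I.
  apply: (is_invertible_crit sAB sI _ sI' _ II'A K1) => u.
    by move=> /IJ; apply: invmod_subB.
  by move=> /IJ'; apply: invmod_subB.
exists (InvMod sAB invI); apply: invmod_inj; apply/seteqP; split=> u /=.
  by apply: submod_span_min => [|_ [v /IJ Jv <-]].
move=> Ju; set S := submod_span _ _.
have sS : is_submod C S := submod_spanP _ _.
have IS v : I v -> S v by move=> Iv; apply: sub_submod_span; exists v.
have -> : u = \sum_i (u * y i) * x i.
  by rewrite -[LHS]mulr1 -xy1 mulr_sumr; apply: eq_bigr => i _; ring.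
apply: (submod_sum _ sS) => i _; apply: (submodZ sS); first exact: JJ.
(* Start from [x i = xt i + b * z i]; expanding [z i] in the [x j] and substituting once more leaves
   only [xt] and multiples of [b ^+ 2]. *)
have -> : x i = xt i + (\sum_j (b * (a (i, j)).2) * xt j
    + \sum_j (a (i, j)).2 * (b ^+ 2 * z j)).
  rewrite {1}/xt -big_split /= -[LHS](subrK (b * z i)); congr (_ + _).
  by rewrite {1}/z mulr_sumr; apply: eq_bigr => j _; rewrite /xt; ring.
have Ca2 j : (a (i, j)).2 \in C by apply: sAC; case: (aP (i, j)).
apply: (submodD sS); first exact: IS.
apply: (submodD sS); apply: (submod_sum _ sS) => j _; apply: (submodZ sS) => //.
- exact: rpredM.
- exact: IS.
- by apply: IS; apply: Ib2.
Qed.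

End QuadExt.

End Subintegrality.

(** * Exactness of the rows *)

Section Exactness.
Variable T : comNzRingType.
Local Open Scope classical_set_scope.
Local Open Scope ring_scope.
Implicit Types (A B C D : subringClosed T).

Lemma elementary_sub A C : elementary_subintegral A C -> {subset A <= C}.
Proof. by case/elementary_quad=> b /quad_ext_sub. Qed.

Lemma mem_invmod_phi A C B (sAC : {subset A <= C}) (sCB : {subset C <= B})
    (sAB : {subset A <= B}) (I : invmod sAB) x :
  invmod_set I x -> invmod_set (invmod_phi sAC sCB sAB I) x.
Proof. by move=> Ix; apply: sub_submod_span; exists x. Qed.

Lemma invmod_phi_min A C B (sAC : {subset A <= C}) (sCB : {subset C <= B})
    (sAB : {subset A <= B}) (I : invmod sAB) (K : set T) : is_submod C K ->
  (forall x, invmod_set I x -> K x) ->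
  forall x, invmod_set (invmod_phi sAC sCB sAB I) x -> K x.
Proof. by move=> sK IK; apply: submod_span_min => // _ [x /IK Kx <-]. Qed.

Lemma invmod_phi_comp A C D B (sAC : {subset A <= C}) (sCD : {subset C <= D})
    (sAD : {subset A <= D}) (sDB : {subset D <= B}) (sCB : {subset C <= B})
    (sAB : {subset A <= B}) (I : invmod sAB) :
  invmod_phi sCD sDB sCB (invmod_phi sAC sCB sAB I) = invmod_phi sAD sDB sAB I.
Proof. exact: invmod_map_comp. Qed.

Lemma finitely_subintegral_phi_surj A D : finitely_subintegral A D ->
  forall B (sAD : {subset A <= D}) (sDB : {subset D <= B}) (sAB : {subset A <= B})
    (J : invmod sDB), exists I : invmod sAB, invmod_phi sAD sDB sAB I = J.
Proof.
elim=> [B sAA sAB sAB' J|C {}D fC IH elD B sAD sDB sAB J].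
  exists (InvMod sAB' (invmodP J)); apply: invmod_inj; apply/seteqP; split=> x /=.
    by apply: submod_span_min => [|_ [y Jy <-] //]; apply: invmod_submod.
  by move=> Jx; apply: sub_submod_span; exists x.
have sCD := elementary_sub elD.
have sCB : {subset C <= B} by move=> x /sCD/sDB.
have sAC := finitely_subintegral_sub fC.
case/elementary_quad: elD => b CDb.
have [J1 <-] := quad_ext_phi_surj CDb sCD sCB J.
have [I <-] := IH B sAC sCB sAB J1.
by exists I; rewrite (invmod_phi_comp sAC sCD sAD).
Qed.

Lemma subintegral_finite A C : subintegral A C -> forall s : seq T,
  {subset s <= C} -> exists D,
    [/\ finitely_subintegral A D, {subset D <= C} & {subset s <= D}].
Proof.
move=> CP; elim=> [_|x s IH sC].
  have /CP[D [fD sDC _]] : 0 \in C by apply: rpred0.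
  by exists D; split.
have [|D [fD sDC sD]] := IH; first by move=> y ys; apply: sC; rewrite inE ys orbT.
have /CP[E [fE sEC xE]] : x \in C by apply: sC; rewrite inE eqxx.
have [F [fF sFC sDF sEF]] := finitely_subintegral_join fD sDC fE sEC.
exists F; split=> // y; rewrite inE => /orP[/eqP->|/sD]; [exact: sEF|exact: sDF].
Qed.

(** The finitely many products of a dual pair of [J] lie in a finite stage [D]; so [J] comes from an
    invertible [D]-module, which the tower lifts to [A]. *)
Lemma subintegral_phi_surj A C B (sAC : {subset A <= C}) (sCB : {subset C <= B})
    (sAB : {subset A <= B}) : subintegral A C ->
  forall J : invmod sCB, exists I : invmod sAB, invmod_phi sAC sCB sAB I = J.
Proof.
move=> subC J; have [n [x [y [Jx Jy xy1]]]] := invmod_dual_basis J.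
have [|D [fD sDC sD]] := subintegral_finite subC
    (s := [seq x i * y j | i <- enum 'I_n, j <- enum 'I_n]).
  by move=> _ /allpairsP[[i j] [_ _ ->]]; exact: (invmod_mul_mem (Jx i) (Jy j)).
have sDB : {subset D <= B} by move=> z /sDC/sCB.
have sAD := finitely_subintegral_sub fD.
have [i|i|i j|//|J0 J0xy] := @invmod_of_dual _ _ _ sDB n x y.
- exact: invmod_subB (Jx i).
- exact: invmod_subB (Jy i).
- by apply: sD; apply/allpairsP; exists (i, j); rewrite !mem_enum.
have [I eI] := finitely_subintegral_phi_surj fD sAD sAB J0.
exists I; rewrite -(invmod_phi_comp sAD sDC sAC sCB sDB) eI.
apply: (invmod_eq_dual xy1) => // i; case: (J0xy i) => J0x J0y.
by split; [|rewrite -raddfN]; exact: mem_invmod_phi.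
Qed.

Lemma invmod_short_exact A C B (sAC : {subset A <= C}) (sCB : {subset C <= B})
    (sAB : {subset A <= B}) : subintegral A C ->
  short_exact (invmod_incl sAC sCB sAB) (invmod_phi sAC sCB sAB).
Proof.
move=> subC; split.
- move=> I J eIJ; apply: invmod_inj; rewrite -(invmod_inclE sCB sAB I) eIJ.
  exact: invmod_inclE.
- apply/seteqP; split=> [_ [I _ <-]|I phiI0].
    have phiC (J : invmod sAC) x :
        invmod_set (invmod_phi sAC sCB sAB (invmod_incl sAC sCB sAB J)) x -> x \in C.
      apply: (@invmod_phi_min _ _ _ _ _ _ _ [set` C]) => [|y]; first exact: is_submod_ring.
      by rewrite invmod_inclE; apply: invmod_subB.
    by apply: invmod_eq0 => x; [exact: phiC|rewrite -!raddfN; exact: phiC].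
  (* [J] is contained in [J C = C]. Applied to [I] and to its inverse, this makes [I] invertible
     inside [C]. *)
  have IC (J : invmod sAB) : invmod_phi sAC sCB sAB J = 0 -> J `<=` [set` C].
    move=> e x Jx; have : invmod_set (invmod_phi sAC sCB sAB J) x.
      exact: mem_invmod_phi.
    by rewrite e.
  have invI : is_invertible A C I.
    apply: (@is_invertible_crit _ _ _ I (- I)) => //; try exact: invmod_submod.
    - exact: IC phiI0.
    - by apply: IC; rewrite raddfN [X in - X]phiI0 oppr0.
    - by move=> x y; apply: invmod_mul_mem.
    - by rewrite invmod_mulVE /=; apply: rpred1.
  by exists (InvMod sAC invI) => //; apply: invmod_inj; rewrite invmod_inclE.
- apply/seteqP; split=> // J _; have [I <-] := subintegral_phi_surj sAC sAB subC J.
  by exists I.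
Qed.

End Exactness.

(** * The Dedekind-Mertens lemma *)

Section DedekindMertens.
Variables (T : comNzRingType) (A : subringClosed T).
Local Open Scope classical_set_scope.
Local Open Scope ring_scope.
Implicit Types (F G H K : set T) (f g : {poly T}).

Definition submod_exp F k : set T := iter k (submod_mul A F) [set` A].

(** The content of [f], a submodule of the ambient ring and not an ideal of [A], since the
    coefficients of [f] need not lie in [A]. *)
Definition coef_span f : set T := submod_span A (range (fun i => f`_i)).

Lemma submod_expP F k : is_submod A (submod_exp F k).
Proof. by case: k => [|k]; [apply: is_submod_ring|apply: submod_mulP]. Qed.

Lemma submod_exp_mul F k u v : F u -> submod_exp F k v -> submod_exp F k.+1 (u * v).
Proof. exact: mem_submod_mul. Qed.

Lemma submod_expS_min F k K : is_submod A K ->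
  (forall u v, F u -> submod_exp F k v -> K (u * v)) -> submod_exp F k.+1 `<=` K.
Proof. exact: submod_mul_min. Qed.

Lemma submod_exp_le F F' k : F `<=` F' -> submod_exp F k `<=` submod_exp F' k.
Proof.
move=> sFF; elim: k => // k IH; apply: submod_expS_min => [|u v Fu Fv].
  exact: submod_expP.
by apply: submod_exp_mul; [apply: sFF|apply: IH].
Qed.

Lemma submod_expD F k l u v : submod_exp F k u -> submod_exp F l v ->
  submod_exp F (k + l) (u * v).
Proof.
elim: k u => [|k IH] u; first by move=> Au Fv; apply: (submodZ (submod_expP F l)).
move=> Fu Fv; move: u Fu.
apply: (submod_expS_min (is_submod_preim v (submod_expP F (k.+1 + l)))) => w z Fw Fz /=.
by rewrite -mulrA; apply: submod_exp_mul => //; apply: IH.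
Qed.

Lemma mem_coef_span f i : coef_span f f`_i.
Proof. by apply: sub_submod_span; exists i. Qed.

Lemma coef_span_min f K : is_submod A K -> (forall i, K f`_i) -> coef_span f `<=` K.
Proof. by move=> sK fK; apply: submod_span_min => // _ [i _ <-]. Qed.

Lemma is_submod_addZ H F b : is_submod A H -> is_submod A F ->
  is_submod A [set z | exists h u, [/\ H h, F u & z = h + b * u]].
Proof.
move=> sH sF; split=> [|_ _ [h [u [Hh Fu ->]]] [k [v [Hk Fv ->]]]|a _ Aa [h [u [Hh Fu ->]]]].
- by exists 0, 0; rewrite mulr0 addr0; split; [exact: submod0 sH|exact: submod0 sF|].
- exists (h + k), (u + v).
  by split; [exact: (submodD sH)|exact: (submodD sF)|ring].
- exists (a * h), (a * u).
  by split; [exact: (submodZ sH)|exact: (submodZ sF)|ring].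
Qed.

Lemma is_submod_preiml K y : is_submod A K -> is_submod A [set x | K (y * x)].
Proof.
by move=> /(is_submod_preim y); congr is_submod; apply: funext => x /=; rewrite mulrC.
Qed.

Lemma coefM_top f g n k : (size f <= n.+1)%N -> (size g <= k.+1)%N ->
  (f * g)`_(n + k) = f`_n * g`_k.
Proof.
move=> sf sg; rewrite coefM; have nk : (n < (n + k).+1)%N by rewrite ltnS leq_addr.
rewrite (bigD1 (Ordinal nk)) //= addKn big1 ?addr0 // => i /eqP ni.
have [lt_in|lt_ni|eni] := ltngtP i n; last by case: ni; apply: val_inj.
  rewrite [g`_ _]nth_default ?mulr0 //; apply: leq_trans sg _; lia.
by rewrite nth_default ?mul0r //; apply: leq_trans sf _.
Qed.

Lemma coef_drop_top f n i : (f - f`_n *: 'X^n)`_i = if i == n then 0 else f`_i.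
Proof.
by rewrite coefB coefZ coefXn; case: eqP => [->|]; rewrite ?mulr1 ?subrr ?mulr0 ?subr0.
Qed.

Lemma size_drop_top f n : (size f <= n.+1)%N -> (size (f - f`_n *: 'X^n)%R <= n)%N.
Proof.
move=> sf; apply/leq_sizeP => j; rewrite coef_drop_top leq_eqVlt eq_sym.
by case: eqP => //= _ nj; apply: nth_default; apply: leq_trans sf _.
Qed.

(** The content is spanned by the n-th coefficient and the content of the rest; a product of k+1
    generators either contains that coefficient or does not. *)
Lemma submod_exp_split f n k u : submod_exp (coef_span f) k.+1 u ->
  exists u1 u2, [/\ submod_exp (coef_span f) k u1,
    submod_exp (coef_span (f - f`_n *: 'X^n)) k.+1 u2 & u = f`_n * u1 + u2].
Proof.
set F := coef_span f; set F' := coef_span _.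
have sF'F : F' `<=` F.
  apply: coef_span_min => [|i]; first exact: submod_spanP.
  rewrite coef_drop_top; case: eqP => _; last exact: mem_coef_span.
  exact: submod0 (submod_spanP _ _).
pose Q k := [set u | exists u1 u2, [/\ submod_exp F k u1, submod_exp F' k.+1 u2
  & u = f`_n * u1 + u2]].
have sQ l : is_submod A (Q l).
  have := is_submod_addZ f`_n (submod_expP F' l.+1) (submod_expP F l).
  congr is_submod; apply: funext => z; apply: propext.
  split=> -[u1 [u2 [? ? ->]]]; exists u2, u1; split=> //; exact: addrC.
have spl w : F w -> exists c w', [/\ c \in A, F' w' & w = f`_n * c + w'].
  move: w; apply: (@coef_span_min f [set w | exists c w', [/\ c \in A, F' w' & w = f`_n * c + w']]).
    have := is_submod_addZ f`_n (submod_spanP A (range (fun i => (f - f`_n *: 'X^n)`_i)))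
      (is_submod_ring (fun x Ax => Ax : x \in A)).
    congr is_submod; apply: funext => z; apply: propext.
    split=> -[u1 [u2 [? ? ->]]]; exists u2, u1; split=> //; exact: addrC.
  move=> i /=; have [->|ni] := eqVneq i n.
    exists 1, 0; rewrite rpred1 mulr1 addr0; split=> //.
    exact: submod0 (submod_spanP _ _).
  exists 0, f`_i; rewrite rpred0 mulr0 add0r; split=> //.
  by have := @mem_coef_span (f - f`_n *: 'X^n) i; rewrite coef_drop_top (negPf ni).
suff: submod_exp F k.+1 `<=` Q k by apply.
elim: k {u} => [|k IH]; apply: submod_expS_min => // w v Fw Fv.
  have [c [w' [Ac F'w' ->]]] := spl w Fw.
  exists (c * v), (w' * v); split; [exact: rpredM|exact: submod_exp_mul|ring].
have [c [w' [Ac F'w' ->]]] := spl w Fw.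
have [v1 [v2 [Fv1 F'v2 ev]]] := IH _ Fv.
exists (c * v + w' * v1), (w' * v2); split; last by rewrite ev; ring.
  apply: (submodD (submod_expP _ _)); first exact: (submodZ (submod_expP _ _)).
  by apply: submod_exp_mul => //; apply: sF'F.
exact: submod_exp_mul.
Qed.

(** The classical form has the content of [f * g] in place of [H]. Allowing any [H] makes the double
    induction work: removing the top term [b] of [g] enlarges [H] by [b] times the content of [f],
    removing the top term [a] of [f] enlarges it by [a] times the content of [g], and the cross
    terms are absorbed because [a * b], the top coefficient of the product, lies in [H]. *)
Theorem dedekind_mertens m f g H : (size g <= m.+1)%N -> is_submod A H ->
  (forall i, H (f * g)`_i) ->
  forall u j, submod_exp (coef_span f) m.+1 u ->
    submod_mul A (submod_exp (coef_span f) m) H (u * g`_j).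
Proof.
elim: m f g H => [|m IHm] f g H sg sH fgH u j.
  set K := submod_mul _ _ _; have sK : is_submod A K by exact: submod_mulP.
  have -> : g = (g`_0)%:P by apply: size1_polyC.
  rewrite coefC; case: eqP => [_|_ _]; last by rewrite mulr0; apply: submod0 sK.
  move: u; apply: (submod_expS_min (is_submod_preim _ sK)) => w v Fw Av /=.
  move: w Fw; apply: (coef_span_min (is_submod_preim _ (is_submod_preim _ sK))) => i /=.
  rewrite mulrAC mulrC; apply: mem_submod_mul => //.
  by have := fgH i; rewrite {1}[g]size1_polyC // coefMC.
have [n] : exists n, (size f <= n)%N by exists (size f).
elim: n f H sH fgH u j => [|n IHn] f H sH fgH u j.
  rewrite leqn0 size_poly_eq0 => /eqP->; set K := submod_mul _ _ _.
  have sK : is_submod A K by exact: submod_mulP.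
  move: u; apply: (submod_expS_min (is_submod_preim _ sK)) => w v Fw Av /=.
  suff -> : w = 0 by rewrite !mul0r; apply: submod0 sK.
  move: w Fw; apply: (@coef_span_min 0 [set w | w = 0]) => [|i]; last by rewrite /= coef0.
  by split=> [//|x y -> ->|c x _ ->]; rewrite ?addr0 ?mulr0.
move=> sf; set F := coef_span f; set K := submod_mul _ _ _.
have sK : is_submod A K by exact: submod_mulP.
have sF : is_submod A F by exact: submod_spanP.
pose a := f`_n; pose b := g`_m.+1.
pose f' := f - a *: 'X^n; pose g' := g - b *: 'X^(m.+1).
have sf' : (size f' <= n)%N by apply: size_drop_top.
have sg' : (size g' <= m.+1)%N by apply: size_drop_top.
have Hab : H (a * b) by rewrite -(coefM_top sf sg).
have KH v h : submod_exp F m.+1 v -> H h -> K (v * h) by apply: mem_submod_mul.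
have Fa : F a by apply: mem_coef_span.
have sF'F : coef_span f' `<=` F.
  apply: coef_span_min => // i; rewrite coef_drop_top; case: eqP => _.
    exact: submod0 sF.
  exact: mem_coef_span.
have g'E k : g`_k = g'`_k + (if k == m.+1 then b else 0).
  by rewrite coef_drop_top; case: eqP => [->|]; rewrite ?add0r ?addr0.
have fg'P v k : submod_exp F m.+1 v ->
    submod_mul A (submod_exp F m) [set z | exists h w, [/\ H h, F w & z = h + b * w]]
      (v * g'`_k).
  apply: IHm => // [|i]; first exact: is_submod_addZ.
  exists (f * g)`_i, (- (if (i < m.+1)%N then 0 else f`_(i - m.+1))); split=> //.
    case: ifP => _; first by rewrite oppr0; apply: submod0 sF.
    by apply: (submodN sF); apply: mem_coef_span.
  by rewrite mulrBr coefB -scalerAr coefZ coefMXn mulrN.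
have K1 v k : submod_exp F m.+1 v -> K (a * (v * g'`_k)).
  move=> Fv; apply: (submod_mul_min (is_submod_preiml _ sK) _ (fg'P v k Fv)).
  move=> w _ Fw [h [z [Hh Fz ->]]] /=.
  have -> : a * (w * (h + b * z)) = a * w * h + z * w * (a * b) by ring.
  by apply: (submodD sK); apply: KH => //; apply: submod_exp_mul.
(* Since [b] is a coefficient of [g] itself, the part of [v] that is free of [a] falls under the
   induction on [f]. *)
have K2 v : submod_exp F m.+2 v -> K (b * v).
  move=> /(submod_exp_split n)[v1 [v2 [Fv1 F'v2 ->]]]; rewrite mulrDr.
  have Kab w : submod_exp F m.+1 w -> K (b * (a * w)).
    by move=> Fw; have -> : b * (a * w) = w * (a * b) by [ring]; apply: KH.
  apply: (submodD sK); first exact: Kab.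
  rewrite mulrC.
  set H' := [set z | exists h w, [/\ H h, coef_span g w & z = h + a * w]].
  have sH' : is_submod A H' by apply: is_submod_addZ => //; apply: submod_spanP.
  have f'gH' i : H' (f' * g)`_i.
    exists (f * g)`_i, (- (if (i < n)%N then 0 else g`_(i - n))); split=> //.
      case: ifP => _; first by rewrite oppr0; apply: submod0 (submod_spanP _ _).
      by apply: (submodN (submod_spanP _ _)); apply: mem_coef_span.
    by rewrite mulrBl coefB -scalerAl coefZ coefXnM mulrN.
  have := IHn f' H' sH' f'gH' v2 m.+1 sf' F'v2.
  move: (v2 * _); apply: submod_mul_min => // w _ F'w [h [z [Hh Gz ->]]].
  have Fw : submod_exp F m.+1 w by apply: submod_exp_le F'w.
  rewrite mulrDr; apply: (submodD sK); first exact: KH.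
  have -> : w * (a * z) = (a * w) * z by ring.
  move: z Gz; apply: (coef_span_min (is_submod_preiml _ sK)) => k /=.
  rewrite g'E mulrDr; apply: (submodD sK); first by rewrite -mulrA; apply: K1.
  case: ifP => _; last by rewrite mulr0; apply: submod0 sK.
  by rewrite mulrC; apply: Kab.
move=> Fu; rewrite g'E mulrDr; apply: (submodD sK); last first.
  case: ifP => _; first by rewrite mulrC; apply: K2.
  by rewrite mulr0; apply: submod0 sK.
move: u Fu; apply: (submod_expS_min (is_submod_preim _ sK)) => w v Fw Fv /=.
rewrite -mulrA; apply: (submod_mul_min (is_submod_preiml _ sK) _ (fg'P v j Fv)).
move=> z _ Fz [h [y [Hh Fy ->]]] /=.
have -> : w * (z * (h + b * y)) = w * z * h + b * (w * (y * z)) by ring.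
apply: (submodD sK); first by apply: KH => //; apply: submod_exp_mul.
by apply: K2; do 2!apply: submod_exp_mul => //.
Qed.

(* For h = f g over A, the ring generated over A by the coefficients of f is the
   finite module F^m. *)
Corollary coef_span_exp_stable f g : f`_0 = 1 -> g`_0 = 1 -> f * g \is a polyOver A ->
  exists m, forall k, submod_exp (coef_span f) k `<=` submod_exp (coef_span f) m.
Proof.
move=> f0 g0 /polyOverP fgA; set F := coef_span f; exists (size g).
have F1 : F 1 by rewrite -f0; apply: mem_coef_span.
have sA := is_submod_ring (fun x Ax => Ax : x \in A).
have step k : submod_exp F k `<=` submod_exp F k.+1.
  by move=> u Fu; rewrite -[u]mul1r; apply: submod_exp_mul.
have stepm k : submod_exp F (size g + k) `<=` submod_exp F (size g).
  elim: k => [|k IH]; rewrite ?addn0 // addnS.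
  apply: submod_expS_min => [|u v Fu /IH Fv]; first exact: submod_expP.
  have Fuv : submod_exp F (size g).+1 (u * v) by apply: submod_exp_mul.
  have := dedekind_mertens (leqnSn _) sA fgA 0 Fuv; rewrite g0 mulr1.
  by rewrite submod_mulC submod_mul1 //; apply: submod_expP.
move=> k u Fu; apply: (stepm k); rewrite addnC.
by elim: (size g) => [|l IH]; rewrite ?addn0 // addnS; apply: step.
Qed.

End DedekindMertens.

(** * Polynomials over a subintegrally closed subring *)

Section PolySub.
Variable T : comNzRingType.

Definition poly_sub (A : subringClosed T) : {pred {poly T}} :=
  [pred f | f \is a polyOver A].

Lemma poly_subP (A : subringClosed T) (f : {poly T}) :
  reflect (forall i, f`_i \in A) (f \in poly_sub A).
Proof. exact: polyOverP. Qed.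

Lemma poly_sub_closed (A : subringClosed T) : subring_closed (poly_sub A).
Proof.
split=> [|f g Af Ag|f g Af Ag]; rewrite inE; first exact: rpred1.
- exact: rpredB.
- exact: rpredM.
Qed.

HB.instance Definition _ (A : subringClosed T) :=
  GRing.isSubringClosed.Build {poly T} (poly_sub A) (poly_sub_closed A).

Lemma poly_subC (A : subringClosed T) c : c \in A -> c%:P \in poly_sub A.
Proof. by move=> Ac; rewrite inE polyOverC. Qed.

Lemma poly_subXn (A : subringClosed T) n : 'X^n \in poly_sub A.
Proof. by rewrite inE polyOverXn. Qed.

Lemma poly_subZ (A : subringClosed T) c f :
  c \in A -> f \in poly_sub A -> c *: f \in poly_sub A.
Proof. by move=> Ac Af; rewrite inE polyOverZ. Qed.

End PolySub.

(** * Rank one modules over a polynomial ring, modulo an ideal *)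

Section RankOne.
Variables (T : comNzRingType) (A C : subringClosed T) (sAC : {subset A <= C}).
Variable N : set T.
Local Open Scope classical_set_scope.
Local Open Scope ring_scope.
(** [N] models the conductor extended to the localisation at a minimal prime. [radN] says that
    [C / N] is reduced; [regN] makes the elements of [A] outside [N] regular on [C / N], so that [A]
    modulo [N] is a domain, whose fraction field is K. *)
Hypothesis sN : is_submod C N.
Hypothesis radN : forall z, z \in C -> N (z ^+ 2) -> N z.
Hypothesis regN : forall a z, a \in A -> ~ N a -> z \in C -> N (a * z) -> N z.
Hypothesis N1 : ~ N 1.

Let PA := poly_sub A : subringClosed {poly T}.
Let PC := poly_sub C : subringClosed {poly T}.
Let PN : set {poly T} := [set f | forall k, N f`_k].

Let sPAC : {subset PA <= PC}.
Proof. by move=> f /poly_subP Af; apply/poly_subP => i; apply: (sAC). Qed.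

Let sPN : is_submod PC PN.
Proof.
split=> [k|f g Nf Ng k|f g /poly_subP Cf Ng k]; rewrite ?coef0 ?coefD ?coefM.
- exact: submod0 sN.
- exact: (submodD sN).
- by apply: (submod_sum _ sN) => i _; apply: (submodZ sN).
Qed.

Let regNM a b : a \in A -> b \in A -> ~ N a -> ~ N b -> ~ N (a * b).
Proof. by move=> Aa Ab Na Nb /(regN Aa Na (sAC Ab)). Qed.

Lemma PN_cancel g z : g \in PA -> ~ N (lead_coef g) -> z \in PC ->
  PN (z * g) -> PN z.
Proof.
move=> Ag Ng; have sg : (size g <= (size g).-1.+1)%N by apply: leqSpred.
have Alg : lead_coef g \in A by move/poly_subP: Ag => /(_ (size g).-1).
have [n] : exists n, (size z <= n)%N by exists (size z).
elim: n z => [|n IH] z.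
  by rewrite leqn0 size_poly_eq0 => /eqP-> _ _; apply: submod0 sPN.
move=> sz Cz Nzg; have /poly_subP Czi := Cz.
have Nn : N z`_n.
  apply: (regN Alg Ng (Czi n)); rewrite mulrC.
  by have := Nzg (n + (size g).-1)%N; rewrite (coefM_top sz sg).
have NX : PN (z`_n *: 'X^n).
  by move=> k; rewrite coefZ coefXn mulrC; apply: (submodZ sN); rewrite ?rpred_nat.
rewrite -(subrK (z`_n *: 'X^n) z); apply: (submodD sPN) => //.
apply: IH; first exact: size_drop_top.
  by apply: rpredB => //; apply: poly_subZ => //; apply: poly_subXn.
rewrite mulrBl; apply: (submodB sPN) => //.
by rewrite mulrC; apply: (submodZ sPN) => //; apply: sPAC.
Qed.

Lemma PN_unit_const l m d : l \in PC -> m \in PC -> d \in A -> ~ N d ->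
  PN (l * m - d%:P) -> forall k, (0 < k)%N -> N l`_k.
Proof.
move=> + /poly_subP Cm Ad Nd.
have [n] : exists n, (size l <= n.+1)%N by exists (size l).
elim: n l => [|n IH] l sl Cl Nlm k k0.
  by rewrite nth_default ?(leq_trans sl) //; apply: submod0 sN.
have /poly_subP Cli := Cl; set a := l`_n.+1; have Ca : a \in C by exact: Cli.
have Nam j : N (a * m`_j).
  have [r] : exists r, (size m <= j + r)%N by exists (size m); rewrite leq_addl.
  elim/ltn_ind: r j => r IHr j sm.
  have [lt_jm|le_mj] := ltnP j (size m); last first.
    by rewrite nth_default // mulr0; apply: submod0 sN.
  apply: radN; first exact: rpredM.
  (* After multiplication by [a], all terms but one of this coefficient lie in [N]; hence so does
     the square of [a] times the j-th coefficient of [m]. *)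
  have := Nlm (n.+1 + j)%N; rewrite coefB coefC addSn /= subr0 -addSn coefM.
  have lt_n : (n.+1 < (n.+1 + j).+1)%N by rewrite ltnS leq_addr.
  rewrite (bigD1 (Ordinal lt_n)) //= addKn => /(submodZ sN Ca).
  rewrite mulrDr; set R := _ * \sum_(i < _ | _) _; move=> NR.
  have -> : (a * m`_j) ^+ 2 = m`_j * (a * (a * m`_j) + R) - m`_j * R by ring.
  apply: (submodB sN); apply: (submodZ sN) => //.
  rewrite /R mulr_sumr; apply: (submod_sum _ sN) => i /eqP ni.
  have [lt_in|lt_ni|eni] := ltngtP i n.+1; last by case: ni; apply: val_inj.
    rewrite mulrCA; apply: (submodZ sN) => //.
    apply: (IHr (r - (n.+1 - i))%N); clear -lt_in lt_jm sm; lia.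
  rewrite [l`_i]nth_default ?(leq_trans sl) // mul0r mulr0.
  exact: submod0 sN.
have Na : N a.
  apply: (regN Ad Nd Ca).
  have -> : d * a = l`_0 * (a * m`_0) - a * (l * m - d%:P)`_0.
    by rewrite coefB coefC eqxx coefM big_ord_recl big_ord0 /= subn0; ring.
  by apply: (submodB sN); apply: (submodZ sN).
have [->|nk] := eqVneq k n.+1; first by [].
have CX : a *: 'X^(n.+1) \in PC by apply: poly_subZ => //; apply: poly_subXn.
have NX : PN (a *: 'X^(n.+1)).
  by move=> i; rewrite coefZ coefXn mulrC; apply: (submodZ sN); rewrite ?rpred_nat.
have Cl' : l - a *: 'X^(n.+1) \in PC by apply: rpredB.
have Nl' : PN ((l - a *: 'X^(n.+1)) * m - d%:P).
  have -> : (l - a *: 'X^(n.+1)) * m - d%:P = (l * m - d%:P) - m * (a *: 'X^(n.+1)).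
    by ring.
  by apply: (submodB sPN) => //; apply: (submodZ sPN) => //; apply/poly_subP.
have := IH _ (size_drop_top sl) Cl' Nl' k k0.
by rewrite coef_drop_top (negPf nk).
Qed.

Section Vectors.
Variables (n : nat) (x y : 'I_n -> {poly T}).
Hypothesis Cx : forall i, x i \in PC.
Hypothesis Cy : forall i, y i \in PC.
Hypothesis xyA : forall i j, x i * y j \in PA.
Hypothesis xy1 : \sum_i x i * y i = 1.

(** The column [j0] of the matrix [x i * y j] generates a nonzero ideal of K[t], and [g] is a
    generator, found as an element of least degree. Division by [g] becomes pseudo-division; [s]
    collects powers of the leading coefficient. *)
Let min_comb j0 : (exists i, ~ PN (x i * y j0)) ->
  exists g u r, [/\ forall k : 'I_n, u k \in PA, r \in PA, PN r,
      g = \sum_k u k * (x k * y j0) + r & ~ N (lead_coef g)] /\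
    forall i, exists s q, [/\ s \in A, ~ N s, q \in PA
      & PN (s *: (x i * y j0) - q * g)].
Proof.
move=> [i0 Ni0].
pose J := [set f | exists u r, [/\ forall k : 'I_n, u k \in PA, r \in PA, PN r
  & f = \sum_k u k * (x k * y j0) + r]].
have sJ : is_submod PA J.
  split=> [|_ _ [u [r [Au Ar Nr ->]]] [v [s [Av As Ns ->]]]|a _ Aa [u [r [Au Ar Nr ->]]]].
  - exists (fun=> 0), 0; rewrite big1 => [|i _]; last by rewrite mul0r.
    by rewrite addr0; split=> // [i||]; rewrite ?rpred0 //; apply: submod0 sPN.
  - exists (fun k => u k + v k), (r + s); split=> [k|||].
    + exact: rpredD.
    + exact: rpredD.
    + exact: (submodD sPN).
    + by under [in RHS]eq_bigr do rewrite mulrDl; rewrite big_split /=; ring.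
  - exists (fun k => a * u k), (a * r); split=> [k|||].
    + exact: rpredM.
    + exact: rpredM.
    + by apply: (submodZ sPN) => //; apply: sPAC.
    + by under [in RHS]eq_bigr do rewrite -mulrA; rewrite -mulr_sumr; ring.
have JA f : J f -> f \in PA.
  move=> [u [r [Au Ar _ ->]]]; apply: rpredD => //; apply: rpred_sum => k _.
  exact: rpredM.
have JP i : J (x i * y j0).
  exists (fun k => (k == i)%:R), 0; rewrite (bigD1 i) //= eqxx mul1r big1 ?addr0.
    by split=> // [k||]; rewrite ?rpred_nat ?rpred0 //; apply: submod0 sPN.
  by move=> k /negPf->; rewrite mul0r.
have JN r : r \in PA -> PN r -> J r.
  move=> Ar Nr; exists (fun=> 0), r; rewrite big1 ?add0r; last by move=> k; rewrite mul0r.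
  by split=> // k; apply: rpred0.
have [|m /asboolP[g [Jg Ng sg]] min_m] := @find_ex_minn
    (fun m => `[< exists g, [/\ J g, ~ PN g & size g = m] >]).
  by exists (size (x i0 * y j0)); apply/asboolP; exists (x i0 * y j0).
have Ag := JA _ Jg; have /poly_subP Agi := Ag.
have g0 : (0 < size g)%N.
  by rewrite lt0n size_poly_eq0; apply/eqP => g0; apply: Ng; rewrite g0; apply: submod0 sPN.
have sg' : (size g <= (size g).-1.+1)%N by apply: leqSpred.
(* A top term with coefficient in [N] could be subtracted without leaving [J] or entering [PN],
   against minimality. *)
have Nlg : ~ N (lead_coef g).
  move=> Nl; pose t := lead_coef g *: 'X^((size g).-1).
  have At : t \in PA by apply: poly_subZ (Agi _) (poly_subXn _ _).
  have Nt : PN t.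
    by move=> k; rewrite coefZ coefXn mulrC; apply: (submodZ sN); rewrite ?rpred_nat.
  have /min_m : `[< exists g', [/\ J g', ~ PN g' & size g' = size (g - t)] >].
    apply/asboolP; exists (g - t); split=> // [|Ngt].
      by apply: (submodB sJ) => //; apply: JN.
    by apply: Ng; rewrite -(subrK t g); apply: (submodD sPN).
  by rewrite -sg leqNgt -[X in (_ < X)%N](prednK g0) ltnS size_drop_top.
case: (Jg) => u [r [Au Ar Nr eg]]; exists g, u, r; split=> // i.
suff div f : J f -> exists s q, [/\ s \in A, ~ N s, q \in PA & PN (s *: f - q * g)].
  exact: div.
have [k] : exists k, (size f <= k)%N by exists (size f).
elim: k f => [|k IH] f sf Jf.
  exists 1, 0; rewrite rpred1 rpred0 mul0r subr0 scale1r; split=> //.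
  by move: sf; rewrite leqn0 size_poly_eq0 => /eqP->; apply: submod0 sPN.
have [Nf|Nf] := pselect (PN f).
  by exists 1, 0; rewrite rpred1 rpred0 mul0r subr0 scale1r.
have le_gf : (size g <= size f)%N.
  by rewrite sg; apply: min_m; apply/asboolP; exists f.
have /poly_subP Afi := JA _ Jf.
pose c := f`_k *: 'X^(k - (size g).-1).
have Ac : c \in PA by apply: poly_subZ (Afi _) (poly_subXn _ _).
have Alg : lead_coef g \in A by apply: Agi.
have [||s [q [As Ns Aq Nsq]]] := IH (lead_coef g *: f - c * g).
- have arith a b j : (a <= k.+1 -> b <= a -> k < j -> b <= j - (k - b.-1))%N by lia.
  apply/leq_sizeP => j kj; rewrite coefB coefZ -scalerAl coefZ coefXnM.
  move: kj; rewrite leq_eqVlt => /predU1P[<-|kj].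
    rewrite ifF ?subKn ?lead_coefE; last 2 first.
    + by move: sf le_gf; lia.
    + by move: sf le_gf; lia.
    by rewrite mulrC subrr.
  rewrite (nth_default _ (leq_trans sf kj)) mulr0 sub0r.
  case: ifP => _; rewrite ?mulr0 ?oppr0 //.
  rewrite [g`_ _]nth_default ?mulr0 ?oppr0 //; apply: arith sf le_gf kj.
- apply: (submodB sJ); last exact: (submodZ sJ).
  by rewrite -mul_polyC; apply: (submodZ sJ) => //; apply: poly_subC.
exists (s * lead_coef g), (q + s *: c); split.
- exact: rpredM.
- exact: regNM.
- by apply: rpredD => //; apply: poly_subZ.
- congr PN: Nsq; rewrite -!mul_polyC polyCM; ring.
Qed.

(** Dividing the column [j0] by its generator [g] gives [q], with [d] the product of the
    denominators; [v j] applies to column [j] the combination [u] that produces [g] from column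
    [j0]. The required congruences hold after multiplication by [g], which is regular modulo [N]. *)
Lemma rank_one_factor : exists (q v : 'I_n -> {poly T}) d,
  [/\ forall i, q i \in PA, forall i, v i \in PA, d \in A, ~ N d
    & forall i j, PN (d *: (x i * y j) - q i * v j)].
Proof.
have [j0 [i0 Nij]] : exists j i, ~ PN (x i * y j).
  apply: contrapT => none; apply: N1.
  suff /(_ 0%N) : PN (\sum_i x i * y i) by rewrite xy1 coef1.
  apply: (submod_sum _ sPN) => i _; apply: contrapT => Nii.
  by apply: none; exists i, i.
have [|g [u [r [[Au Ar Nr eg Nlg] div]]]] := @min_comb j0; first by exists i0.
have Ag : g \in PA.
  by rewrite eg; apply: rpredD => //; apply: rpred_sum => k _; apply: rpredM.
have {div}/choice[sq sqP] : forall i, exists sq : T * {poly T},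
    [/\ sq.1 \in A, ~ N sq.1, sq.2 \in PA & PN (sq.1 *: (x i * y j0) - sq.2 * g)].
  by move=> i; have [s [q ?]] := div i; exists (s, q).
pose d := \prod_i (sq i).1.
have Ad : d \in A by apply: rpred_prod => i _; case: (sqP i).
have Nd : ~ N d.
  suff [] : d \in A /\ ~ N d by [].
  rewrite /d; elim/big_ind: _ => [|a b [Aa Na] [Ab Nb]|i _].
  - by split=> //; apply: rpred1.
  - by split; [apply: rpredM|apply: regNM].
  - by case: (sqP i).
pose q i := (\prod_(k | k != i) (sq k).1) *: (sq i).2.
have Aq i : q i \in PA.
  apply: poly_subZ; last by case: (sqP i).
  by apply: rpred_prod => k _; case: (sqP k).
have Nq i : PN (d *: (x i * y j0) - q i * g).
  have -> : d *: (x i * y j0) - q i * g =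
      (\prod_(k | k != i) (sq k).1)%:P * ((sq i).1 *: (x i * y j0) - (sq i).2 * g).
    rewrite /d /q (bigD1 i) //= -!mul_polyC polyCM; ring.
  apply: (submodZ sPN); last by case: (sqP i).
  by apply: sPAC; apply: poly_subC; apply: rpred_prod => k _; case: (sqP k).
have PAC f : f \in PA -> f \in PC by apply: sPAC.
have Cxy i j : x i * y j \in PC by apply: PAC.
have Nuq : PN (d%:P - \sum_k u k * q k).
  apply: (PN_cancel Ag Nlg).
    apply: rpredB; first by apply: poly_subC; apply: (sAC).
    by apply: rpred_sum => k _; apply: rpredM; apply: PAC.
  have -> : (d%:P - \sum_k u k * q k) * g =
      \sum_k u k * (d *: (x k * y j0) - q k * g) + d%:P * r.
    rewrite mulrBl {1}eg mulrDr mulr_suml mulr_sumr addrAC -sumrB; congr (_ + _).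
    by apply: eq_bigr => k _; rewrite -mul_polyC; ring.
  apply: (submodD sPN).
    by apply: (submod_sum _ sPN) => k _; apply: (submodZ sPN) => //; apply: PAC.
  by apply: (submodZ sPN) => //; apply: PAC; apply: poly_subC.
have Nqx i k j : PN (q i * (x k * y j) - q k * (x i * y j)).
  apply: (PN_cancel Ag Nlg).
    by apply: rpredB; apply: rpredM => //; apply: PAC.
  have -> : (q i * (x k * y j) - q k * (x i * y j)) * g =
      (x i * y j) * (d *: (x k * y j0) - q k * g)
      - (x k * y j) * (d *: (x i * y j0) - q i * g).
    by rewrite -!mul_polyC; ring.
  by apply: (submodB sPN); apply: (submodZ sPN).
exists q, (fun j => \sum_k u k * (x k * y j)), d; split=> // [j|i j].
  by apply: rpred_sum => k _; apply: rpredM.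
have -> : d *: (x i * y j) - q i * (\sum_k u k * (x k * y j)) =
    (x i * y j) * (d%:P - \sum_k u k * q k)
    - \sum_k u k * (q i * (x k * y j) - q k * (x i * y j)).
  rewrite -mul_polyC mulrBr !mulr_sumr -!sumrN -!addrA -big_split /=.
  congr (_ + _); first by rewrite mulrC.
  by apply: eq_bigr => k _; ring.
apply: (submodB sPN); first exact: (submodZ sPN).
by apply: (submod_sum _ sPN) => k _; apply: (submodZ sPN) => //; apply: PAC.
Qed.

(* The unit relating the two rank one factorisations x y and q v of d (x_i y_j)
   is constant because C / N is reduced. *)
Lemma rank_one_descent : (forall i, (x i)`_0 \in A) ->
  exists2 d, d \in A /\ ~ N d &
    forall i, exists2 f, f \in PA & PN (d *: x i - f).
Proof.
move=> Ax0; have [q [v [d [Aq Av Ad Nd Nqv]]]] := rank_one_factor.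
have PAC f : f \in PA -> f \in PC by apply: sPAC.
pose l := \sum_j v j * x j; pose m := \sum_i y i * q i.
have Cl : l \in PC by apply: rpred_sum => j _; apply: rpredM => //; apply: PAC.
have Cm : m \in PC by apply: rpred_sum => j _; apply: rpredM => //; apply: PAC.
have Nql i : PN (d *: x i - q i * l).
  have -> : d *: x i - q i * l = \sum_j x j * (d *: (x i * y j) - q i * v j).
    rewrite -mul_polyC -[in LHS](mulr1 (d%:P * _)) -xy1 !mulr_sumr -sumrB.
    by apply: eq_bigr => j _; rewrite -mul_polyC; ring.
  by apply: (submod_sum _ sPN) => j _; apply: (submodZ sPN).
have Nlm : PN (l * m - d%:P).
  have -> : l * m - d%:P = - \sum_i y i * (d *: x i - q i * l).
    transitivity (l * m - d%:P * 1); first by rewrite mulr1.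
    rewrite -xy1 /m !mulr_sumr -sumrB -sumrN; apply: eq_bigr => i _.
    by rewrite -mul_polyC; ring.
  apply: (submodN sPN); apply: (submod_sum _ sPN) => i _; exact: (submodZ sPN).
have Nl := PN_unit_const Cl Cm Ad Nd Nlm.
exists d; first by split.
(* [l] is congruent to its constant term, which lies in [A] because the constant terms of [x] and
   [v] do. *)
move=> i; exists (q i * (l`_0)%:P).
  apply: rpredM => //; apply: poly_subC; rewrite coef_sum; apply: rpred_sum => j _.
  by rewrite coefM big_ord1; apply: rpredM => //; have /poly_subP := Av j; apply.
have -> : d *: x i - q i * (l`_0)%:P = (d *: x i - q i * l) + q i * (l - (l`_0)%:P).
  by ring.
apply: (submodD sPN) => //; apply: (submodZ sPN); first exact: PAC.
move=> k; rewrite coefB coefC; case: k => [|k] /=.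
  by rewrite subrr; apply: submod0 sN.
by rewrite subr0; apply: Nl.
Qed.

End Vectors.

End RankOne.

Section SubringOfSet.
Variables (T : comNzRingType) (C : set T).
Hypotheses (C1 : C 1) (CB : forall x y, C x -> C y -> C (x - y)).
Hypothesis CM : forall x y, C x -> C y -> C (x * y).

Let Cpred : {pred T} := [pred x | `[< C x >]].

Let Cpred_closed : subring_closed Cpred.
Proof.
split=> [|x y /asboolP Cx /asboolP Cy|x y /asboolP Cx /asboolP Cy]; apply/asboolP => //.
  exact: CB.
exact: CM.
Qed.

HB.instance Definition _ := GRing.isSubringClosed.Build T Cpred Cpred_closed.

Lemma subring_of_set : exists D : subringClosed T, forall x, x \in D <-> C x.
Proof. by exists (Cpred : subringClosed T) => x; split=> [/asboolP|/asboolP]. Qed.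

End SubringOfSet.

(** * Descent to a subintegrally closed subring *)

Section PolyDescent.
Variables (T : comNzRingType).
Local Open Scope classical_set_scope.
Local Open Scope ring_scope.
Implicit Types A B C : subringClosed T.

Definition subint_closed A B :=
  forall b, b \in B -> b ^+ 2 \in A -> b ^+ 3 \in A -> b \in A.

(** [h] is invertible as a power series over [C], so the coefficients of [f] can be solved for one
    after another. *)
Lemma poly_sub_div C (f h : {poly T}) : h`_0 = 1 -> h \in poly_sub C ->
  h * f \in poly_sub C -> f \in poly_sub C.
Proof.
move=> h0 /poly_subP Ch /poly_subP Chf; apply/poly_subP; elim/ltn_ind => k IH.
have -> : f`_k = (h * f)`_k - \sum_(i < k) h`_i.+1 * f`_(k - i.+1).
  by rewrite coefM big_ord_recl h0 mul1r subn0 /= addrK.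
apply: rpredB => //; apply: rpred_sum => i _; apply: rpredM => //; apply: IH.
by move: (ltn_ord i) => ik; rewrite -subn_gt0 subKn.
Qed.

(** When [P] is an ideal, [S] is the complement of a minimal prime over it. The last clause is what
    minimality gives: after localisation at [S], every excluded [r] is nilpotent modulo [P]. *)
Lemma exists_maximal_multset A (P : set T) : ~ P 1 -> exists S : set T,
  [/\ [/\ S `<=` [set` A], S 1, forall s t, S s -> S t -> S (s * t)
        & forall s, S s -> ~ P s]
    & forall r, r \in A -> ~ S r -> exists s k, S s /\ P (s * r ^+ k)].
Proof.
move=> P1.
(* [good] does not ask for 1 because Zorn's lemma also meets the empty chain, whose union is empty;
   maximality supplies 1 afterwards. *)
pose good (S : set T) := [/\ S `<=` [set` A], forall s t, S s -> S t -> S (s * t)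
  & forall s, S s -> ~ P s].
have [F goodF totF|S [[SA SM SP] Smax]] := @Zorn_bigcup T good.
  split=> [x [S FS Sx]|s t [S FS Ss] [U FU Ut]|s [S FS Ss]].
  - by have [+ _ _] := goodF _ FS; apply.
  - have [SU|US] := totF _ _ FS FU.
      by exists U => //; have [_ UM _] := goodF _ FU; apply: UM => //; apply: SU.
    by exists S => //; have [_ SM _] := goodF _ FS; apply: SM => //; apply: US.
  - by have [_ _] := goodF _ FS; apply.
have maxS r : r \in A -> ~ S r -> exists s k, (S s \/ s = 1) /\ P (s * r ^+ k).
  move=> Ar Sr; apply: contrapT => noP.
  pose S' := [set x | exists s k, (S s \/ s = 1) /\ x = s * r ^+ k].
  apply: (Smax S'); first split=> [x Sx|SS'].
  - by exists x, 0%N; rewrite mulr1; split=> //; left.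
  - by apply: Sr; apply: SS'; exists 1, 1%N; rewrite mul1r; split=> //; right.
  split=> [_ [s [k [Ss ->]]]|_ _ [s [k [Ss ->]]] [t [l [St ->]]]|_ [s [k [Ss ->]]]].
  - apply: rpredM; last exact: rpredX.
    by case: Ss => [/SA//|->]; apply: rpred1.
  - exists (s * t), (k + l)%N; rewrite exprD; split; last by ring.
    case: Ss St => [Ss|->] [St|->]; rewrite ?mulr1 ?mul1r; [left|left|left|right] => //.
    exact: SM.
  - by move=> Psr; apply: noP; exists s, k.
have S1 : S 1.
  apply: contrapT => nS1; have [s [k [[Ss|->]]]] := maxS 1 (rpred1 _) nS1;
    rewrite expr1n mulr1 //; exact: SP.
exists S; split=> // r Ar Sr; have [s [k [[Ss|->] ?]]] := maxS r Ar Sr.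
  by exists s, k.
by exists 1, k.
Qed.

Theorem subint_closed_descent A B n (x y : 'I_n -> {poly T}) :
  {subset A <= B} -> subint_closed A B ->
  (forall i, x i \in poly_sub B) -> (forall i, y i \in poly_sub B) ->
  (forall i j, x i * y j \in poly_sub A) -> \sum_i x i * y i = 1 ->
  (forall i, (x i)`_0 \in A) -> (forall i, (y i)`_0 \in A) ->
  forall i, x i \in poly_sub A.
Proof.
move=> sAB clA Bx By xyA xy1 Ax0 Ay0.
(* [X] and [Y] have constant term 1 and a product with coefficients in [A], which is what the
   finiteness argument by contents needs. *)
pose X := \sum_i (y i)`_0 *: x i; pose Y := \sum_i (x i)`_0 *: y i.
have e0 : \sum_i (x i)`_0 * (y i)`_0 = 1.
  transitivity (\sum_i x i * y i)`_0; last by rewrite xy1 coef1.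
  by rewrite coef_sum; apply: eq_bigr => i _; rewrite coefM big_ord1.
have X0 : X`_0 = 1.
  by rewrite coef_sum -e0; apply: eq_bigr => i _; rewrite coefZ mulrC.
have Y0 : Y`_0 = 1 by rewrite coef_sum -e0; apply: eq_bigr => i _; rewrite coefZ.
have XyA j : X * y j \in poly_sub A.
  rewrite mulr_suml; apply: rpred_sum => i _; rewrite -scalerAl; exact: poly_subZ.
have YxA j : Y * x j \in poly_sub A.
  by rewrite mulr_suml; apply: rpred_sum => i _; rewrite -scalerAl mulrC; apply: poly_subZ.
have XYA : X * Y \in poly_sub A.
  rewrite mulr_sumr; apply: rpred_sum => i _; rewrite -scalerAr; exact: poly_subZ.
have [m stab] := coef_span_exp_stable X0 Y0 XYA.
set F := coef_span A X in stab.
have F1 : F 1 by rewrite -X0; apply: mem_coef_span.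
have Fm k z : submod_exp A F k z -> submod_exp A F m z by apply: stab.
have [||u v Fu Fv|C CP] := @subring_of_set T (submod_exp A F m).
- by apply: (Fm 0%N); apply: rpred1.
- by move=> u v; apply: (submodB (submod_expP _ _ _)).
- by apply: Fm; apply: submod_expD Fu Fv.
have sAC : {subset A <= C} by move=> a Aa; apply/CP; apply: (Fm 0%N).
have sCB : {subset C <= B}.
  have FB : F `<=` [set` B].
    apply: coef_span_min => [|i]; first exact: is_submod_ring.
    rewrite /= coef_sum; apply: rpred_sum => k _; rewrite coefZ.
    apply: rpredM; first exact: (sAB).
    by have /poly_subP := Bx k; apply.
  have FkB k : submod_exp A F k `<=` [set` B].
    elim: k => [|k IH]; first exact: sAB.
    apply: submod_expS_min => [|u v Fu Fv]; first exact: is_submod_ring.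
    by apply: rpredM; [apply: FB|apply: IH].
  by move=> z /CP; apply: FkB.
have sPAC f : f \in poly_sub A -> f \in poly_sub C.
  by move=> /poly_subP Af; apply/poly_subP => i; apply: sAC.
have CX : X \in poly_sub C.
  apply/poly_subP => i; apply/CP; apply: (Fm 1%N); rewrite -[X`_i]mulr1.
  by apply: submod_exp_mul; [apply: mem_coef_span|apply: rpred1].
have Cy j : y j \in poly_sub C by apply: (poly_sub_div X0 CX); apply: sPAC.
have CY : Y \in poly_sub C.
  by apply: rpred_sum => i _; apply: poly_subZ => //; apply: sAC.
have Cx j : x j \in poly_sub C by apply: (poly_sub_div Y0 CY); apply: sPAC.
(* The conductor of [C] in [A], an ideal of both rings. *)
pose cond : set T := [set z | forall d, d \in C -> z * d \in A].
have condA z : cond z -> z \in A by move=> /(_ 1 (rpred1 _)); rewrite mulr1.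
have [c1|ncond1] := pselect (cond 1).
  move=> i; apply/poly_subP => k; rewrite -[_`_k]mul1r; apply: c1.
  by have /poly_subP := Cx i; apply.
have condM z d : cond z -> d \in C -> cond (z * d).
  by move=> cz Cd e Ce; rewrite -mulrA; apply: cz; apply: rpredM.
(* Here [clA] enters: the square and the cube of [z * d] lie in [A]. *)
have cond2 z : z \in C -> cond (z ^+ 2) -> cond z.
  move=> Cz cz d Cd; apply: clA; first by apply: sCB; apply: rpredM.
    by rewrite exprMn; apply: cz; apply: rpredX.
  have -> : (z * d) ^+ 3 = z ^+ 2 * (z * d ^+ 3) by ring.
  by apply: cz; apply: rpredM => //; apply: rpredX.
have condX z k : z \in C -> cond (z ^+ k.+1) -> cond z.
  move=> Cz; elim/ltn_ind: k => -[|k] IH // ck.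
  have kk : (k.+2 <= k.+1 * 2)%N by lia.
  apply: (IH k (ltnSn k)); apply: cond2; first exact: rpredX.
  by rewrite -exprM -(subnKC kk) exprD; apply: condM => //; apply: rpredX.
have [S [[SA S1 SM ScP] Smax]] := exists_maximal_multset A ncond1.
have Smax1 r : r \in A -> ~ S r -> exists2 s, S s & cond (s * r).
  move=> Ar Sr; have [s [k [Ss csr]]] := Smax r Ar Sr; exists s => //.
  have Cr : r \in C by apply: sAC.
  have Cs : s \in C by apply: sAC; apply: SA.
  apply: (condX _ k); first exact: rpredM.
  have -> : (s * r) ^+ k.+1 = s * r ^+ k * (s ^+ k * r).
    by rewrite exprMn !exprS; ring.
  by apply: condM => //; apply: rpredM => //; apply: rpredX.
(* The conductor localised at [S] and pulled back to [C], as required by the rank one argument. *)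
pose N : set T := [set z | z \in C /\ exists2 s, S s & cond (s * z)].
have sN : is_submod C N.
  split=> [|u v [Cu [s Ss cu]] [Cv [t St cv]]|a u Ca [Cu [s Ss cu]]].
  - split; first exact: rpred0.
    by exists 1 => // d _; rewrite mulr0 mul0r rpred0.
  - split; first exact: rpredD.
    exists (s * t) => [|d Cd]; first exact: SM.
    have -> : s * t * (u + v) * d = s * u * (t * d) + t * v * (s * d) by ring.
    by apply: rpredD; [apply: cu|apply: cv]; apply: rpredM => //; apply: sAC; apply: SA.
  - split; first exact: rpredM.
    by exists s => //; rewrite mulrCA mulrC; apply: condM.
have radN z : z \in C -> N (z ^+ 2) -> N z.
  move=> Cz [_ [s Ss cz]]; split=> //; exists s => //.
  have Cs : s \in C by apply: sAC; apply: SA.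
  apply: cond2; first exact: rpredM.
  have -> : (s * z) ^+ 2 = s * z ^+ 2 * s by ring.
  exact: condM.
have SN a : a \in A -> ~ N a -> S a.
  move=> Aa Na; apply: contrapT => nSa; apply: Na; split; first exact: sAC.
  by have [s Ss ?] := Smax1 a Aa nSa; exists s.
have regN a z : a \in A -> ~ N a -> z \in C -> N (a * z) -> N z.
  move=> Aa Na Cz [_ [s Ss caz]]; split=> //; exists (s * a); last by rewrite -mulrA.
  by apply: SM => //; apply: SN.
have N1 : ~ N 1 by move=> [_ [s /ScP]]; rewrite mulr1.
have [d [Ad Nd] dx] := rank_one_descent sAC sN radN regN N1 Cx Cy xyA xy1 Ax0.
have Sx i k : exists2 s, S s & s * (x i)`_k \in A.
  have [f /poly_subP Af /(_ k)[_ [s Ss]]] := dx i.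
  rewrite coefB coefZ => /condA; rewrite mulrBr => Asd.
  exists (s * d); first by apply: SM => //; apply: SN.
  rewrite -mulrA -(subrK (s * f`_k) (s * _)); apply: rpredD => //.
  by apply: rpredM => //; apply: SA.
have Ssub : is_submod A [set z | exists2 s, S s & s * z \in A].
  split=> [|u v [s Ss Asu] [t St Atv]|a u Aa [s Ss Asu]].
  - by exists 1 => //; rewrite mulr0 rpred0.
  - exists (s * t); first exact: SM.
    have -> : s * t * (u + v) = t * (s * u) + s * (t * v) by ring.
    by apply: rpredD; apply: rpredM => //; apply: SA.
  - by exists s => //; rewrite mulrCA; apply: rpredM.
have SX k : exists2 s, S s & s * X`_k \in A.
  rewrite coef_sum; apply: (submod_sum _ Ssub) => i _; rewrite coefZ.
  exact: (submodZ Ssub).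
(* One denominator serves all coefficients of [X]. Its m-th power multiplies [C], the m-th power of
   the content, into [A], and so lies in the conductor, which [S] avoids. *)
have [s Ss sX] : exists2 s, S s & forall k, s * X`_k \in A.
  suff [s Ss sX] : exists2 s, S s & forall k, (k < size X)%N -> s * X`_k \in A.
    exists s => // k; have [/sX//|kX] := ltnP k (size X).
    by rewrite nth_default // mulr0 rpred0.
  elim: (size X) => [|l [s Ss sX]]; first by exists 1.
  have [t St tX] := SX l; exists (s * t) => [|k]; first exact: SM.
  rewrite ltnS leq_eqVlt => /predU1P[->|/sX sXk].
    by rewrite -mulrA; apply: rpredM => //; apply: SA.
  by rewrite mulrAC; apply: rpredM => //; apply: SA.
have As : s \in A by apply: SA.
have sA := is_submod_ring (fun z Az => Az : z \in A).
have sF : F `<=` [set z | s * z \in A].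
  by apply: (coef_span_min (is_submod_preiml s sA)).
have sFk k : submod_exp A F k `<=` [set z | s ^+ k * z \in A].
  elim: k => [|k IH] z; first by rewrite /= mul1r.
  move: z; apply: (submod_expS_min (is_submod_preiml (s ^+ k.+1) sA)) => u v Fu Fv /=.
  have -> : s ^+ k.+1 * (u * v) = (s * u) * (s ^+ k * v) by rewrite exprS; ring.
  by apply: rpredM; [apply: sF|apply: IH].
have Ssm k : S (s ^+ k) by elim: k => [|k IH] //; rewrite exprS; apply: SM.
by case: (ScP _ (Ssm m)) => e /CP; apply: sFk.
Qed.

End PolyDescent.

(** * Weights on positive torsion-free monoids *)

Section Gordan.
Import Order.TTheory Num.Theory.
Variable l : nat.
Local Notation vec := 'rV[rat]_l.
Implicit Types (u v : vec) (us ds : seq vec) (phi psi : 'cV[rat]_l).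

Definition pairing u phi : rat := (u *m phi) 0 0.

Lemma pairingDl u v phi : pairing (u + v) phi = pairing u phi + pairing v phi.
Proof. by rewrite /pairing mulmxDl mxE. Qed.

Lemma pairingZl a u phi : pairing (a *: u) phi = a * pairing u phi.
Proof. by rewrite /pairing -scalemxAl mxE. Qed.

Lemma pairingDr u phi psi : pairing u (phi + psi) = pairing u phi + pairing u psi.
Proof. by rewrite /pairing mulmxDr mxE. Qed.

Lemma pairingZr a u phi : pairing u (a *: phi) = a * pairing u phi.
Proof. by rewrite /pairing -scalemxAr mxE. Qed.

Lemma pairing_tr_gt0 u : u != 0 -> 0 < pairing u u^T.
Proof.
move=> u0; have sq i : 0 <= u 0 i * u^T i 0 by rewrite mxE -expr2 sqr_ge0.
rewrite /pairing mxE lt_def sumr_ge0 ?andbT // psumr_eq0 //.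
apply: contra u0 => /allP u0; apply/eqP/rowP => i; rewrite mxE.
by have := u0 i (mem_index_enum i); rewrite mxE /= -expr2 sqrf_eq0 => /eqP.
Qed.

Lemma pairing_perturb us phi psi : {in us, forall u, 0 < pairing u phi} ->
  exists2 e, 0 < e & {in us, forall u, 0 < pairing u (phi + e *: psi)}.
Proof.
move=> pos; suff [e e0 eP] : exists2 e, 0 < e & forall e', 0 < e' <= e ->
    {in us, forall u, 0 < pairing u (phi + e' *: psi)}.
  by exists e => //; apply: eP; rewrite e0 lexx.
elim: us pos => [|u us IH] pos; first by exists 1.
have [v vus|e e0 eP] := IH; first by apply: pos; rewrite inE vus orbT.
pose d := pairing u phi / (`|pairing u psi| + 1).
have b0 : 0 < `|pairing u psi| + 1 by rewrite ltr_wpDl.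
have u0 : 0 < pairing u phi by apply: pos; rewrite inE eqxx.
exists (Order.min e d) => [|e' /andP[e'0]].
  by rewrite lt_min e0 divr_gt0.
rewrite le_min => /andP[e'e e'd] v; rewrite inE => /predU1P[->|]; last first.
  by apply: eP; rewrite e'0 e'e.
rewrite pairingDr pairingZr.
have : e' * (`|pairing u psi| + 1) <= pairing u phi by rewrite -ler_pdivlMr.
have : - (e' * `|pairing u psi|) <= e' * pairing u psi.
  by rewrite -mulrN ler_pM2l // lerNl ler_normr lexx orbT.
by move: e'0; rewrite mulrDr; lra.
Qed.

(** Induction on the number of vectors. If the functional [phi] found for [us] is negative at [v],
    the vectors of [us] are projected along [v] to the kernel of [phi]. A functional positive on the
    projections yields one that is positive on [us] and zero at [v], and a small multiple of [- phi]
    corrects the value at [v]. *)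
Lemma gordan us :
  (forall c : nat -> rat, (forall i, 0 <= c i) ->
     \sum_(i < size us) c i *: us`_i = 0 -> forall i, (i < size us)%N -> c i = 0) ->
  exists phi, {in us, forall u, 0 < pairing u phi}.
Proof.
have [n] : exists n, (size us <= n)%N by exists (size us).
elim: n us => [|n IH] [|v us] //=; try by exists 0.
rewrite ltnS => sn indep.
have [c c0 c_rel i iu|phi phiP] := IH us sn.
  apply: (indep (fun j => if j is j'.+1 then c j' else 0) _ _ i.+1) => //.
    by case.
  by rewrite big_ord_recl /= scale0r add0r.
have v0 : v != 0.
  apply/eqP => v0; suff /eqP: 1 = 0 :> rat by rewrite oner_eq0.
  apply: (indep (fun j => (j == 0)%N%:R) _ _ 0%N) => //.
  by rewrite big_ord_recl /= v0 scaler0 add0r big1 // => i _; rewrite scale0r.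
have [pv|pv|pv] := ltrgt0P (pairing v phi).
- by exists phi => u; rewrite inE => /predU1P[->|/phiP].
- pose w u := - pairing v phi *: u + pairing u phi *: v.
  have s0 : 0 < - pairing v phi by rewrite oppr_gt0.
  have [||psi psiP] := IH (map w us); first by rewrite size_map.
    rewrite size_map => c c0 c_rel i iu.
    pose c' j := if j is j'.+1 then - pairing v phi * c j'
      else \sum_(j' < size us) c j' * pairing us`_j' phi.
    have c'0 j : 0 <= c' j.
      case: j => [|j] /=; last by rewrite mulr_ge0 // ltW.
      apply: sumr_ge0 => j _; rewrite mulr_ge0 // ltW //.
      by apply: phiP; apply: mem_nth.
    have c'_rel : \sum_(j < (size us).+1) c' j *: (v :: us)`_j = 0.
      rewrite big_ord_recl /= addrC scaler_suml -big_split -[RHS]c_rel /=.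
      apply: eq_bigr => j _; rewrite (nth_map 0) // /w scalerDr !scalerA.
      by rewrite [c j * - _]mulrC addrC.
    have /eqP := indep c' c'0 c'_rel i.+1 iu.
    by rewrite /= mulf_eq0 (gt_eqF s0) => /eqP.
  have ev u : u \in us -> 0 < pairing u (- pairing v phi *: psi + pairing v psi *: phi).
    move=> uus; have := psiP _ (map_f w uus).
    by rewrite /w !pairingDl !pairingZl pairingDr !pairingZr; lra.
  have [e e0 eP] := pairing_perturb (- phi) ev.
  exists (- pairing v phi *: psi + pairing v psi *: phi + e *: - phi) => u.
  rewrite inE => /predU1P[->|/eP //].
  rewrite !pairingDr !pairingZr -scaleN1r pairingZr.
  have : 0 < e * - pairing v phi by apply: mulr_gt0.
  by lra.
- have [e e0 eP] := pairing_perturb v^T phiP.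
  exists (phi + e *: v^T) => u; rewrite inE => /predU1P[->|/eP //].
  by rewrite pairingDr pairingZr pv add0r mulr_gt0 // pairing_tr_gt0.
Qed.

(** Each [d] receives a sign realised by some functional positive on [us], and then joins the
    vectors on which positivity is preserved. *)
Lemma pairing_separate us ds phi : {in us, forall u, 0 < pairing u phi} ->
  {in ds, forall d, d != 0} ->
  exists psi, {in us, forall u, 0 < pairing u psi} /\ {in ds, forall d, pairing d psi != 0}.
Proof.
elim: ds us phi => [|d ds IH] us phi pos ds0; first by exists phi.
have ds0' : {in ds, forall d, d != 0}.
  by move=> d' dd'; apply: ds0; rewrite inE dd' orbT.
have [psi [b pos']] : exists psi (b : bool),
    {in (-1) ^+ b *: d :: us, forall u, 0 < pairing u psi}.
  have [pd|pd|pd] := ltrgt0P (pairing d phi).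
  - by exists phi, false => u; rewrite expr0 scale1r inE => /predU1P[->|/pos].
  - exists phi, true => u; rewrite inE => /predU1P[->|/pos//].
    by rewrite expr1 pairingZl mulN1r oppr_gt0.
  - have [e e0 eP] := pairing_perturb d^T pos.
    exists (phi + e *: d^T), false => u; rewrite expr0 scale1r inE => /predU1P[->|/eP//].
    rewrite pairingDr pairingZr pd add0r mulr_gt0 // pairing_tr_gt0 //.
    by apply: ds0; rewrite inE eqxx.
have [chi [posc dsc]] := IH _ _ pos' ds0'.
exists chi; split=> [u uus|d']; first by apply: posc; rewrite inE uus orbT.
rewrite inE => /predU1P[->|/dsc//].
have := posc _ (mem_head _ _); rewrite pairingZl.
by case: eqP => // ->; rewrite mulr0 ltxx.
Qed.

End Gordan.

(** * Additive weights on finitely many monomials *)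

Section Weights.
Import Order.TTheory Num.Theory.
Variable M : conomType.
Hypotheses (cancM : cancellative_monoid M) (tfM : torsion_free_monoid M).

Definition mexp (a : M) n : M := iter n (mmul a) mone.

Lemma mexpD a n p : mexp a (n + p) = mmul (mexp a n) (mexp a p).
Proof. by elim: n => [|n IH]; rewrite ?mul1m // addSn /= IH mulmA. Qed.

Lemma mexp1m n : mexp mone n = mone.
Proof. by elim: n => //= n ->; rewrite mul1m. Qed.

Lemma mexpMm a b n : mexp (mmul a b) n = mmul (mexp a n) (mexp b n).
Proof.
elim: n => [|n IH] /=; first by rewrite mul1m.
by rewrite IH; exact: (Monoid.mulmACA (mmul : Monoid.com_law mone)).
Qed.

Lemma mexpM a n p : mexp a (n * p) = mexp (mexp a p) n.
Proof. by elim: n => //= n IH; rewrite mulSn mexpD IH. Qed.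

Section Evaluation.
Variables (k : nat) (L : 'I_k -> M).

Definition meval (f : 'I_k -> nat) : M := \big[mmul/mone]_i mexp (L i) (f i).

Lemma eq_meval f g : f =1 g -> meval f = meval g.
Proof. by move=> fg; apply: eq_bigr => i _; rewrite fg. Qed.

Lemma mevalD f g : meval (fun i => f i + g i)%N = mmul (meval f) (meval g).
Proof. by rewrite -big_split; apply: eq_bigr => i _; rewrite mexpD. Qed.

Lemma meval_mexp f n : meval (fun i => n * f i)%N = mexp (meval f) n.
Proof.
rewrite /meval (@big_morph _ _ (fun a => mexp a n) mone mmul mone mmul).
- by apply: eq_bigr => i _; rewrite mexpM.
- by move=> a b; apply: mexpMm.
- exact: mexp1m.
Qed.

Lemma meval0 : meval (fun=> 0%N) = mone.
Proof. by apply: big1. Qed.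

Lemma meval_sum (J : finType) (f : J -> 'I_k -> nat) :
  meval (fun i => \sum_j f j i)%N = \big[mmul/mone]_j meval (f j).
Proof.
rewrite exchange_big; apply: eq_bigr => i _.
by apply: (@big_morph _ _ (mexp (L i)) mone mmul 0%N addn) => // n p; apply: mexpD.
Qed.

Lemma meval_delta i : meval (fun j => (j == i)) = L i.
Proof.
rewrite /meval (bigD1 i) //= eqxx big1 ?mulm1 //= ?mulm1 // => j /negPf->.
by [].
Qed.

(** Positivity of the monoid, in the form [unitm], enters the construction of weights here. *)
Lemma meval_eq1 f i : meval f = mone -> (0 < f i)%N -> L i = mone.
Proof.
rewrite /meval (bigD1 i) //= => /unitm[+ _]; case: (f i) => // n.
by move=> /= /unitm[].
Qed.

End Evaluation.

Lemma clear_denom (I : finType) (q : I -> rat) :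
  exists2 n : nat, (0 < n)%N & exists z : I -> int, forall i, n%:R * q i = (z i)%:~R.
Proof.
pose den i := `|denq (q i)|%N.
have den0 i : (0 < den i)%N by rewrite absz_gt0 denq_neq0.
exists (\prod_i den i)%N; first by rewrite prodn_gt0.
exists (fun i => (\prod_(j | j != i) den j)%N%:Z * numq (q i)) => i.
have ed : (den i)%:R = (denq (q i))%:~R :> rat by rewrite pmulrn absz_denq.
by rewrite (bigD1 i) //= natrM intrM numqE ed -pmulrn; ring.
Qed.

Section Relations.
Variables (k : nat) (L : 'I_k -> M) (J : finType) (P Q : J -> 'I_k -> nat).
Hypothesis PQ : forall j, meval L (P j) = meval L (Q j).

(* An equality of f and g modulo the rational span of the relations P_j = Q_j
   holds in M up to a power. *)
Lemma rational_relation (f g : 'I_k -> nat) (d : J -> rat) :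
  (forall i, (f i)%:R - (g i)%:R = \sum_j d j * ((P j i)%:R - (Q j i)%:R)) ->
  exists2 n, (0 < n)%N & mexp (meval L f) n = mexp (meval L g) n.
Proof.
move=> fg; have [n n0 [z zP]] := clear_denom d.
pose p j := if 0 <= z j then `|z j|%N else 0%N.
pose m j := if 0 <= z j then 0%N else `|z j|%N.
have zE j : (z j)%:~R = (p j)%:R - (m j)%:R :> rat.
  rewrite /p /m; case: ifP => zj; rewrite ?subr0 ?sub0r.
    by rewrite natr_absz ger0_norm.
  by rewrite natr_absz ltr0_norm ?ltNge ?zj // rmorphN opprK.
exists n => //; rewrite -!meval_mexp.
(* [p] and [m] are the positive and negative parts of the integral coefficients. Multiplying both
   sides by [X], written in two ways through [PQ], turns the relation into an identity of exponents;
   then [X] is cancelled. *)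
pose X := \big[mmul/mone]_j mmul (mexp (meval L (P j)) (m j)) (mexp (meval L (P j)) (p j)).
apply: (cancM (x := X)); rewrite -[LHS]mulmC -[RHS]mulmC.
have XE : X = meval L (fun i => \sum_j (m j * P j i + p j * Q j i))%N.
  rewrite meval_sum; apply: eq_bigr => j _.
  by rewrite mevalD !meval_mexp PQ.
have XE' : X = meval L (fun i => \sum_j (p j * P j i + m j * Q j i))%N.
  rewrite meval_sum; apply: eq_bigr => j _.
  by rewrite mevalD !meval_mexp PQ mulmC.
rewrite {1}XE XE' -!mevalD; apply: eq_meval => i.
apply/eqP; rewrite -(eqr_nat rat) !natrD !natrM !natr_sum -subr_eq0.
have := congr1 (fun x => n%:R * x) (fg i); rewrite mulrBr mulr_sumr => e.
have {}e : n%:R * (f i)%:R - n%:R * (g i)%:R =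
    \sum_j ((p j * P j i + m j * Q j i)%N%:R - (m j * P j i + p j * Q j i)%N%:R) :> rat.
  rewrite e; apply: eq_bigr => j _; rewrite mulrA zP zE !natrD !natrM; ring.
by rewrite sumrB in e; apply/eqP; lra.
Qed.

End Relations.

(** The vectors [u i] are the classes of the unit vectors modulo the rational span of the relations
    e_a + e_b - e_c, one for each product of listed elements that is again listed. Positivity of the
    monoid gives the hypothesis of Gordan's theorem, torsion-freeness keeps the classes of distinct
    elements apart, and clearing denominators in a separating functional gives natural numbers. *)
Lemma weight_indexed k (L : 'I_k -> M) : exists w : 'I_k -> nat,
  [/\ forall a b c, mmul (L a) (L b) = L c -> w c = (w a + w b)%N,
      forall a, L a != mone -> (0 < w a)%N
    & forall a b, L a != L b -> w a != w b].
Proof.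
pose J : finType := ('I_k * 'I_k * 'I_k)%type.
pose valid (t : J) := mmul (L t.1.1) (L t.1.2) == L t.2.
pose P (t : J) i := (valid t * ((i == t.1.1) + (i == t.1.2)))%N.
pose Q (t : J) i := (valid t * (i == t.2))%N.
have PQ t : meval L (P t) = meval L (Q t).
  rewrite /P /Q; case: (boolP (valid t)) => [/eqP tv|_] /=.
    under eq_meval do rewrite mul1n; under [RHS]eq_meval do rewrite mul1n.
    by rewrite mevalD !meval_delta.
  by apply: eq_meval => i; rewrite ?mul0n.
pose R : 'M[rat]_(#|J|, k) := \matrix_(j, i) ((P (enum_val j) i)%:R - (Q (enum_val j) i)%:R).
pose row_of (f g : 'I_k -> nat) : 'rV[rat]_k := \row_i ((f i)%:R - (g i)%:R).
have inR (f g : 'I_k -> nat) : row_of f g *m cokermx R = 0 ->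
    exists2 n, (0 < n)%N & mexp (meval L f) n = mexp (meval L g) n.
  move/eqP; rewrite -submxE => /submxP[D eD].
  apply: (rational_relation PQ (d := fun t => D 0 (enum_rank t))) => i.
  have := congr1 (fun A : 'rV_k => A 0 i) eD; rewrite !mxE => ->.
  rewrite [RHS](reindex (@enum_val J J)) /=; last exact/onW_bij/enum_val_bij.
  by apply: eq_bigr => j _; rewrite !mxE enum_valK.
pose u i := row i (cokermx R).
have uE (c : 'I_k -> rat) : \sum_i c i *: u i = (\row_i c i) *m cokermx R.
  by rewrite mulmx_sum_row; apply: eq_bigr => i _; rewrite mxE.
have u_pos (c : 'I_k -> rat) : (forall i, 0 <= c i) -> \sum_i c i *: u i = 0 ->
    forall i, L i != mone -> c i = 0.
  move=> c0 c_rel i Li; have [n n0 [z zP]] := clear_denom c.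
  have zE j : (`|z j|%N)%:R = n%:R * c j.
    rewrite zP pmulrn gez0_abs // -(ler0z rat) -zP mulr_ge0 ?ler0n //.
  have [|p p0] := inR (fun j => `|z j|%N) (fun=> 0%N).
    have -> : row_of (fun j => `|z j|%N) (fun=> 0%N) = n%:R *: \row_j c j.
      by apply/rowP => j; rewrite !mxE subr0 zE.
    by rewrite -scalemxAl -uE c_rel scaler0.
  rewrite meval0 mexp1m -meval_mexp => e1.
  apply/eqP; move: Li; apply: contraNT => ci; apply/eqP.
  apply: (meval_eq1 e1); rewrite muln_gt0 p0 lt0n -(pnatr_eq0 rat) zE.
  by rewrite mulf_neq0 // pnatr_eq0 -lt0n.
have u_sep a b : L a != L b -> u a - u b != 0.
  apply: contraNneq => uab; have [|p p0] := inR (fun j => (j == a)) (fun j => (j == b)).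
    rewrite -[RHS]uab -(uE (fun j => (j == a)%:R - (j == b)%:R)).
    under eq_bigr do rewrite scalerBl; rewrite sumrB; congr (_ - _).
      by rewrite (bigD1 a) //= eqxx scale1r big1 ?addr0 // => j /negPf->; rewrite scale0r.
    by rewrite (bigD1 b) //= eqxx scale1r big1 ?addr0 // => j /negPf->; rewrite scale0r.
  by rewrite !meval_delta => /(tfM p0) ->.
pose us := [seq u i | i <- enum 'I_k & L i != mone].
pose ds := [seq u p.1 - u p.2 | p <- enum {: 'I_k * 'I_k} & L p.1 != L p.2].
have [phi0 phi0P] : exists phi, {in us, forall v, 0 < pairing v phi}.
  apply: gordan => c c0.
  pose E := [seq i <- enum 'I_k | L i != mone].
  have uE' : uniq E by rewrite filter_uniq // enum_uniq.
  rewrite size_map -/E => c_rel j jE.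
  have i0 : 'I_k by case: (E) jE => // i0.
  have := u_pos (fun i => if L i == mone then 0 else c (index i E)) _ _ (nth i0 E j).
  have Lj : L (nth i0 E j) != mone by have := mem_nth i0 jE; rewrite mem_filter => /andP[].
  rewrite (negPf Lj) index_uniq //; apply=> // [i|]; first by case: ifP.
  rewrite -[RHS]c_rel -(big_mkord xpredT (fun i => c i *: (map u E)`_i)).
  rewrite (bigID (fun i => L i == mone)) /= big1 ?add0r => [|i ->]; last by rewrite scale0r.
  have sumE (F : 'I_k -> 'rV[rat]_k) : \sum_(i | L i != mone) F i = \sum_(i <- E) F i.
    by rewrite big_filter big_enum_cond; apply: eq_bigl.
  rewrite sumE (big_nth i0).
  rewrite big_nat_cond [in RHS]big_nat_cond; apply: eq_bigr => i /andP[/andP[_ iE] _].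
  have Li : L (nth i0 E i) != mone by have := mem_nth i0 iE; rewrite mem_filter => /andP[].
  by rewrite (negPf Li) index_uniq // (nth_map i0).
have [|phi [phi_us phi_ds]] := pairing_separate (ds := ds) phi0P.
  by move=> d /mapP[[a b]]; rewrite mem_filter => /andP[/= ab _] ->; apply: u_sep.
have phi_rel a b c : mmul (L a) (L b) = L c ->
    pairing (u c) phi = pairing (u a) phi + pairing (u b) phi.
  move=> abc; suff e : u a + u b = u c by rewrite -e pairingDl.
  have := mulmx_coker R => /(congr1 (row (enum_rank (a, b, c)))).
  rewrite row_mul row0 mulmx_sum_row => /eqP.
  rewrite (eq_bigr (fun i => (i == a)%:R *: u i + (i == b)%:R *: u i - (i == c)%:R *: u i)).
    have sumd x : \sum_i (i == x)%:R *: u i = u x.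
      by rewrite (bigD1 x) //= eqxx scale1r big1 ?addr0 // => j /negPf->; rewrite scale0r.
    by rewrite sumrB big_split /= !sumd subr_eq0 => /eqP.
  move=> i _; rewrite !mxE enum_rankK /P /Q /valid /= abc eqxx !mul1n natrD.
  by rewrite scalerBl scalerDl.
have [n n0 [z zP]] := clear_denom (fun i => pairing (u i) phi).
have phi_ge0 i : 0 <= pairing (u i) phi.
  have [Li|Li] := eqVneq (L i) mone; last first.
    by apply/ltW/phi_us/mapP; exists i; rewrite // mem_filter Li mem_enum.
  have := phi_rel i i i; rewrite Li mul1m => /(_ erefl).
  by move: (pairing _ _) => x; lra.
have zE i : (`|z i|%N)%:R = n%:R * pairing (u i) phi.
  by rewrite zP pmulrn gez0_abs // -(ler0z rat) -zP mulr_ge0 ?ler0n.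
have nR0 : n%:R != 0 :> rat by rewrite pnatr_eq0 -lt0n.
exists (fun i => `|z i|%N); split=> [a b c abc|a La|a b Lab].
- by apply/eqP; rewrite -(eqr_nat rat) natrD !zE (phi_rel a b c abc) mulrDr.
- rewrite lt0n -(pnatr_eq0 rat) zE mulf_neq0 // gt_eqF //.
  by apply/phi_us/mapP; exists a; rewrite // mem_filter La mem_enum.
- rewrite -(eqr_nat rat) !zE (inj_eq (mulfI nR0)) -subr_eq0.
  have := phi_ds (u a - u b); rewrite pairingDl -scaleN1r pairingZl mulN1r; apply.
  by apply/mapP; exists (a, b); rewrite ?scaleN1r // mem_filter Lab mem_enum.
Qed.

(** The list is enlarged by 1 and by all products of two members of [s], so that these products
    occur among the relations of [weight_indexed]. *)
Lemma exists_weight (s : seq M) : exists w : M -> nat,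
  [/\ {in s &, forall a b, w (mmul a b) = (w a + w b)%N}, w mone = 0%N,
      {in s, forall a, a != mone -> (0 < w a)%N} & {in s &, injective w}].
Proof.
pose l := mone :: s ++ [seq mmul a b | a <- s, b <- s].
have [w [wD w_gt0 w_inj]] := weight_indexed (tnth (in_tuple l)).
pose W m := if [pick i | tnth (in_tuple l) i == m] is Some i then w i else 0%N.
have WP m : m \in l -> exists2 i, tnth (in_tuple l) i = m & W m = w i.
  move=> /(tnthP (in_tuple l))[i0 mi0]; rewrite /W.
  by case: pickP => [i /eqP mi|/(_ i0)]; [exists i|rewrite -mi0 eqxx].
have sl m : m \in s -> m \in l by move=> ms; rewrite inE mem_cat ms orbT.
exists W; split=> [a b sa sb||a sa a1|a b sa sb].
- have [i ia ->] := WP a (sl _ sa); have [j jb ->] := WP b (sl _ sb).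
  have [|h hab ->] := WP (mmul a b).
    by rewrite inE mem_cat allpairs_f ?orbT.
  by apply: wD; rewrite ia jb hab.
- have [i i1 ->] := WP mone (mem_head _ _).
  by have := wD i i i; rewrite i1 mul1m => /(_ erefl); lia.
- by have [i ia ->] := WP a (sl _ sa); apply: w_gt0; rewrite ia.
- have [i ia ->] := WP a (sl _ sa); have [j jb ->] := WP b (sl _ sb).
  by move/eqP => wij; apply/eqP; move: wij; apply: contraTT => ab; apply: w_inj; rewrite ia jb.
Qed.

End Weights.

(** * The map theta *)

Section Theta.
Variable T : comNzRingType.
Local Open Scope classical_set_scope.
Local Open Scope ring_scope.
Implicit Types A B C : subringClosed T.

Lemma finitely_subintegral_subintegral A C :
  finitely_subintegral A C -> subintegral A C.
Proof. by move=> fC x; split=> [Cx|[D [_ sDC /sDC]]//]; exists C; split. Qed.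

(** [b ^+ 2] and [b ^+ 3] already lie in a finite stage [D]; then [D[b]] is subintegral over [A],
    and maximality applies. *)
Lemma subintegral_closure_closed A B C :
  is_subintegral_closure A B C -> subint_closed C B.
Proof.
move=> [sCB subC maxC] b Bb b2 b3.
have [|D [fD sDC sD]] := subintegral_finite subC (s := [:: b ^+ 2; b ^+ 3]).
  by move=> x; rewrite !inE => /orP[] /eqP->.
have D2 : b ^+ 2 \in D by apply: sD; rewrite mem_head.
have D3 : b ^+ 3 \in D by apply: sD; rewrite !inE eqxx orbT.
pose E : subringClosed T := adjoin D b.
have fE : finitely_subintegral A E.
  apply: (finitely_subintegral_step fD); exists b; split=> // x.
  by split=> [/asboolP|?]; last apply/asboolP.
apply: (maxC E).
- move=> _ /asboolP[p /polyOverP Dp ->]; rewrite horner_coef; apply: rpred_sum => i _.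
  by apply: rpredM; [apply: sCB; apply: sDC|apply: rpredX].
- exact: finitely_subintegral_subintegral.
- by apply/asboolP; exists 'X; rewrite ?hornerX // polyOverX.
Qed.

Lemma invmod_map_id A B (sAB : {subset A <= B}) hA hB (I : invmod sAB) :
  invmod_map idfun sAB sAB hA hB I = I.
Proof.
apply: invmod_inj; apply/seteqP; split=> x /=; last first.
  by move=> Ix; apply: sub_submod_span; exists x.
by apply: submod_span_min => [|_ [y Iy <-] //]; apply: invmod_submod.
Qed.

Section WeightMap.
Variables (M : conomType) (w : M -> nat).

(** The substitution of ['X^(w m)] for the monomial [m]: additive for every [w], but compatible with
    products only where [w] is additive. *)
Definition weight_map : {malg T[M]} -> {poly T} :=
  mmap (polyC : {additive T -> {poly T}}) (fun m => 'X^(w m)).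

Lemma weight_mapE f : weight_map f = \sum_(m <- msupp f) f@_m *: 'X^(w m).
Proof. by apply: eq_bigr => m _; rewrite mul_polyC. Qed.

Lemma weight_map_sum n (F : 'I_n -> {malg T[M]}) :
  weight_map (\sum_i F i) = \sum_i weight_map (F i).
Proof. exact: raddf_sum. Qed.

Variable s : seq M.
Hypotheses (wD : {in s &, forall a b, w (mmul a b) = (w a + w b)%N})
  (w1 : w mone = 0%N) (w_gt0 : {in s, forall a, a != mone -> (0 < w a)%N})
  (w_inj : {in s &, injective w}).

Lemma weight_map1 : weight_map 1 = 1.
Proof. by rewrite /weight_map mmapU w1 expr0 mulr1. Qed.

Lemma weight_mapM f g : {subset msupp f <= s} -> {subset msupp g <= s} ->
  weight_map (f * g) = weight_map f * weight_map g.
Proof.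
move=> fs gs; rewrite malgME /weight_map raddf_sum /= [X in _ = X * _]mmapE mulr_suml.
rewrite big_seq [RHS]big_seq; apply: eq_bigr => a fa.
rewrite raddf_sum /= [X in _ = _ * X]mmapE mulr_sumr.
rewrite big_seq [RHS]big_seq; apply: eq_bigr => b gb.
by rewrite mmapU (wD (fs _ fa) (gs _ gb)) exprD /= polyCM; ring.
Qed.

Lemma weight_map_sub A f : f \in monalg_sub A -> weight_map f \in poly_sub A.
Proof.
move=> /monalg_subP Af; rewrite weight_mapE; apply: rpred_sum => m _.
by apply: poly_subZ => //; apply: poly_subXn.
Qed.

Lemma coef_weight_map f m : {subset msupp f <= s} -> m \in s ->
  (weight_map f)`_(w m) = f@_m.
Proof.
move=> fs ms; rewrite weight_mapE coef_sum.
have [mf|mf] := boolP (m \in msupp f); last first.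
  rewrite (mcoeff_outdom mf) big_seq big1 // => a fa.
  rewrite coefZ coefXn; case: eqP => [/(w_inj ms (fs _ fa)) ema|_]; last by rewrite mulr0.
  by rewrite ema fa in mf.
rewrite (bigD1_seq m) ?fset_uniq //= big_seq_cond big1 ?addr0 => [|a /andP[fa am]].
  by rewrite coefZ coefXn eqxx mulr1.
rewrite coefZ coefXn; case: eqP => [/(w_inj ms (fs _ fa)) ema|_]; last by rewrite mulr0.
by rewrite ema eqxx in am.
Qed.

Lemma coef0_weight_map f : {subset msupp f <= s} -> (weight_map f)`_0 = f@_mone.
Proof.
move=> fs; rewrite weight_mapE coef_sum.
have z a : a \in msupp f -> a != mone -> (f@_a *: 'X^(w a))`_0 = 0.
  move=> /fs sa /(w_gt0 sa); rewrite coefZ coefXn.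
  by case: (w a) => // k _; rewrite mulr0.
have [mf|mf] := boolP (mone \in msupp f); last first.
  rewrite (mcoeff_outdom mf) big_seq big1 // => a fa; apply: z => //.
  by apply: contraNneq mf => <-.
rewrite (bigD1_seq mone) ?fset_uniq //= big_seq_cond big1 ?addr0; last first.
  by move=> a /andP[fa am]; apply: z.
by rewrite coefZ coefXn w1 mulr1.
Qed.

End WeightMap.

(** * Bijectivity of theta over a subintegrally closed subring *)

Section Bijective.
Variables (A B : subringClosed T) (sAB : {subset A <= B}) (M : conomType).
Hypotheses (clA : subint_closed A B).
Hypotheses (cancM : cancellative_monoid M) (tfM : torsion_free_monoid M).

Let eps : {rmorphism {malg T[M]} -> T} := mcoeff mone.

Let eps_homo (D : subringClosed T) :
  {homo eps : x / x \in (monalg_sub D : subringClosed {malg T[M]}) >-> x \in D}.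
Proof. by move=> f /monalg_subP; apply. Qed.

Let augm : {additive invmod (sub_monalg (M := M) sAB) -> invmod sAB} :=
  invmod_map eps (sub_monalg sAB) sAB (@eps_homo A) (@eps_homo B).

Lemma augmK I : augm (invmod_theta M sAB I) = I.
Proof.
transitivity (invmod_map idfun sAB sAB (homo_idfun (@subring_subxx _ A))
  (homo_idfun (@subring_subxx _ B)) I); last exact: invmod_map_id.
by apply: invmod_map_comp => x; apply: malgCK.
Qed.

(** A weight adapted to the supports of a dual basis carries it to a dual pair of polynomials. Its
    positivity turns the augmentation into the constant term, and its injectivity lets the
    coefficients of [x i] be read off again. *)
Lemma augm_eq0_sub K : augm K = 0 -> forall f, invmod_set K f -> f \in monalg_sub A.
Proof.
move=> K0; have K0' : augm (- K) = 0 by rewrite raddfN K0 oppr0.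
have augA (L : invmod (sub_monalg (M := M) sAB)) f :
    augm L = 0 -> invmod_set L f -> f@_mone \in A.
  move=> L0 Lf; suff : invmod_set (augm L) (eps f) by rewrite L0.
  exact: mem_invmod_map.
have [n [x [y [Kx Ky xy1]]]] := invmod_dual_basis K.
pose s := flatten [seq (msupp (x i) ++ msupp (y i) : seq M) | i <- enum 'I_n].
have xs i : {subset msupp (x i) <= s}.
  move=> m mx; apply/flattenP; exists (msupp (x i) ++ msupp (y i)); last by rewrite mem_cat mx.
  by apply/mapP; exists i; rewrite ?mem_enum.
have ys i : {subset msupp (y i) <= s}.
  move=> m my; apply/flattenP; exists (msupp (x i) ++ msupp (y i)).
    by apply/mapP; exists i; rewrite ?mem_enum.
  by rewrite mem_cat my orbT.
have [w [wD w1 w_gt0 w_inj]] := exists_weight cancM tfM s.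
have xA i : weight_map w (x i) \in poly_sub A.
  apply: (@subint_closed_descent T A B n (fun i => weight_map w (x i))
    (fun i => weight_map w (y i)) sAB clA _ _ _ _ _ _ i).
  - by move=> j; apply: weight_map_sub; apply: invmod_subB (Kx j).
  - by move=> j; apply: weight_map_sub; apply: invmod_subB (Ky j).
  - move=> j k; rewrite -(weight_mapM wD) //; apply: weight_map_sub.
    exact: invmod_mul_mem (Kx j) (Ky k).
  - rewrite -(weight_map1 w1) -xy1 weight_map_sum; apply: eq_bigr => j _.
    by rewrite (weight_mapM wD).
  - by move=> j; rewrite (coef0_weight_map w1 w_gt0) //; apply: augA (Kx j).
  - by move=> j; rewrite (coef0_weight_map w1 w_gt0) //; apply: augA (Ky j).
have xA' i : x i \in monalg_sub A.
  apply/monalg_subP => m; have [mx|/mcoeff_outdom->] := boolP (m \in msupp (x i)).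
    rewrite -(coef_weight_map w_inj (@xs i)); last exact: xs mx.
    by have /poly_subP := xA i; apply.
  exact: rpred0.
move=> f Kf; rewrite -[f]mulr1 -xy1 mulr_sumr; apply: rpred_sum => i _.
by rewrite mulrCA mulrC; apply: rpredM => //; apply: invmod_mul_mem Kf (Ky i).
Qed.

(** [augm] is a left inverse. For the other side, the quotient of [J] by the extension of its
    augmentation has trivial augmentation, hence is trivial. *)
Theorem invmod_theta_bijective : bijective (invmod_theta M sAB).
Proof.
exists augm => [I|J]; first exact: augmK.
apply/eqP; rewrite eq_sym -subr_eq0; apply/eqP.
have K0 : augm (J - invmod_theta M sAB (augm J)) = 0 by rewrite raddfB augmK subrr.
apply: invmod_eq0 => f; apply: augm_eq0_sub => //.
by rewrite raddfN K0 oppr0.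
Qed.

End Bijective.

End Theta.

(** * Elementary extensions *)

Section QuadMod.
Variable T : comNzRingType.
Local Open Scope classical_set_scope.
Local Open Scope ring_scope.
Implicit Types A B C D : subringClosed T.

(** Stands for the module generated by exp(bQ), whose terms after the linear one are absorbed by
    [b ^+ 2] times [C]. *)
Definition quad_mod A C b Q : set T :=
  [set x | exists a z, [/\ a \in A, z \in C & x = (1 + b * Q) * a + b ^+ 2 * z]].

Variables (A C : subringClosed T) (b : T).
Hypothesis ACb : quad_ext A C b.

Lemma quad_mod_submod Q : Q \in A -> is_submod A (quad_mod A C b Q).
Proof.
have sAC := quad_ext_sub ACb; move=> AQ.
split=> [|_ _ [a [z [Aa Cz ->]]] [a' [z' [Aa' Cz' ->]]]|e _ Ae [a [z [Aa Cz ->]]]].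
- by exists 0, 0; rewrite !rpred0; split=> //; ring.
- by exists (a + a'), (z + z'); split; [exact: rpredD|exact: rpredD|ring].
- exists (e * a), (e * z); split; [exact: rpredM| |ring].
  by apply: rpredM => //; apply: sAC.
Qed.

Lemma quad_mod_sub Q : Q \in A -> quad_mod A C b Q `<=` [set` C].
Proof.
have sAC := quad_ext_sub ACb; have Cb := quad_ext_gen ACb.
move=> AQ _ [a [z [Aa Cz ->]]] /=; apply: rpredD; apply: rpredM.
- by apply: rpredD; [exact: rpred1|apply: rpredM => //; apply: sAC].
- exact: sAC.
- exact: rpredX.
- by [].
Qed.

Lemma quad_mod_invertible (sAC : {subset A <= C}) Q : Q \in A ->
  is_invertible A C (quad_mod A C b Q).
Proof.
move=> AQ; have AQ' : - Q \in A by rewrite rpredN.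
have Cb := quad_ext_gen ACb; have CQ : Q \in C by apply: (sAC).
apply: (is_invertible_crit sAC (quad_mod_submod AQ) (quad_mod_sub AQ)
  (quad_mod_submod AQ') (quad_mod_sub AQ')) => [x y Ex Ey|].
  have Cy := quad_mod_sub AQ' Ey.
  case: Ex Ey => [a [z [Aa Cz ->]]] [a' [z' [Aa' Cz' ey]]].
  have -> : ((1 + b * Q) * a + b ^+ 2 * z) * y = a * a'
      + b ^+ 2 * ((1 + b * Q) * a * z' + z * y - Q ^+ 2 * a * a').
    by rewrite mulrDl [in X in X + _]ey; ring.
  apply: rpredD; first exact: rpredM.
  apply: (quad_ext_cond ACb); rewrite !(rpredB, rpredD, rpredM, rpredX, rpred1) //;
    exact: sAC.
have E1 q z : q \in A -> z \in C -> quad_mod A C b q (1 + b * q + b ^+ 2 * z).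
  by move=> Aq Cz; exists 1, z; rewrite rpred1 mulr1.
have E2 q z : q \in A -> z \in C -> quad_mod A C b q (b ^+ 2 * z).
  by move=> Aq Cz; exists 0, z; rewrite rpred0 mulr0 add0r.
set K := submod_mul _ _ _; have sK : is_submod A K := submod_mulP A _ _.
have A2 : b ^+ 2 * Q ^+ 2 \in A by apply: (quad_ext_cond ACb); apply: rpredX.
(* The product of [1 + b Q] and [1 - b Q] is [1 - b^2 Q^2]; the factor [1 + b^2 Q^2] pushes the
   error to [b^4 Q^4], a product of elements of [b^2 C]. *)
have -> : 1 = (1 + b ^+ 2 * Q ^+ 2) *
    ((1 + b * Q + b ^+ 2 * 0) * (1 + b * - Q + b ^+ 2 * 0))
    + (b ^+ 2 * Q ^+ 4) * (b ^+ 2 * 1) by ring.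
apply: (submodD sK).
  apply: (submodZ sK); first by apply: rpredD => //; apply: rpred1.
  by apply: mem_submod_mul; apply: E1; rewrite ?rpred0.
by apply: mem_submod_mul; apply: E2; rewrite ?rpredX ?rpred1.
Qed.

Lemma quad_mod_surj (sAC : {subset A <= C}) (I : invmod sAC) :
  exists2 Q, Q \in A & invmod_set I = quad_mod A C b Q.
Proof.
have Cb := quad_ext_gen ACb; have condA := quad_ext_cond ACb.
have sI := invmod_submod I.
(* The dual basis relation modulo [b ^+ 2] times [C]: combining the [x i] with the [A]-parts of the
   [y i] gives 1 up to a multiple of [b]. *)
have half (J : invmod sAC) : exists2 r, r \in A & invmod_set J (1 - b * r)
    /\ forall z, z \in C -> invmod_set J (b ^+ 2 * z).
  have [n [x [y [Jx Jy xy1]]]] := invmod_dual_basis J.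
  have Cx i : x i \in C := invmod_subB (Jx i).
  have Cy i : y i \in C := invmod_subB (Jy i).
  have Jb z : z \in C -> invmod_set J (b ^+ 2 * z).
    move=> Cz; rewrite -[_ * z]mulr1 -xy1 mulr_sumr.
    apply: (submod_sum _ (invmod_submod J)) => i _.
    have -> : b ^+ 2 * z * (x i * y i) = b ^+ 2 * (z * y i) * x i by ring.
    apply: (submodZ (invmod_submod J)) => //; apply: condA; exact: rpredM.
  case: (ACb) => b2 b3 CP.
  have /choice[a aP] : forall i, exists q : T * T,
      [/\ q.1 \in A, q.2 \in A & x i = q.1 + q.2 * b].
    by move=> i; have /CP[c0 [c1 ?]] := Cx i; exists (c0, c1).
  have /choice[d dP] : forall i, exists q : T * T,
      [/\ q.1 \in A, q.2 \in A & y i = q.1 + q.2 * b].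
    by move=> i; have /CP[c0 [c1 ?]] := Cy i; exists (c0, c1).
  exists (\sum_i (d i).2 * (a i).1).
    by apply: rpred_sum => i _; case: (aP i) (dP i) => ? ? _ [? ? _]; apply: rpredM.
  split=> //.
  have -> : 1 - b * (\sum_i (d i).2 * (a i).1) =
      \sum_i (d i).1 * x i + b ^+ 2 * \sum_i (d i).2 * (a i).2.
    rewrite -{1}xy1 !mulr_sumr -sumrB -big_split; apply: eq_bigr => i _ /=.
    by case: (aP i) (dP i) => _ _ -> [_ _ ->]; ring.
  apply: (submodD (invmod_submod J)).
    apply: (submod_sum _ (invmod_submod J)) => i _.
    by apply: (submodZ (invmod_submod J)) => //; case: (dP i).
  apply: Jb; apply: rpred_sum => i _; case: (aP i) (dP i) => _ A2 _ [_ A2' _].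
  by apply: (sAC); apply: rpredM.
have [r Ar [Ir Ib]] := half I; have [r' Ar' [Ir' _]] := half (- I).
exists (- r); first by rewrite rpredN.
apply/seteqP; split=> [z Iz|_ [a [z [Aa Cz ->]]]]; last first.
  apply: (submodD sI); last exact: Ib.
  by rewrite mulrC mulrN; apply: (submodZ sI).
pose s := z * (1 - b * r'); have As : s \in A := invmod_mul_mem Iz Ir'.
have Cz : z \in C := invmod_subB Iz.
have CA a : a \in A -> a \in C by apply: (sAC).
pose t := b * (r + r').
have At : t \in A.
  have -> : t = 1 + b ^+ 2 * (r * r') - (1 - b * r) * (1 - b * r') by rewrite /t; ring.
  apply: rpredB; last exact: invmod_mul_mem Ir Ir'.
  by apply: rpredD; [exact: rpred1|apply: condA; apply: CA; apply: rpredM].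
(* Modulo [b ^+ 2] times [C], [z] is [s * (1 + b * r')], and [1 + b * r'] is
   [(1 + t) * (1 - b * r)]; the second witness collects the exact error. *)
exists (s * (1 + t)), (r' ^+ 2 * z + s * (r * (r + r'))); split.
- by apply: rpredM => //; apply: rpredD => //; apply: rpred1.
- apply: rpredD; apply: rpredM => //; first by apply: rpredX; apply: CA.
    exact: CA.
  by apply: CA; apply: rpredM => //; apply: rpredD.
- by rewrite /s /t; ring.
Qed.

End QuadMod.

(** * Subintegral extensions of polynomial rings and monoid algebras *)

Section Transfer.
Variables (T : comNzRingType).
Implicit Types A C : subringClosed T.

Lemma sub_poly_sub A C : {subset A <= C} ->
  {subset (poly_sub A : subringClosed {poly T}) <= (poly_sub C : subringClosed {poly T})}.
Proof. by move=> sAC f /poly_subP Af; apply/poly_subP => i; apply: sAC. Qed.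

Lemma quad_ext_poly A C b : quad_ext A C b -> quad_ext (poly_sub A) (poly_sub C) b%:P.
Proof.
move=> ACb; have sAC := quad_ext_sub ACb; have Cb := quad_ext_gen ACb.
case: ACb => b2 b3 CP; split; rewrite -?polyC_exp ?poly_subC // => f.
split=> [/poly_subP Cf|[f0 [f1 [Af0 Af1 ->]]]]; last first.
  apply: rpredD; first exact: sub_poly_sub sAC _ Af0.
  by apply: rpredM; [exact: sub_poly_sub sAC _ Af1|exact: poly_subC].
have /choice[c cP] : forall i, exists q : T * T,
    [/\ q.1 \in A, q.2 \in A & f`_i = q.1 + q.2 * b].
  by move=> i; have /CP[c0 [c1 ?]] := Cf i; exists (c0, c1).
exists (\poly_(i < size f) (c i).1), (\poly_(i < size f) (c i).2); split.
- by apply/poly_subP => i; rewrite coef_poly; case: ifP => _; [case: (cP i)|apply: rpred0].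
- by apply/poly_subP => i; rewrite coef_poly; case: ifP => _; [case: (cP i)|apply: rpred0].
- apply/polyP => i; rewrite coefD coefMC !coef_poly; case: ltnP => [_|fi].
    by case: (cP i).
  by rewrite nth_default // mul0r addr0.
Qed.

Lemma finitely_subintegral_poly A D : finitely_subintegral A D ->
  finitely_subintegral (poly_sub A) (poly_sub D).
Proof.
elim=> [|C E _ IH /elementary_quad[b /quad_ext_poly CEb]]; first by left.
by apply: finitely_subintegral_step IH _; apply/elementary_quad; exists b%:P.
Qed.

Section MonAlg.
Variable M : conomType.

Lemma quad_ext_monalg A C b : quad_ext A C b ->
  quad_ext (monalg_sub A : subringClosed {malg T[M]}) (monalg_sub C) b%:MP.
Proof.
move=> ACb; have sAC := quad_ext_sub ACb; have Cb := quad_ext_gen ACb.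
case: ACb => b2 b3 CP; split; rewrite -?rmorphXn /= ?homo_malgC // => f.
split=> [/monalg_subP Cf|[f0 [f1 [Af0 Af1 ->]]]]; last first.
  apply: rpredD; first exact: sub_monalg sAC _ Af0.
  by apply: rpredM; [exact: sub_monalg sAC _ Af1|exact: homo_malgC].
have /choice[c cP] : forall m, exists q : T * T,
    [/\ q.1 \in A, q.2 \in A & f@_m = q.1 + q.2 * b].
  by move=> m; have /CP[c0 [c1 ?]] := Cf m; exists (c0, c1).
have AU (d : T) m : d \in A -> << d *g m >> \in (monalg_sub A : subringClosed {malg T[M]}).
  move=> Ad; apply/monalg_subP => m'; rewrite mcoeffU; case: eqP => _ //.
  exact: rpred0.
exists (\sum_(m <- msupp f) << (c m).1 *g m >>), (\sum_(m <- msupp f) << (c m).2 *g m >>).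
split.
- by apply: rpred_sum => m _; apply: AU; case: (cP m).
- by apply: rpred_sum => m _; apply: AU; case: (cP m).
- rewrite {1}[f]monalgE mulr_suml -big_split; apply: eq_bigr => m _ /=.
  case: (cP m) => _ _ ->; rewrite monalgUD; congr (_ + _).
  by rewrite [RHS]mulrC mul_malgC; apply/malgP => k; rewrite mcoeffZ !mcoeffU mulrnAr mulrC.
Qed.

Lemma finitely_subintegral_monalg A D : finitely_subintegral A D ->
  finitely_subintegral (monalg_sub A : subringClosed {malg T[M]}) (monalg_sub D).
Proof.
elim=> [|C E _ IH /elementary_quad[b /quad_ext_monalg CEb]]; first by left.
by apply: finitely_subintegral_step IH _; apply/elementary_quad; exists b%:MP.
Qed.

Lemma subintegral_monalg A C : subintegral A C ->
  subintegral (monalg_sub A : subringClosed {malg T[M]}) (monalg_sub C).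
Proof.
move=> subC f; split=> [/monalg_subP Cf|[D [_ sDC /sDC]]//].
have [|D [fD sDC sD]] := subintegral_finite subC (s := [seq f@_m | m <- msupp f]).
  by move=> _ /mapP[m _ ->].
exists (monalg_sub D : subringClosed {malg T[M]}); split;
  [exact: finitely_subintegral_monalg|exact: sub_monalg|].
apply/monalg_subP => m; have [mf|/mcoeff_outdom->] := boolP (m \in msupp f).
  by apply: sD; apply: map_f.
exact: rpred0.
Qed.

End MonAlg.
End Transfer.

(** * Logarithmic derivatives and exponentials *)

Section LogDerivative.
Variable T : comNzRingType.
Local Open Scope classical_set_scope.
Local Open Scope ring_scope.
Implicit Types A C D : subringClosed T.

Lemma zero_mem A : (0 : T) \in A. Proof. exact: rpred0. Qed.
Lemma one_mem A : (1 : T) \in A. Proof. exact: rpred1. Qed.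

(* The quantified hypothesis on a makes evaluation at a map A[t] to A for every A. *)
Lemma homo_horner a (aP : forall A, a \in A) A :
  {homo horner_eval a : f / f \in (poly_sub A : subringClosed {poly T}) >-> f \in A}.
Proof.
move=> f /poly_subP Af; rewrite /horner_eval horner_coef; apply: rpred_sum => i _.
by apply: rpredM; [exact: Af|apply: rpredX; exact: aP].
Qed.

Lemma homo_polyC A :
  {homo (polyC : {rmorphism T -> {poly T}}) : x / x \in A >->
     x \in (poly_sub A : subringClosed {poly T})}.
Proof. by move=> x Ax; exact: poly_subC. Qed.

Definition invmod_ev a (aP : forall A, a \in A) A C (sAC : {subset A <= C}) :
    {additive invmod (sub_poly_sub sAC) -> invmod sAC} :=
  invmod_map (horner_eval a) (sub_poly_sub sAC) sAC (homo_horner aP (A := A))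
    (homo_horner aP (A := C)).

Definition invmod_polyC A C (sAC : {subset A <= C}) :
    {additive invmod sAC -> invmod (sub_poly_sub sAC)} :=
  invmod_map (polyC : {rmorphism T -> {poly T}}) sAC (sub_poly_sub sAC)
    (@homo_polyC A) (@homo_polyC C).

Lemma invmod_evC a (aP : forall A, a \in A) A C (sAC : {subset A <= C}) I :
  invmod_ev aP sAC (invmod_polyC sAC I) = I.
Proof.
transitivity (invmod_map idfun sAC sAC (homo_idfun (@subring_subxx _ A))
  (homo_idfun (@subring_subxx _ C)) I); last exact: invmod_map_id.
by apply: invmod_map_comp => x; rewrite /= /horner_eval hornerC.
Qed.

Lemma mem_invmod_ev a (aP : forall A, a \in A) A C (sAC : {subset A <= C})
    (I : invmod (sub_poly_sub sAC)) f :
  invmod_set I f -> invmod_set (invmod_ev aP sAC I) f.[a].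
Proof. by move=> If; apply: (mem_invmod_map (phi := horner_eval a)). Qed.

Lemma poly_sub_deriv A f : f \in poly_sub A -> f^`() \in poly_sub A.
Proof. by move=> /poly_subP Af; apply/poly_subP => i; rewrite coef_deriv rpredMn. Qed.

(* I is stable under the connection d/dt - p; when I is locally generated by
   exp q this says p = q' modulo A[t]. *)
Definition dlog (I : set {poly T}) (p : {poly T}) : Prop :=
  forall f, I f -> I (f^`() - p * f).

(** By the Leibniz rule, stability under the connection has to be checked on generators only. *)
Lemma is_submod_dlog A (I : set {poly T}) p : is_submod (poly_sub A) I ->
  is_submod (poly_sub A) [set f | I f /\ I (f^`() - p * f)].
Proof.
move=> sI; split=> [|f g [If If'] [Ig Ig']|a f Aa [If If']].
- by split; rewrite ?mulr0 ?deriv0 ?subrr; apply: submod0 sI.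
- split; first exact: (submodD sI).
  have -> : (f + g)^`() - p * (f + g) = (f^`() - p * f) + (g^`() - p * g).
    by rewrite derivD; ring.
  exact: (submodD sI).
- split; first exact: (submodZ sI).
  have -> : (a * f)^`() - p * (a * f) = a^`() * f + a * (f^`() - p * f).
    by rewrite derivM; ring.
  by apply: (submodD sI); apply: (submodZ sI) => //; apply: poly_sub_deriv.
Qed.

Section Dlog.
Variables (A C : subringClosed T) (sAC : {subset A <= C}).
Local Notation PA := (poly_sub A : subringClosed {poly T}).
Local Notation PC := (poly_sub C : subringClosed {poly T}).
Local Notation sP := (sub_poly_sub sAC).
Implicit Types I J : invmod sP.

Lemma dlogD I J p r : dlog I p -> dlog J r -> dlog (I + J : invmod sP) (p + r).
Proof.
move=> Ip Jr f; set K := (I + J : invmod sP).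
suff h : K `<=` [set f | invmod_set K f /\ invmod_set K (f^`() - (p + r) * f)] by move=> /h[].
apply: submod_mul_min => [|x y Ix Jy]; first exact/is_submod_dlog/invmod_submod.
have Kxy u v : invmod_set I u -> invmod_set J v -> invmod_set K (u * v) by apply: mem_submod_mul.
split; first exact: Kxy.
have -> : (x * y)^`() - (p + r) * (x * y) =
    (x^`() - p * x) * y + x * (y^`() - r * y) by rewrite derivM; ring.
by apply: (submodD (invmod_submod K)); apply: Kxy => //; [apply: Ip|apply: Jr].
Qed.

Lemma dlogN I p : dlog I p -> dlog (- I : invmod sP) (- p).
Proof.
move=> Ip y Iy; apply: mem_invmod => x; rewrite opprK => Ix.
have -> : (y^`() - - p * y) * x = (x * y)^`() - (x^`() - p * x) * y.
  by rewrite derivM; ring.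
apply: rpredB; last by apply: (invmod_mul_mem (I := I)) => //; apply: Ip.
by apply: poly_sub_deriv; apply: (invmod_mul_mem (I := I)).
Qed.

Lemma dlogB I J p r : dlog I p -> dlog J r -> dlog (I - J : invmod sP) (p - r).
Proof. by move=> Ip /dlogN; apply: dlogD. Qed.

Lemma dlog0 p : p \in PA -> dlog (0 : invmod sP) p.
Proof.
move=> Ap f /= Af; apply: rpredB; first exact: poly_sub_deriv.
exact: rpredM.
Qed.

Lemma dlog_polyC (K : invmod sAC) : dlog (invmod_polyC sAC K) 0.
Proof.
move=> f; set I := invmod_polyC _ _; have sI := invmod_submod I.
suff h g : invmod_set I g -> [set g | invmod_set I g /\ invmod_set I (g^`() - 0 * g)] g.
  by move=> /h[].
apply: invmod_map_min => [|x Kx]; first exact: is_submod_dlog.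
split; first exact: mem_invmod_map.
by rewrite /= derivC mul0r subrr; apply: submod0 sI.
Qed.

Variable q : {rmorphism rat -> T}.
Hypothesis qA : forall x, q x \in A.

Lemma div_nat_mem n x : (0 < n)%N -> x *+ n \in A -> x \in A.
Proof.
move=> n0 An; have -> : x = q n%:R^-1 * (x *+ n); last exact: rpredM.
rewrite -[x *+ n]mulr_natl mulrA -(rmorph_nat q) -rmorphM mulVf.
  by rewrite rmorph1 mul1r.
by rewrite Num.Theory.pnatr_eq0 -lt0n.
Qed.

Local Notation ev0 := (invmod_ev zero_mem sAC).

(** Taylor expansion at 0: the derivatives of [f] stay in the module, whose values at 0 lie in [A],
    and the n-th coefficient is the n-th derivative at 0 divided by n!. *)
Lemma dlog0_eq0 I : dlog I 0 -> ev0 I = 0 -> I = 0.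
Proof.
suff sub J : dlog J 0 -> ev0 J = 0 -> forall f, invmod_set J f -> f \in PA.
  move=> I0 Iz; apply: invmod_eq0; apply: sub => //; last by rewrite raddfN Iz oppr0.
  by have := dlogN I0; rewrite oppr0.
move=> J0 Jz f Jf; apply/poly_subP => n.
have Jn : invmod_set J f^`(n).
  elim: n => // n Jn; rewrite derivnS.
  by have := J0 _ Jn; rewrite mul0r subr0.
apply: (div_nat_mem (fact_gt0 n)).
have := mem_invmod_ev zero_mem Jn; rewrite Jz horner_coef0 coef_derivn addn0 ffactnn.
by [].
Qed.

Lemma dlog_uniq I J p : dlog I p -> dlog J p -> ev0 I = ev0 J -> I = J.
Proof.
move=> Ip Jp IJ; apply/eqP; rewrite -subr_eq0; apply/eqP; apply: dlog0_eq0.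
  by rewrite -(subrr p); apply: dlogB.
by rewrite raddfB IJ subrr.
Qed.

(** Interpolation at 0, ..., n-1: the Vandermonde matrix is invertible over the rationals, and [q]
    carries its inverse into [A]. *)
Lemma poly_nat_valued f : (forall k, f.[k%:R] \in A) -> f \in PA.
Proof.
pose n := size f; pose a : 'rV[rat]_n := \row_j j%:R.
pose V := Vandermonde n a.
have uV : V \in unitmx.
  rewrite unitmxE det_Vandermonde unitfE; apply/prodf_neq0 => i _.
  apply/prodf_neq0 => j ij; rewrite !mxE subr_eq0 Num.Theory.eqr_nat.
  by rewrite gtn_eqF.
have eV : \row_(j < n) f.[j%:R] = \row_(i < n) f`_i *m map_mx q V.
  apply/rowP => j; rewrite !mxE horner_coef; apply: eq_bigr => i _.
  by rewrite !mxE rmorphXn rmorph_nat.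
move=> fA; apply/poly_subP => i.
have [ni|lt_in] := leqP n i; first by rewrite nth_default // rpred0.
have := congr1 (fun B : 'rV_n => B 0 (Ordinal lt_in)) (congr1 (mulmxr (map_mx q (invmx V))) eV).
rewrite /= -mulmxA -map_mxM mulmxV // map_mx1 mulmx1 !mxE /= => <-.
by apply: rpred_sum => j _; rewrite !mxE; apply: rpredM.
Qed.

End Dlog.
End LogDerivative.

(** * Existence, uniqueness and values of exponential paths *)

Section Exponential.
Variable T : comNzRingType.
Local Open Scope classical_set_scope.
Local Open Scope ring_scope.
Implicit Types A C D : subringClosed T.

Local Notation ev0 := (invmod_ev (@zero_mem T)).
Local Notation ev1 := (invmod_ev (@one_mem T)).

Section Tower.
Variables (A C D : subringClosed T).
Variables (sAC : {subset A <= C}) (sCD : {subset C <= D}) (sAD : {subset A <= D}).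
Local Notation phi := (invmod_phi sAC sCD sAD).
Local Notation pphi :=
  (invmod_phi (sub_poly_sub sAC) (sub_poly_sub sCD) (sub_poly_sub sAD)).
Local Notation incl := (invmod_incl sAC sCD sAD).
Local Notation pincl :=
  (invmod_incl (sub_poly_sub sAC) (sub_poly_sub sCD) (sub_poly_sub sAD)).

Lemma dlog_phi (I : invmod (sub_poly_sub sAD)) p : dlog I p -> dlog (pphi I) p.
Proof.
move=> Ip f; set J := pphi I; have sJ := invmod_submod J.
suff h g : invmod_set J g -> [set g | invmod_set J g /\ invmod_set J (g^`() - p * g)] g.
  by move=> /h[].
apply: invmod_phi_min => [|x Ix]; first exact: is_submod_dlog.
by split; apply: mem_invmod_phi => //; apply: Ip.
Qed.

Lemma dlog_incl (I : invmod (sub_poly_sub sAC)) p : dlog I p -> dlog (pincl I) p.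
Proof. by rewrite /dlog invmod_inclE. Qed.

Lemma invmod_ev_phi a (aP : forall A, a \in A) I :
  invmod_ev aP sCD (pphi I) = phi (invmod_ev aP sAD I).
Proof.
have aD B : {homo horner_eval a : f / f \in (poly_sub B : subringClosed {poly T}) >-> f \in B}.
  exact: homo_horner.
have aAC : {homo horner_eval a : f / f \in (poly_sub A : subringClosed {poly T}) >-> f \in C}.
  by move=> f /(aD A)/sAC.
transitivity (invmod_map (horner_eval a) (sub_poly_sub sAD) sCD aAC (aD D) I).
  exact: invmod_map_comp.
by symmetry; apply: invmod_map_comp.
Qed.

Lemma invmod_ev_incl a (aP : forall A, a \in A) I :
  invmod_ev aP sAD (pincl I) = incl (invmod_ev aP sAC I).
Proof.
have aD B : {homo horner_eval a : f / f \in (poly_sub B : subringClosed {poly T}) >-> f \in B}.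
  exact: homo_horner.
have aCD : {homo horner_eval a : f / f \in (poly_sub C : subringClosed {poly T}) >-> f \in D}.
  by move=> f /(aD C)/sCD.
transitivity (invmod_map (horner_eval a) (sub_poly_sub sAC) sAD (aD A) aCD I).
  exact: invmod_map_comp.
by symmetry; apply: invmod_map_comp.
Qed.

(* The connection d/dt - p of I C[t] induces an A[t]-linear map I -> I C[t] / I,
   which is multiplication by some r in C[t] since I is invertible. *)
Lemma dlog_lift (I : invmod (sub_poly_sub sAD)) p : dlog (pphi I) p ->
  exists2 r, r \in poly_sub C & dlog I (p + r).
Proof.
move=> Ip; have [n [x [y [Ix Iy xy1]]]] := invmod_dual_basis I.
exists (\sum_i (x i)^`() * y i - p).
  have -> : \sum_i (x i)^`() * y i - p = \sum_i ((x i)^`() - p * x i) * y i.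
    rewrite -[p in LHS]mulr1 -xy1 mulr_sumr -sumrB.
    by apply: eq_bigr => i _; ring.
  apply: rpred_sum => i _; apply: (invmod_mul_mem (I := pphi I)).
    by apply: Ip; apply: mem_invmod_phi.
  by rewrite -raddfN; apply: mem_invmod_phi.
move=> f If.
have -> : f^`() - (p + (\sum_i (x i)^`() * y i - p)) * f = \sum_i (f * y i)^`() * x i.
  transitivity ((\sum_i f * (x i * y i))^`() - \sum_i (x i)^`() * y i * f).
    by rewrite -mulr_sumr xy1 mulr1 -mulr_suml; ring.
  rewrite raddf_sum -sumrB; apply: eq_bigr => i _.
  by rewrite /= !derivM; ring.
apply: (submod_sum _ (invmod_submod I)) => i _; apply: (submodZ (invmod_submod I)) => //.
by apply: poly_sub_deriv; apply: (invmod_mul_mem (I := I)).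
Qed.

End Tower.

(** For [y = 1 + b Q] one has [y' - b Q' y = - b^2 Q Q'], an error inside [b^2 C[t]]. *)
Lemma quad_mod_dlog A C b Q : quad_ext A C b -> Q \in poly_sub A ->
  dlog (quad_mod (poly_sub A) (poly_sub C) b%:P Q) (b%:P * Q^`()).
Proof.
move=> ACb AQ _ [a [z [Aa Cz ->]]].
have PCA := sub_poly_sub (quad_ext_sub ACb); have Cb := poly_subC (quad_ext_gen ACb).
exists a^`(), (z^`() - Q * Q^`() * a - b%:P * Q^`() * z); split.
- exact: poly_sub_deriv.
- have CQ := PCA _ AQ; have CQ' : Q^`() \in poly_sub C by apply: poly_sub_deriv.
  apply: rpredB; first apply: rpredB; first exact: poly_sub_deriv.
    by apply: rpredM; [apply: rpredM|apply: PCA].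
  by apply: rpredM => //; apply: rpredM.
- by rewrite -polyC_exp !(derivD, derivM, derivC); rewrite !polyC_exp; ring.
Qed.

Lemma quad_mod_ev a (aP : forall A, a \in A) A C b Q (ACb : quad_ext A C b)
    (sAC : {subset A <= C}) (AQ : Q \in poly_sub A)
    (E : is_invertible (poly_sub A : subringClosed {poly T}) (poly_sub C)
       (quad_mod (poly_sub A) (poly_sub C) b%:P Q)) :
  invmod_set (invmod_ev aP sAC (InvMod (sub_poly_sub sAC) E)) = quad_mod A C b Q.[a].
Proof.
have AQa : Q.[a] \in A by apply: homo_horner AQ.
apply/seteqP; split=> x.
  apply: (invmod_map_min (quad_mod_submod ACb AQa)) => _ [c [z [Ac Cz ->]]].
  exists c.[a], z.[a]; split; first exact: homo_horner Ac.
    exact: homo_horner Cz.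
  by rewrite /= /horner_eval -polyC_exp !hornerE.
move=> [c [z [Ac Cz ->]]].
have -> : (1 + b * Q.[a]) * c + b ^+ 2 * z =
    ((1 + b%:P * Q) * c%:P + b%:P ^+ 2 * z%:P).[a] by rewrite -polyC_exp !hornerE.
by apply: mem_invmod_ev; exists c%:P, z%:P; split=> //; apply: poly_subC.
Qed.

Variable q : {rmorphism rat -> T}.

Lemma antiderivative A p : (forall x, q x \in A) -> p \in poly_sub A ->
  exists2 Q, Q \in poly_sub A & Q^`() = p.
Proof.
move=> qA /poly_subP Ap.
exists (\poly_(i < (size p).+1) (if i is j.+1 then q j.+1%:R^-1 * p`_j else 0)).
  apply/poly_subP => i; rewrite coef_poly; case: ifP => _; last exact: rpred0.
  by case: i => [|i]; [exact: rpred0|exact: rpredM].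
apply/polyP => i; rewrite coef_deriv coef_poly ltnS.
case: ltnP => [_|pi]; last by rewrite mul0rn nth_default.
rewrite -[LHS]mulr_natl mulrA -(rmorph_nat q) -rmorphM mulfV ?rmorph1 ?mul1r //.
by rewrite Num.Theory.pnatr_eq0.
Qed.

(** Induction along the tower. With [p = p0 + p1 * b] over [C], the model for an antiderivative [Q]
    of [p1] realises [b * p1] over [C]. Its lift to [A] has a logarithmic derivative that is off by
    some [r] over [C], and the induction hypothesis supplies a module for [p0 - r]. *)
Lemma finitely_subintegral_dlog A D : (forall x, q x \in A) ->
  finitely_subintegral A D -> forall (sAD : {subset A <= D}) p,
  p \in poly_sub D -> exists I : invmod (sub_poly_sub sAD), dlog I p.
Proof.
move=> qA; elim=> [sAA p Ap|C {}D fC IH elD sAD p Dp].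
  by exists 0; apply: dlog0.
have sCD := elementary_sub elD; have sAC := finitely_subintegral_sub fC.
case/elementary_quad: elD => b CDb; have PCDb := quad_ext_poly CDb.
case: (PCDb) => _ _ /(_ p)[/(_ Dp)[p0 [p1 [Cp0 Cp1 ->]]] _].
have [Q CQ Qp1] := antiderivative (fun x => sAC _ (qA x)) Cp1.
pose E : invmod (sub_poly_sub sCD) :=
  InvMod (sub_poly_sub sCD) (quad_mod_invertible PCDb (sub_poly_sub sCD) CQ).
have [I eI] := finitely_subintegral_phi_surj (finitely_subintegral_poly fC)
  (sub_poly_sub sAC) (sub_poly_sub sAD) E.
have [|r Cr Ir] := @dlog_lift A C D sAC sCD sAD I (b%:P * Q^`()).
  by rewrite eI; apply: quad_mod_dlog.
have [|J Jp] := IH sAC (p0 - r); first exact: rpredB.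
exists (invmod_incl (sub_poly_sub sAC) (sub_poly_sub sCD) (sub_poly_sub sAD) J + I).
have -> : p0 + p1 * b%:P = (p0 - r) + (b%:P * Q^`() + r) by rewrite Qp1; ring.
by apply: dlogD => //; apply: dlog_incl.
Qed.

(* The family t |-> exp(c t). *)
Definition exp_path A C (sAC : {subset A <= C}) c (I : invmod (sub_poly_sub sAC)) :=
  dlog I c%:P /\ ev0 sAC I = 0.

Lemma exp_path_uniq A C (sAC : {subset A <= C}) c
    (I J : invmod (sub_poly_sub sAC)) : (forall x, q x \in A) ->
  exp_path c I -> exp_path c J -> I = J.
Proof. by move=> qA [Ic I0] [Jc J0]; apply: (dlog_uniq qA Ic Jc); rewrite I0 J0. Qed.

Lemma exp_pathD A C (sAC : {subset A <= C}) c d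
    (I J : invmod (sub_poly_sub sAC)) :
  exp_path c I -> exp_path d J -> exp_path (c + d) (I + J : invmod (sub_poly_sub sAC)).
Proof.
move=> [Ic I0] [Jd J0]; split; last by rewrite raddfD I0 J0 addr0.
by rewrite polyCD; apply: dlogD.
Qed.

Lemma exp_pathN A C (sAC : {subset A <= C}) c (I : invmod (sub_poly_sub sAC)) :
  exp_path c I -> exp_path (- c) (- I : invmod (sub_poly_sub sAC)).
Proof.
move=> [Ic I0]; split; last by rewrite raddfN I0 oppr0.
by rewrite polyCN; apply: dlogN.
Qed.

Lemma exp_path_incl A C D (sAC : {subset A <= C}) (sCD : {subset C <= D})
    (sAD : {subset A <= D}) c (I : invmod (sub_poly_sub sAC)) : exp_path c I ->
  exp_path c (invmod_incl (sub_poly_sub sAC) (sub_poly_sub sCD) (sub_poly_sub sAD) I).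
Proof.
move=> [Ic I0]; split; first exact: dlog_incl.
by rewrite invmod_ev_incl I0 raddf0.
Qed.

Lemma finitely_subintegral_exp_path A D c : (forall x, q x \in A) ->
  finitely_subintegral A D -> forall sAD : {subset A <= D}, c \in D ->
  exists I : invmod (sub_poly_sub sAD), exp_path c I.
Proof.
move=> qA fD sAD Dc.
have [I Ic] := finitely_subintegral_dlog qA fD sAD (poly_subC Dc).
(* Dividing by the constant family [I(0)] normalises the value at 0 and keeps the logarithmic
   derivative. *)
exists (I - invmod_polyC sAD (ev0 sAD I)); split.
  by rewrite -[c%:P]subr0; apply: dlogB => //; apply: dlog_polyC.
by rewrite raddfB invmod_evC subrr.
Qed.

Lemma exists_exp_path A C (sAC : {subset A <= C}) c : (forall x, q x \in A) ->
  subintegral A C -> c \in C -> exists I : invmod (sub_poly_sub sAC), exp_path c I.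
Proof.
move=> qA subC /subC[D [fD sDC Dc]].
have sAD := finitely_subintegral_sub fD.
have [I Ic] := finitely_subintegral_exp_path qA fD sAD Dc.
by exists (invmod_incl (sub_poly_sub sAD) (sub_poly_sub sDC) (sub_poly_sub sAC) I);
  apply: exp_path_incl.
Qed.

(* Translation by 1 preserves an exponential path which is trivial at 0 and 1, so
   its elements take values in A at all natural numbers. *)
Lemma exp_path_trivial A C (sAC : {subset A <= C}) c
    (I : invmod (sub_poly_sub sAC)) : (forall x, q x \in A) ->
  exp_path c I -> ev1 sAC I = 0 -> c \in A.
Proof.
move=> qA.
suff sub d (J : invmod (sub_poly_sub sAC)) : exp_path d J -> ev1 sAC J = 0 ->
    forall f, invmod_set J f -> f \in poly_sub A.
  (* Once [I] is trivial, the connection applied to 1 gives [- c]. *)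
  move=> Ic I1; have I0 : I = 0.
    apply: invmod_eq0; first exact: sub Ic I1.
    by apply: (sub _ _ (exp_pathN Ic)); rewrite raddfN I1 oppr0.
  have : invmod_set I 1 by rewrite I0; apply: rpred1.
  case: Ic => Ic _ /Ic; rewrite -polyC1 derivC polyC1 mulr1 sub0r I0 => /poly_subP/(_ 0%N).
  by rewrite coefN coefC eqxx rpredN.
move=> {c I} Jd J1 f Jf.
have sX B : {homo comp_poly ('X + 1%:P : {poly T}) : g /
    g \in (poly_sub B : subringClosed {poly T}) >->
    g \in (poly_sub B : subringClosed {poly T})}.
  move=> g /poly_subP Bg; rewrite comp_polyE; apply: rpred_sum => i _.
  apply: poly_subZ => //; apply: rpredX; apply: rpredD; last exact/poly_subC/rpred1.
  by rewrite -['X]expr1; apply: poly_subXn.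
pose tau := invmod_map (comp_poly ('X + 1%:P : {poly T})) (sub_poly_sub sAC) (sub_poly_sub sAC)
  (@sX A) (@sX C).
have tauJ : tau J = J.
  apply: (exp_path_uniq qA _ Jd); split.
    move=> g; have sK := invmod_submod (tau J).
    suff h g' : invmod_set (tau J) g' ->
        [set g' | invmod_set (tau J) g' /\ invmod_set (tau J) (g'^`() - d%:P * g')] g'.
      by move=> /h[].
    apply: invmod_map_min => [|x Jx]; first exact: is_submod_dlog.
    split; first exact: mem_invmod_map.
    case: Jd => /(_ _ Jx) Jx' _.
    have := mem_invmod_map (sub_poly_sub sAC) (@sX A) (@sX C) Jx'.
    rewrite /= rmorphB rmorphM /= comp_polyC deriv_comp derivD derivX derivC addr0 mulr1.
    by [].
  rewrite -[RHS]J1.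
  have e1 B : {homo horner_eval 1 : f / f \in (poly_sub B : subringClosed {poly T}) >-> f \in B}.
    exact: (homo_horner (@one_mem T)).
  apply: invmod_map_comp => x.
  by rewrite /= /horner_eval horner_comp !hornerE.
have tauP g : invmod_set J g -> invmod_set J (g \Po ('X + 1%:P)).
  by move=> Jg; rewrite -[J]tauJ; apply: (mem_invmod_map (phi := comp_poly ('X + 1%:P : {poly T}))).
apply: (poly_nat_valued qA) => k; elim: k f Jf => [|k IH] f Jf.
  by have := mem_invmod_ev (@zero_mem T) Jf; case: Jd => _ ->.
have := IH _ (tauP _ Jf); rewrite horner_comp !hornerE.
by rewrite natr1.
Qed.

(** The image of [I] over [C] is a model module, reached at time 1 by the path with [Q t] in place
    of [Q]. A path over [A] with exponent [b * Q] lies above it by uniqueness; what remains of [I]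
    is trivial over [C], hence comes from the shorter tower. *)
Lemma finitely_subintegral_exp_surj A D : (forall x, q x \in A) ->
  finitely_subintegral A D -> forall (sAD : {subset A <= D}) (I : invmod sAD),
  exists c (K : invmod (sub_poly_sub sAD)), [/\ c \in D, exp_path c K & ev1 sAD K = I].
Proof.
move=> qA; elim=> [sAA I|C {}D fC IH elD sAD I].
  have -> : I = 0 by apply: invmod_eq0 => x; apply: invmod_subB.
  exists 0, 0; split; [exact: rpred0| |exact: raddf0].
  by split; [apply: dlog0; rewrite polyC0; apply: rpred0|exact: raddf0].
have fD : finitely_subintegral A D by apply: finitely_subintegral_step fC elD.
have sCD := elementary_sub elD; have sAC := finitely_subintegral_sub fC.
case/elementary_quad: elD => b CDb; have PCDb := quad_ext_poly CDb.
have qC x : q x \in C by apply: sAC.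
have [Q CQ eQ] := quad_mod_surj CDb (invmod_phi sAC sCD sAD I).
have CQX : Q%:P * 'X \in poly_sub C.
  by apply: rpredM; [apply: poly_subC|rewrite -['X]expr1; apply: poly_subXn].
pose E : invmod (sub_poly_sub sCD) :=
  InvMod (sub_poly_sub sCD) (quad_mod_invertible PCDb (sub_poly_sub sCD) CQX).
have Eexp : exp_path (b * Q) E.
  split.
    have -> : (b * Q)%:P = b%:P * (Q%:P * 'X)^`().
      by rewrite derivM derivC derivX mul0r add0r mulr1 polyCM.
    exact: quad_mod_dlog.
  apply: invmod_inj; rewrite (quad_mod_ev _ CDb sCD CQX) hornerM hornerX mulr0.
  apply/seteqP; split=> [_ [a [z [Ca Dz ->]]]|x Cx] /=.
    rewrite mulr0 addr0 mul1r; apply: rpredD => //; exact: (quad_ext_cond CDb).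
  by exists x, 0; rewrite rpred0 !mulr0 !addr0 mul1r.
have DbQ : b * Q \in D by apply: rpredM; [exact: quad_ext_gen CDb|exact: (sCD _ CQ)].
have [K1 K1exp] := finitely_subintegral_exp_path qA fD sAD DbQ.
pose pphi := invmod_phi (sub_poly_sub sAC) (sub_poly_sub sCD) (sub_poly_sub sAD).
have K1E : pphi K1 = E.
  apply: (exp_path_uniq qC _ Eexp); case: K1exp => K1d K10; split.
    exact: dlog_phi.
  by rewrite invmod_ev_phi K10 raddf0.
have ker : invmod_phi sAC sCD sAD (I - ev1 sAD K1) = 0.
  rewrite raddfB -invmod_ev_phi -/pphi K1E; apply/eqP; rewrite subr_eq0; apply/eqP.
  apply: invmod_inj; rewrite (quad_mod_ev _ CDb sCD CQX) eQ.
  by rewrite hornerM hornerC hornerX mulr1.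
have [_ exact_mid _] := invmod_short_exact sAC sCD sAD (finitely_subintegral_subintegral fC).
have : (range (invmod_incl sAC sCD sAD)) (I - ev1 sAD K1) by rewrite exact_mid.
case=> I2 _ eI2; have [c2 [K2 [Cc2 K2exp K21]]] := IH sAC I2.
exists (c2 + b * Q),
  (invmod_incl (sub_poly_sub sAC) (sub_poly_sub sCD) (sub_poly_sub sAD) K2 + K1); split.
- by apply: rpredD => //; apply: (sCD).
- by apply: exp_pathD => //; apply: exp_path_incl.
- by rewrite raddfD invmod_ev_incl K21 eI2 subrK.
Qed.

Lemma exp_surj A C (sAC : {subset A <= C}) : (forall x, q x \in A) ->
  subintegral A C -> forall I : invmod sAC,
  exists c (K : invmod (sub_poly_sub sAC)), [/\ c \in C, exp_path c K & ev1 sAC K = I].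
Proof.
move=> qA subC I; have [n [x [y [Ix Iy xy1]]]] := invmod_dual_basis I.
have [|D [fD sDC sD]] := subintegral_finite subC
    (s := [seq x i | i <- enum 'I_n] ++ [seq y i | i <- enum 'I_n]).
  move=> z; rewrite mem_cat => /orP[] /mapP[i _ ->].
    exact: invmod_subB (Ix i).
  exact: invmod_subB (Iy i).
have sAD := finitely_subintegral_sub fD.
have [i|i|i j|//|J J_xy] := @invmod_of_dual _ _ _ sAD n x y.
- by apply: sD; rewrite mem_cat; apply/orP; left; apply: map_f; rewrite mem_enum.
- by apply: sD; rewrite mem_cat; apply/orP; right; apply: map_f; rewrite mem_enum.
- exact: invmod_mul_mem (Ix i) (Iy j).
have eJ : invmod_incl sAD sDC sAC J = I.
  apply: (invmod_eq_dual xy1) => // i; rewrite -raddfN !invmod_inclE; exact: J_xy.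
have [c [K [Dc Kexp K1]]] := finitely_subintegral_exp_surj qA fD J.
exists c, (invmod_incl (sub_poly_sub sAD) (sub_poly_sub sDC) (sub_poly_sub sAC) K).
split; [exact: (sDC _ Dc)|exact: exp_path_incl|].
by rewrite invmod_ev_incl K1 eJ.
Qed.

(** The quotient [C / A] is not formed: [xi] acts on representatives, with an arbitrary module
    chosen outside [C]. *)
Theorem exists_exp_iso A C (sAC : {subset A <= C}) : (forall x, q x \in A) ->
  subintegral A C -> exists xi : T -> invmod sAC,
  [/\ {in C &, forall c d, xi (c + d) = xi c + xi d},
      {in C, forall c, xi c = 0 <-> c \in A}
    & forall I, exists2 c, c \in C & xi c = I].
Proof.
move=> qA subC.
have /choice[K KP] : forall c, exists K : invmod (sub_poly_sub sAC),
    c \in C -> exp_path c K.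
  move=> c; have [Cc|nCc] := pselect (c \in C); last by exists 0.
  by have [K ?] := exists_exp_path sAC qA subC Cc; exists K.
exists (fun c => ev1 sAC (K c)); split=> [c d Cc Cd|c Cc|I].
- rewrite -raddfD; congr (ev1 _ _); apply: (exp_path_uniq qA (KP _ (rpredD Cc Cd))).
  by apply: exp_pathD; apply: KP.
- split=> [|Ac]; first exact: exp_path_trivial (KP c Cc).
  suff -> : K c = 0 by apply: raddf0.
  apply: (exp_path_uniq qA (KP c Cc)); split; last exact: raddf0.
  by apply: dlog0; apply: poly_subC.
- have [c [L [Cc Lexp <-]]] := exp_surj qA subC I; exists c => //.
  by congr (ev1 _ _); apply: (exp_path_uniq qA (KP c Cc)).
Qed.

End Exponential.

(** * The tensor decomposition *)

Section AdditiveOf.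
Variables (U V : zmodType) (f : U -> V) (fB : forall x y, f (x - y) = f x - f y).

HB.instance Definition _ := GRing.isZmodMorphism.Build U V f fB.

Lemma additive_of : exists g : {additive U -> V}, g =1 f.
Proof. by exists (f : {additive U -> V}). Qed.

End AdditiveOf.

Section TensorTheory.
Variables U V : zmodType.
Local Open Scope classical_set_scope.
Local Open Scope ring_scope.
Local Notation free := {malg int[(U * V)%type]}.
Local Notation quot := (Quotient.quot (@tensor_kernel U V : zmodClosed free)).

Definition tensor_pi (x : free) : tensor U V := (\pi_quot x)%qT.

Lemma tensor_piB x y : tensor_pi (x - y) = tensor_pi x - tensor_pi y.
Proof. exact: (raddfB ((\pi_quot)%qT : {additive free -> quot})). Qed.

HB.instance Definition _ := GRing.isZmodMorphism.Build free (tensor U V) tensor_pi tensor_piB.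

Lemma tensor_pi_eq0 x : tensor_pi x = 0 <-> x \in @tensor_kernel U V.
Proof.
rewrite -[0 in X in X <-> _](raddf0 tensor_pi) -[x in X in _ <-> X]subr0.
rewrite (Quotient.idealrBE (@tensor_kernel U V : zmodClosed free)).
by split=> [/eqP|/eqP].
Qed.

Lemma tensor_pi_surj t : exists x, tensor_pi x = t.
Proof. by exists (repr (t : quot)); apply: (reprK (t : quot)). Qed.

Definition pure (u : U) (v : V) : tensor U V := tensor_pi << (u, v) >>.

Lemma tensor_relation_eq0 r : tensor_relation r -> tensor_pi r = 0.
Proof. by move=> rel; apply/tensor_pi_eq0/asboolP => S [_]; apply. Qed.

Lemma pureDl u u' v : pure (u + u') v = pure u v + pure u' v.
Proof.
apply/eqP; rewrite -subr_eq0 opprD addrA /pure -!tensor_piB; apply/eqP.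
by apply: tensor_relation_eq0; left; exists u, u', v.
Qed.

Lemma pureDr u v v' : pure u (v + v') = pure u v + pure u v'.
Proof.
apply/eqP; rewrite -subr_eq0 opprD addrA /pure -!tensor_piB; apply/eqP.
by apply: tensor_relation_eq0; right; exists u, v, v'.
Qed.

Lemma pure0r u : pure u 0 = 0.
Proof. by apply: (addrI (pure u 0)); rewrite -pureDr !addr0. Qed.

Lemma pure0l v : pure 0 v = 0.
Proof. by apply: (addrI (pure 0 v)); rewrite -pureDl !addr0. Qed.

Lemma pureNl u v : pure (- u) v = - pure u v.
Proof. by apply: (addrI (pure u v)); rewrite -pureDl !subrr pure0l. Qed.

Lemma malg_int_ind (K : choiceType) (W : zmodType) (f : {additive {malg int[K]} -> W})
    (S : set W) : S 0 -> (forall x y, S x -> S y -> S (x - y)) ->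
  (forall k, S (f << k >>)) -> forall x, S (f x).
Proof.
move=> S0 SB Sk x.
have SN y : S y -> S (- y) by move=> Sy; rewrite -sub0r; apply: SB.
have SD y z : S y -> S z -> S (y + z) by move=> Sy Sz; rewrite -[z]opprK; apply/SB/SN.
rewrite [x]monalgE raddf_sum; elim/big_ind: _ => // k _.
have Sn n : S (f << n%:Z *g k >>).
  elim: n => [|n IH]; first by rewrite monalgU0 raddf0.
  by rewrite -addn1 PoszD monalgUD raddfD; apply: SD.
by case: (x@_k) => n //; rewrite NegzE monalgUN raddfN; apply: SN.
Qed.

Lemma tensor_ind (S : set (tensor U V)) : S 0 ->
  (forall x y, S x -> S y -> S (x - y)) -> (forall u v, S (pure u v)) ->
  forall t, S t.
Proof.
move=> S0 SB Sp t; have [x <-] := tensor_pi_surj t.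
by apply: malg_int_ind => // -[u v]; apply: Sp.
Qed.

Section Lift.
Variables (W : zmodType) (b : U -> V -> W).
Hypotheses (bDl : forall u u' v, b (u + u') v = b u v + b u' v)
  (bDr : forall u v v', b u (v + v') = b u v + b u v').

(** The universal property is kept at the level of the free group: for detecting nonzero tensors it
    is enough that the lift vanishes on representatives of 0. *)
Definition tensor_lift (x : free) : W := \sum_(k <- msupp x) b k.1 k.2 *~ x@_k.

Lemma tensor_liftEw (E : {fset U * V}) x : (msupp x `<=` E)%fset ->
  tensor_lift x = \sum_(k <- E) b k.1 k.2 *~ x@_k.
Proof.
by move=> le; apply: big_fset_incl => // k kE /mcoeff_outdom->; rewrite mulr0z.
Qed.

Lemma tensor_liftB x y : tensor_lift (x - y) = tensor_lift x - tensor_lift y.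
Proof.
pose E := (msupp (x - y) `|` (msupp x `|` msupp y))%fset.
have xE : (msupp x `<=` E)%fset by rewrite /E fsetUCA fsubsetUl.
have yE : (msupp y `<=` E)%fset by rewrite /E fsetUA fsubsetUr.
rewrite (tensor_liftEw xE) (tensor_liftEw yE) (@tensor_liftEw E) ?fsubsetUl //.
by rewrite -sumrB; apply: eq_bigr => k _; rewrite mcoeffB mulrzBr.
Qed.

Lemma tensor_liftU u v : tensor_lift << (u, v) >> = b u v.
Proof.
by rewrite (tensor_liftEw msuppU_le) big_seq_fset1 mcoeffUU mulr1z.
Qed.

Lemma tensor_lift_eq0 x : tensor_pi x = 0 -> tensor_lift x = 0.
Proof.
move=> /tensor_pi_eq0/asboolP/(_ [set y | tensor_lift y = 0]); apply; split.
  split=> [|y z /= y0 z0]; last by rewrite tensor_liftB y0 z0 subrr.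
  by have := tensor_liftB 0 0; rewrite !subrr.
move=> _ [[u [u' [v ->]]]|[u [v [v' ->]]]] /=; rewrite !tensor_liftB !tensor_liftU.
  by rewrite bDl -addrA -opprD subrr.
by rewrite bDr -addrA -opprD subrr.
Qed.

End Lift.
End TensorTheory.

(** * Coefficientwise decomposition of C[M] / A[M] *)

Section MonoidTensor.
Variables (T : comNzRingType) (A C : subringClosed T) (sAC : {subset A <= C}).
Variable M : conomType.
Variable xi : T -> invmod sAC.
Hypothesis xiD : {in C &, forall c d, xi (c + d) = xi c + xi d}.
Hypothesis xi0 : {in C, forall c, xi c = 0 <-> c \in A}.
Hypothesis xi_surj : forall I, exists2 c, c \in C & xi c = I.
Local Notation MC := (monalg_sub C : subringClosed {malg T[M]}).
Local Notation MA := (monalg_sub A : subringClosed {malg T[M]}).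
Local Notation tens := (tensor {malg int[M]} (invmod sAC)).

Let xiA c : c \in A -> xi c = 0.
Proof. by move=> Ac; apply/xi0; first exact: sAC. Qed.

Definition coef_tensor (f : {malg T[M]}) : tens :=
  \sum_(m <- msupp f) pure << m >> (xi f@_m).

Lemma coef_tensorEw (E : {fset M}) f : (msupp f `<=` E)%fset ->
  coef_tensor f = \sum_(m <- E) pure << m >> (xi f@_m).
Proof.
move=> le; apply: big_fset_incl => // m mE /mcoeff_outdom->.
by rewrite xiA ?rpred0 // pure0r.
Qed.

Lemma coef_tensorD f g : f \in MC -> g \in MC ->
  coef_tensor (f + g) = coef_tensor f + coef_tensor g.
Proof.
move=> /monalg_subP Cf /monalg_subP Cg.
pose E := (msupp (f + g) `|` (msupp f `|` msupp g))%fset.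
have fE : (msupp f `<=` E)%fset by rewrite /E fsetUCA fsubsetUl.
have gE : (msupp g `<=` E)%fset by rewrite /E fsetUA fsubsetUr.
rewrite (coef_tensorEw fE) (coef_tensorEw gE) (@coef_tensorEw E) ?fsubsetUl //.
by rewrite -big_split; apply: eq_bigr => m _ /=; rewrite mcoeffD xiD ?pureDr.
Qed.

Lemma coef_tensorA f : f \in MA -> coef_tensor f = 0.
Proof.
by move=> /monalg_subP Af; apply: big1 => m _; rewrite xiA ?pure0r.
Qed.

Lemma coef_tensorN f : f \in MC -> coef_tensor (- f) = - coef_tensor f.
Proof.
move=> Cf; apply: (addrI (coef_tensor f)); rewrite -coef_tensorD ?rpredN // !subrr.
by apply: coef_tensorA; apply: rpred0.
Qed.

Lemma coef_tensorB f g : f \in MC -> g \in MC ->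
  coef_tensor (f - g) = coef_tensor f - coef_tensor g.
Proof. by move=> Cf Cg; rewrite coef_tensorD ?rpredN // coef_tensorN. Qed.

(** The coordinate at [m] gives the biadditive map [b], whose lift sends the tensor of [f] to [xi]
    of its coefficient at [m]. *)
Lemma coef_tensor_eq0 f : f \in MC -> coef_tensor f = 0 -> f \in MA.
Proof.
move=> Cf f0; apply/monalg_subP => m.
have [mf|/mcoeff_outdom->] := boolP (m \in msupp f); last exact: rpred0.
apply/(xi0 (monalg_subP _ _ Cf m)).
pose X : {malg int[({malg int[M]} * invmod sAC)%type]} :=
  \sum_(k <- msupp f) << (<< k >>, xi f@_k) >>.
have X0 : tensor_pi X = 0 by rewrite -f0 raddf_sum.
pose b (u : {malg int[M]}) (v : invmod sAC) := v *~ u@_m.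
have bDl u u' v : b (u + u') v = b u v + b u' v by rewrite /b mcoeffD mulrzDr.
have bDr u v v' : b u (v + v') = b u v + b u v' by rewrite /b mulrzDl.
have := tensor_lift_eq0 bDl bDr X0.
have [h hE] := additive_of (@tensor_liftB _ _ _ b).
rewrite -hE raddf_sum /=; under eq_bigr do rewrite hE tensor_liftU /b mcoeffU.
rewrite (bigD1_seq m) ?fset_uniq //= eqxx mulr1n mulr1z big1 ?addr0 // => k km.
by rewrite (negPf km) mulr0n mulr0z.
Qed.

Lemma coef_tensor_surj t : exists2 f, f \in MC & coef_tensor f = t.
Proof.
move: t; apply: tensor_ind => [|_ _ [f Cf <-] [g Cg <-]|u v].
- by exists 0; [apply: rpred0|apply: coef_tensorA; apply: rpred0].
- by exists (f - g); [apply: rpredB|apply: coef_tensorB].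
have [l lE] : exists l : {additive {malg int[M]} -> tens}, l =1 (fun u => pure u v).
  by apply: additive_of => x y; rewrite pureDl pureNl.
rewrite -lE.
apply: (@malg_int_ind _ _ l [set t | exists2 f, f \in MC & coef_tensor f = t]%classic).
- by exists 0; [apply: rpred0|apply: coef_tensorA; apply: rpred0].
- by move=> _ _ [f Cf <-] [g Cg <-]; exists (f - g); [apply: rpredB|apply: coef_tensorB].
move=> m; have [c Cc ec] := xi_surj v; exists << c *g m >>.
  by apply/monalg_subP => k; rewrite mcoeffU; case: eqP => _ //; apply: rpred0.
by rewrite lE (coef_tensorEw msuppU_le) big_seq_fset1 mcoeffUU ec.
Qed.

End MonoidTensor.

(** [r] chooses logarithms in [C[M]]. It is additive only modulo [A[M]], but [coef_tensor] kills
    [A[M]], so the composite is additive. *)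
Theorem invmod_monalg_tensor (T : comNzRingType) (A C : subringClosed T)
    (sAC : {subset A <= C}) (M : conomType) (q : {rmorphism rat -> T}) :
  (forall x, q x \in A) -> subintegral A C ->
  exists f : {additive invmod (sub_monalg (M := M) sAC) ->
                tensor {malg int[M]} (invmod sAC)},
    bijective f.
Proof.
move=> qA subC.
have [xi [xiD xi0 xi_surj]] := exists_exp_iso sAC qA subC.
pose qM : {rmorphism rat -> {malg T[M]}} := (@malgC M T \o q)%FUN.
have qMA x : qM x \in (monalg_sub A : subringClosed {malg T[M]}) by apply: homo_malgC.
have [xiM [xiMD xiM0 xiM_surj]] :=
  exists_exp_iso (sub_monalg (M := M) sAC) qMA (subintegral_monalg subC).
have /choice[r rP] : forall J,
    exists f, f \in (monalg_sub C : subringClosed {malg T[M]}) /\ xiM f = J.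
  by move=> J; have [f Cf fJ] := xiM_surj J; exists f.
pose F := coef_tensor xi : {malg T[M]} -> _.
have xiMN f : f \in monalg_sub C -> xiM (- f) = - xiM f.
  move=> Cf; apply: (addrI (xiM f)); rewrite -xiMD ?rpredN // !subrr.
  by apply/xiM0; apply: rpred0.
have F_eq f g : f \in monalg_sub C -> g \in monalg_sub C -> xiM f = xiM g -> F f = F g.
  move=> Cf Cg fg; apply/eqP; rewrite -subr_eq0 -(coef_tensorB xiD xi0 Cf Cg); apply/eqP.
  apply: (coef_tensorA xi0); apply/xiM0; first exact: rpredB.
  by rewrite xiMD ?rpredN // xiMN // fg subrr.
have [|f fE] := @additive_of _ _ (fun J => F (r J)).
  move=> I J; have [CI eI] := rP I; have [CJ eJ] := rP J; have [CIJ eIJ] := rP (I - J).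
  rewrite /= -[RHS](coef_tensorB xiD xi0 CI CJ).
  apply: (F_eq _ _ CIJ (rpredB CI CJ)).
  by rewrite xiMD ?rpredN // xiMN // eI eJ eIJ.
have f_inj : injective f.
  apply: raddf_inj => J; rewrite fE => FJ; have [CJ <-] := rP J.
  by apply/xiM0 => //; apply: (coef_tensor_eq0 xi0).
have /choice[g gP] : forall t, exists J, f J = t.
  move=> t; have [x Cx <-] := coef_tensor_surj (M := M) xiD xi0 xi_surj t; exists (xiM x).
  by rewrite fE; have [Cr er] := rP (xiM x); apply: F_eq.
by exists f, g => // J; apply: f_inj; rewrite gP.
Qed.

(** * Assembly of the diagram and of the tensor decomposition *)

Theorem theorem1p4 (T : comNzRingType) (A B : subringClosed T)
    (sAB : {subset A <= B})
    (Aplus : subringClosed T)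
    (sAAp : {subset A <= Aplus}) (sApB : {subset Aplus <= B})
    (hAp : is_subintegral_closure A B Aplus)
    (M : conomType)
    (cancM : cancellative_monoid M) (tfM : torsion_free_monoid M) :
  ([/\ short_exact (invmod_incl sAAp sApB sAB) (invmod_phi sAAp sApB sAB),
       short_exact
         (invmod_incl (sub_monalg (M := M) sAAp) (sub_monalg sApB)
            (sub_monalg sAB))
         (invmod_phi (sub_monalg (M := M) sAAp) (sub_monalg sApB)
            (sub_monalg sAB)),
       (forall I : invmod sAAp,
          invmod_theta M sAB (invmod_incl sAAp sApB sAB I) =
          invmod_incl (sub_monalg sAAp) (sub_monalg sApB) (sub_monalg sAB)
            (invmod_theta M sAAp I)),
       (forall I : invmod sAB,
          invmod_theta M sApB (invmod_phi sAAp sApB sAB I) =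
          invmod_phi (sub_monalg sAAp) (sub_monalg sApB) (sub_monalg sAB)
            (invmod_theta M sAB I))
     & bijective (invmod_theta M sApB)])
  /\
  ((exists q : {rmorphism rat -> T}, forall x, q x \in A) ->
   exists f : {additive invmod (sub_monalg (M := M) sAAp) ->
                 tensor {malg int[M]} (invmod sAAp)},
     bijective f).
Proof.
have [sCB subC _] := hAp.
split; last by move=> [q qA]; apply: invmod_monalg_tensor qA subC.
split.
- exact: invmod_short_exact.
- by apply: invmod_short_exact; apply: subintegral_monalg.
(* Both paths around a square are induced by the same ring map [malgC], so each is compared with the
   diagonal through [invmod_map_comp]. *)
- move=> I; have AMB : {homo @malgC M T : x / x \in A >->
      x \in (monalg_sub A : subringClosed {malg T[M]})} by apply: homo_malgC.
  have ApMB : {homo @malgC M T : x / x \in Aplus >->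
      x \in (monalg_sub B : subringClosed {malg T[M]})}.
    by move=> x /sApB; apply: homo_malgC.
  transitivity (invmod_map (@malgC M T) sAAp (sub_monalg sAB) AMB ApMB I).
    exact: invmod_map_comp.
  by symmetry; apply: invmod_map_comp.
- move=> I; have AMAp : {homo @malgC M T : x / x \in A >->
      x \in (monalg_sub Aplus : subringClosed {malg T[M]})}.
    by move=> x /sAAp; apply: homo_malgC.
  have BMB : {homo @malgC M T : x / x \in B >->
      x \in (monalg_sub B : subringClosed {malg T[M]})} by apply: homo_malgC.
  transitivity (invmod_map (@malgC M T) sAB (sub_monalg sApB) AMAp BMB I).
    exact: invmod_map_comp.
  by symmetry; apply: invmod_map_comp.
- apply: invmod_theta_bijective => //; exact: subintegral_closure_closed hAp.
Qed.
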